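(* Let $V\cong\mathbb{C}^n$ be a Hermitian vector space, $\Omega\subset V$ a domain and $p:\Omega\to\,]0,+\infty[$ a continuous function. Let $m\ge 1$ be an integer and $$\widehat{\Omega}_m=\{(z,Z)\in\Omega\times\mathbb{C}^m\mid \|Z\|^2<p(z)\},$$ endowed with the volume form $\omega_V(z)\wedge\omega_m(Z)$. Let $$L_0(z,w;r)=\sum_{k=0}^\infty K_{\Omega,p^k}(z,w)\,r^k,\qquad \mathcal{L}_0(z,r)=L_0(z,z;r)$$ be the virtual Bergman kernel of $(\Omega,p)$. Then the Bergman kernel $\widehat{K}_m$ of $\widehat{\Omega}_m$, with diagonal $\widehat{\mathcal{K}}_m(z,Z)=\widehat{K}_m((z,Z),(z,Z))$, is given by $$\widehat{K}_m\big((z,Z),(w,W)\big)=L_m\big(z,w;\langle Z,W\rangle\big),\qquad \widehat{\mathcal{K}}_m(z,Z)=\mathcal{L}_m\big(z,\|Z\|^2\big)$$ for all $(z,Z),(w,W)\in\widehat{\Omega}_m$, where $$L_m(z,w;r)=\frac{1}{m!}\frac{\partial^m}{\partial r^m}L_0(z,w;r),\qquad \mathcal{L}_m(z,r)=\frac{1}{m!}\frac{\partial^m}{\partial r^m}\mathcal{L}_0(z,r).$$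
   Context: The Hermitian norm of $V$ is denoted $\|\cdot\|_V$, and $V$ carries the volume form $\omega_V(z)=\left(\frac{i}{2\pi}\partial\overline{\partial}\|z\|_V^2\right)^n$, i.e. $n!\,\pi^{-n}$ times Lebesgue measure in coordinates with respect to an orthonormal basis. On $\mathbb{C}^m$, $\langle\cdot,\cdot\rangle$ is the standard Hermitian inner product (linear in the first variable, antilinear in the second), $\|\cdot\|$ its norm, and $\omega_m(Z)=\left(\frac{i}{2\pi}\partial\overline{\partial}\|Z\|^2\right)^m$, i.e. $m!\,\pi^{-m}$ times Lebesgue measure. For a continuous function $q:\Omega\to\,]0,+\infty[$, the weighted Bergman space is the Hilbert space $$H(\Omega,q)=\left\{f:\Omega\to\mathbb{C}\text{ holomorphic}\;\Big|\;\int_\Omega |f(z)|^2 q(z)\,\omega_V(z)<\infty\right\},$$ and $K_{\Omega,q}(z,w)$ denotes its reproducing kernel (holomorphic in $z$, antiholomorphic in $w$); $p^k$ is the $k$-th power of $p$, with $p^0=1$. The Bergman kernel $\widehat{K}_m$ is the reproducing kernel of the Hilbert space of holomorphic functions on $\widehat{\Omega}_m$ that are square integrable with respect to $\omega_V(z)\wedge\omega_m(Z)$. (If a space is $\{0\}$, its kernel is $0$.) The functions $L_0,\mathcal{L}_0$ are defined by the displayed power series in $r$, and $\partial^m/\partial r^m$ is term-by-term differentiation of these power series, so that $L_m(z,w;r)=\sum_{k\ge0}\binom{k+m}{m}K_{\Omega,p^{k+m}}(z,w)r^k$. *)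

(* Defs.v *)
From HB Require Import structures.
From mathcomp Require Import all_boot all_order all_algebra.
From mathcomp Require Import spectral sesquilinear.
From mathcomp Require Import complex.
From mathcomp Require Import all_classical all_reals all_analysis.
From mathcomp Require Import ring.

Set Implicit Arguments.
Unset Strict Implicit.
Unset Printing Implicit Defensive.

Import Order.TTheory GRing.Theory Num.Theory.
Import numFieldNormedType.Exports.

Local Open Scope classical_set_scope.
Local Open Scope ring_scope.
Local Open Scope complex_scope.

(* The canonical sigma-finite structure on m1 \x m2 is only found when m1 and m2
   are subprobabilities, hence this copy. *)
Section ProductMeasure.
Local Open Scope ereal_scope.
Context d1 d2 (T1 : measurableType d1) (T2 : measurableType d2) (R : realType).
Variable m1 : {sigma_finite_measure set T1 -> \bar R}.
Variable m2 : {sigma_finite_measure set T2 -> \bar R}.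

Definition prod_measure : set (T1 * T2) -> \bar R := m1 \x m2.
HB.instance Definition _ := Measure.on prod_measure.

Let prod_measure_sigma_finite : sigma_finite [set: T1 * T2] prod_measure.
Proof.
have /sigma_finiteP[F [TF ndF Foo]] := sigma_finiteT m1.
have /sigma_finiteP[G [TG ndG Goo]] := sigma_finiteT m2.
exists (fun n => F n `*` G n).
  rewrite -setXTT TF TG predeqE => -[x y]; split.
    move=> [/= [i _ Fix] [k _ Gky]]; exists (maxn i k) => //; split.
    - by move: x Fix; exact/subsetPset/ndF/leq_maxl.
    - by move: y Gky; exact/subsetPset/ndG/leq_maxr.
  by move=> [i _ []/= ? ?]; split; exists i.
move=> k; have [? ?] := Foo k; have [? ?] := Goo k.
split; first exact: measurableX.
by rewrite /prod_measure product_measure1E// lte_mul_pinfty// ge0_fin_numE.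
Qed.

HB.instance Definition _ := Measure_isSigmaFinite.Build _ _ _ prod_measure
  prod_measure_sigma_finite.

End ProductMeasure.

(* The pair (a, b) stands for the complex number a + ib. *)
Notation Rpair R := (measurableTypeR R * measurableTypeR R)%type.

Section LebesgueMeasureOnCn.
Variable R : realType.

Definition to_complex (x : Rpair R) : R[i] := Complex (x.1 : R) (x.2 : R).

Definition lebesgue_R : {sigma_finite_measure set (measurableTypeR R) -> \bar R} :=
  @lebesgue_measure R.

Definition lebesgue_pair : {sigma_finite_measure set (Rpair R) -> \bar R} :=
  prod_measure lebesgue_R lebesgue_R.

Section cons_measure.
Variables (n : nat) (mu : {sigma_finite_measure set (n.-tuple (Rpair R)) -> \bar R}).

Definition cons_pair (x : Rpair R * n.-tuple (Rpair R)) : n.+1.-tuple (Rpair R) :=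
  [the n.+1.-tuple (Rpair R) of x.1 :: x.2].

Let uncons_pair (t : n.+1.-tuple (Rpair R)) : Rpair R * n.-tuple (Rpair R) :=
  (thead t, [tuple of behead t]).

Let measurable_cons_pair : measurable_fun [set: Rpair R * n.-tuple (Rpair R)] cons_pair.
Proof. exact: measurable_cons. Qed.

Let measurable_uncons_pair : measurable_fun [set: n.+1.-tuple (Rpair R)] uncons_pair.
Proof.
apply: measurable_fun_pair; last exact: measurable_behead.
exact: measurable_tnth.
Qed.

Let cons_pairK : cancel cons_pair uncons_pair.
Proof.
by case=> x t; rewrite /uncons_pair theadE; congr pair; exact: val_inj.
Qed.

Definition cons_measure : set (n.+1.-tuple (Rpair R)) -> \bar R :=
  pushforward (prod_measure lebesgue_pair mu) cons_pair.

Let cons_measure0 : cons_measure set0 = 0%E.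
Proof. by rewrite /cons_measure /pushforward preimage_set0 measure0. Qed.

Let cons_measure_ge0 A : (0 <= cons_measure A)%E.
Proof. exact: measure_ge0. Qed.

Let cons_measure_sigma_additive : semi_sigma_additive cons_measure.
Proof.
exact: (@measure_semi_sigma_additive _ _ _
  (measure_function_pushforward__canonical__measure_function_Measure
     (prod_measure lebesgue_pair mu) measurable_cons_pair)).
Qed.

HB.instance Definition _ := isMeasure.Build _ _ _ cons_measure
  cons_measure0 cons_measure_ge0 cons_measure_sigma_additive.

Let cons_measure_sigma_finite : sigma_finite [set: n.+1.-tuple (Rpair R)] cons_measure.
Proof.
have [F FT Foo] := sigma_finiteT (prod_measure lebesgue_pair mu).
exists (fun k => uncons_pair @^-1` F k).
  by rewrite -preimage_bigcup -FT preimage_setT.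
move=> k; have [mF Fk] := Foo k; split.
  by rewrite -[X in measurable X]setTI; exact: measurable_uncons_pair.
rewrite /cons_measure /pushforward (_ : _ @^-1` _ = F k)//.
by apply/seteqP; split=> x; rewrite /preimage /= cons_pairK.
Qed.

HB.instance Definition _ := Measure_isSigmaFinite.Build _ _ _ cons_measure
  cons_measure_sigma_finite.

End cons_measure.

Fixpoint lebesgue_Cn (n : nat) :
    {sigma_finite_measure set (n.-tuple (Rpair R)) -> \bar R} :=
  match n with
  | 0 => \d_([tuple])
  | n'.+1 => cons_measure (lebesgue_Cn n')
  end.

Definition volume_const (n : nat) : {nonneg R} :=
  NngNum (divr_ge0 (ler0n R n`!) (exprn_ge0 n (pi_ge0 R))).

(* (i / 2 pi * ddbar |z|^2)^n in the coordinates of an orthonormal basis *)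
Definition volume_Cn (n : nat) : set (n.-tuple (Rpair R)) -> \bar R :=
  mscale (volume_const n) (lebesgue_Cn n).
HB.instance Definition _ n := Measure.on (@volume_Cn n).

Let volume_Cn_sigma_finite n : sigma_finite [set: n.-tuple (Rpair R)] (@volume_Cn n).
Proof.
have [F FT Foo] := sigma_finiteT (lebesgue_Cn n).
exists F => // k; have [mF Fk] := Foo k; split=> //.
by rewrite /volume_Cn /mscale lte_mul_pinfty.
Qed.

HB.instance Definition _ n := Measure_isSigmaFinite.Build _ _ _ (@volume_Cn n)
  (@volume_Cn_sigma_finite n).

End LebesgueMeasureOnCn.
Arguments volume_Cn {R} n A.

Section Coordinates.
Variable R : realType.

Definition coord_map (V : lmodType R[i]) (n : nat) (e : 'I_n -> V)
    (x : n.-tuple (Rpair R)) : V :=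
  \sum_(i < n) to_complex (tnth x i) *: e i.

Definition std_coord_map (m : nat) (x : m.-tuple (Rpair R)) : 'rV[R[i]]_m :=
  \row_(i < m) to_complex (tnth x i).

Definition prod_coord_map (V : lmodType R[i]) (n : nat) (e : 'I_n -> V) (m : nat)
    (x : n.-tuple (Rpair R) * m.-tuple (Rpair R)) : V * 'rV[R[i]]_m :=
  (coord_map e x.1, std_coord_map x.2).

Definition orthonormal_basis (V : lmodType R[i]) (dot : {dot V for Num.conj})
    (n : nat) (e : 'I_n -> V) : Prop :=
  (forall i j, dot (e i) (e j) = (i == j)%:R) /\
  (forall v, exists c : 'I_n -> R[i], v = \sum_(i < n) c i *: e i).

End Coordinates.

Definition is_domain (T : topologicalType) (D : set T) : Prop :=
  [/\ open D, connected D & D !=set0].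

Section BergmanSpace.
Variable R : realType.

Definition holomorphic_on (E : normedModType R[i]) (D : set E) (f : E -> R[i]) : Prop :=
  forall z, D z -> differentiable (f : E -> R[i]^o) z.

Section weighted.
Context d (X : measurableType d) (mu : {measure set X -> \bar R}).
Variables (E : normedModType R[i]) (phi : X -> E) (D : set E) (q : E -> R).

Definition complex_integral (A : set X) (F : X -> R[i]) : R[i] :=
  Complex (Rintegral mu A (fun x => complex.Re (F x)))
          (Rintegral mu A (fun x => complex.Im (F x))).

(* E carries the measure mu through the parametrization phi.  Functions on D
   are represented by functions on E whose values outside D are irrelevant. *)
Definition bergman_space : set (E -> R[i]) :=
  [set f | holomorphic_on D f /\
    (\int[mu]_(x in phi @^-1` D)
       (ComplexField.Normc.normc (f (phi x)) ^+ 2 * q (phi x))%:E < +oo)%E].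

Definition bergman_dot (f g : E -> R[i]) : R[i] :=
  complex_integral (phi @^-1` D)
    (fun x => f (phi x) * (g (phi x))^* * (q (phi x))%:C).

Definition is_reproducing_kernel (K : E -> E -> R[i]) : Prop :=
  forall w, D w ->
    bergman_space (K^~ w) /\
    (forall f, bergman_space f -> f w = bergman_dot f (K^~ w)).

Let RintegralN_total (A : set X) (g : X -> R) :
  Rintegral mu A (fun x => - g x) = - Rintegral mu A g.
Proof.
rewrite /Rintegral [in LHS]integralE [in RHS]integralE.
have -> : (fun x => (- g x)%:E)^\+%E = (fun x => (g x)%:E)^\-%E.
  by rewrite -funeposN.
have -> : (fun x => (- g x)%:E)^\-%E = (fun x => (g x)%:E)^\+%E.
  by rewrite -funenegN.
have := integral_ge0 mu (fun x (_ : A x) => funepos_ge0 (EFin \o g) x).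
have := integral_ge0 mu (fun x (_ : A x) => funeneg_ge0 (EFin \o g) x).
rewrite /comp.
generalize (\int[mu]_(x in A) ((fun x => (g x)%:E)^\- x))%E.
generalize (\int[mu]_(x in A) ((fun x => (g x)%:E)^\+ x))%E.
by move=> a b; case: a b => [a| |] [b| |] //= _ _; rewrite ?oppr0 ?opprB.
Qed.

Let bergman_dotC f g : bergman_dot g f = (bergman_dot f g)^*.
Proof.
rewrite /bergman_dot /complex_integral /= -RintegralN_total.
congr Complex; congr (Rintegral _ _ _); apply/funext => x;
  by case: (f _) (g _) => a b [c e] /=; ring.
Qed.

Lemma reproducing_kernel_unique (K K' : E -> E -> R[i]) :
  is_reproducing_kernel K -> is_reproducing_kernel K' ->
  forall z w, D z -> D w -> K z w = K' z w.
Proof.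
move=> hK hK'.
have swap (L L' : E -> E -> R[i]) : is_reproducing_kernel L ->
    is_reproducing_kernel L' -> forall z w, D z -> D w -> L z w = (L' w z)^*.
  move=> hL hL' z w Dz Dw; have [Lw Lrep] := hL w Dw.
  have [Lz' Lrep'] := hL' z Dz.
  by rewrite (Lrep' _ Lw) (Lrep _ Lz') bergman_dotC.
by move=> z w Dz Dw; rewrite (swap K K) // (swap K' K) // .
Qed.

End weighted.
End BergmanSpace.

Section HartogsDomain.
Variable R : realType.

(* dotmx Z W = \sum_i Z_i * (W_i)^*, the standard Hermitian inner product *)
Definition sqnorm (m : nat) (Z : 'rV[R[i]]_m) : R := complex.Re (dotmx Z Z).

Definition hartogs_domain (V : Type) (Omega : set V) (p : V -> R) (m : nat) :
    set (V * 'rV[R[i]]_m) :=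
  [set zZ | Omega zZ.1 /\ sqnorm zZ.2 < p zZ.1].

End HartogsDomain.

(* Power series are represented by their sequences of coefficients. *)
Section VirtualBergmanKernel.
Variable R : realType.

Definition power_series (a : nat -> R[i]) (r : R[i]) : nat -> R[i]^o :=
  [series (a k * r ^+ k : R[i]^o)]_k.

Definition power_series_sum (a : nat -> R[i]) (r : R[i]) : R[i] :=
  limn (power_series a r).

Definition termwise_derivative (a : nat -> R[i]) : nat -> R[i] :=
  fun k => k.+1%:R * a k.+1.

(* (1 / m!) d^m/dr^m *)
Definition normalized_derivative (m : nat) (a : nat -> R[i]) : nat -> R[i] :=
  fun k => (m`!%:R)^-1 * iter m termwise_derivative a k.

Variables (V : Type) (K : nat -> V -> V -> R[i]).

Definition L0_coef (z w : V) : nat -> R[i] := fun k => K k z w.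

Definition L0 (z w : V) (r : R[i]) : R[i] := power_series_sum (L0_coef z w) r.

Definition Lm_coef (m : nat) (z w : V) : nat -> R[i] :=
  normalized_derivative m (L0_coef z w).

Definition Lm (m : nat) (z w : V) (r : R[i]) : R[i] :=
  power_series_sum (Lm_coef m z w) r.

Definition diagL0_coef (z : V) : nat -> R[i] := L0_coef z z.

Definition diagL0 (z : V) (r : R) : R[i] := power_series_sum (diagL0_coef z) r%:C.

Definition diagLm_coef (m : nat) (z : V) : nat -> R[i] :=
  normalized_derivative m (diagL0_coef z).

Definition diagLm (m : nat) (z : V) (r : R) : R[i] :=
  power_series_sum (diagLm_coef m z) r%:C.

End VirtualBergmanKernel.

(* Main.v *)
Require Import Defs.
From HB Require Import structures.
From mathcomp Require Import all_boot all_order all_algebra.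
From mathcomp Require Import spectral sesquilinear.
From mathcomp Require Import complex.
From mathcomp Require Import all_classical all_reals all_analysis.
From mathcomp Require Import perm measurable_realfun.
From mathcomp Require Import ring lra.

(** Fix (w, W) in the Hartogs domain D and put G = Khat(., (w, W)).  For a unit
vector u of C^m let j_k(z) be the k-th Taylor coefficient at 0 of the function
l |-> G(z, l u) of one complex variable ([direction_coef]).  The theorem amounts to
    j_k(z) = binomial(k + m, m) K_(k+m)(z, w) <u, W>^k
([direction_coef_kernel]).  Indeed, for Z = a u, the series of the j_k(z) a^k has
sum G(z, Z) by Taylor's formula on the disc |l|^2 < p(z); and since
a <u, W> = <Z, W> it is also the series L_m(z, w; <Z, W>), whose k-th coefficient
is binomial(k + m, m) K_(k+m)(z, w) ([normalized_derivativeE]).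

To compute j_k, pair G with F(z, Z) = h(z) <Z, u>^k, where h is in
H(Omega, p^(k+m)).  The ball |Z|^2 < p(z) and its volume are invariant under unitary
maps.  Averaging G(z, Z) conj(<Z, u>)^k over the rotations of the orthogonal of u
replaces Z by <Z, u> u, by the mean value property; averaging then over the rotations
of the line of u leaves j_k(z) |<Z, u>|^(2k).  Hence
    int G(z, Z) conj(<Z, u>)^k dZ = j_k(z) p(z)^(k+m) / binomial(k + m, m)
([ball_integral]), the factor of j_k(z) being the integral of |<Z, u>|^(2k).
This gives two things: by Cauchy-Schwarz on the fibers ([ball_bessel]), j_k lies in
H(Omega, p^(k+m)); by Fubini, <G, F> = <j_k, h> / binomial(k + m, m)
([direction_pairing]).  For h = K_(k+m)(., z) the reproducing property of K_(k+m)
turns <j_k, h> into j_k(z), that of Khat turns <F, G> into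
F(w, W) = K_(k+m)(w, z) <W, u>^k, and conjugating gives the formula for j_k.

The function theory behind this is obtained from Goursat's theorem for closed forms
on a rectangle ([goursat]).  In the coordinates (s, t) of the point
z + e^s (r e^(it) - z) it shows that the Cauchy integral over shrinking curves is
constant, whence Cauchy's formula and the Taylor expansion with remainder
([cauchy_formula], [taylor_remainder]).  That j_k is holomorphic in z follows from
Weierstrass' theorem on uniform limits ([hdiff_uniform_limit], [hdiff_taylor_coef]).
On the side of measures, the argument for the uniqueness of Haar measure
([haar_uniqueness]) gives the behaviour of Lebesgue measure under dilations of the
plane and under unitary maps, and polar coordinates ([polar_integral]) give the
moments of balls ([integral_ball_moment]). *)

Set Implicit Arguments.
Unset Strict Implicit.
Unset Printing Implicit Defensive.

Import Order.TTheory GRing.Theory Num.Theory.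
Import numFieldNormedType.Exports.

Local Open Scope classical_set_scope.
Local Open Scope ring_scope.
Local Open Scope complex_scope.

(** * Modulus and limits of complex-valued functions *)

Notation normc := ComplexField.Normc.normc.

Section ComplexTopology.
Variable R : realType.
Implicit Types z w : R[i].

Lemma norm_normcE z : `|z| = (normc z)%:C.
Proof. by []. Qed.

Lemma normc_ge0 z : 0 <= normc z.
Proof. by case: z => a b; rewrite /= sqrtr_ge0. Qed.

Lemma normcD z w : normc (z + w) <= normc z + normc w.
Proof. exact: (@le_normcD R). Qed.

Lemma normcN z : normc (- z) = normc z.
Proof. exact: (@normcN R). Qed.

Lemma normcB z w : normc (z - w) <= normc z + normc w.
Proof. by rewrite -(normcN w); exact: normcD. Qed.

Lemma normc_distC z w : normc (z - w) = normc (w - z).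
Proof. by rewrite -normcN opprB. Qed.

Lemma normcM z w : normc (z * w) = normc z * normc w.
Proof. exact: ComplexField.Normc.normcM. Qed.

Lemma normcX z k : normc (z ^+ k) = normc z ^+ k.
Proof.
elim: k => [|k IH]; first by rewrite !expr0 ComplexField.Normc.normc1.
by rewrite !exprS normcM IH.
Qed.

Lemma normcV z : normc z^-1 = (normc z)^-1.
Proof. exact: ComplexField.Normc.normcV. Qed.

Lemma normc0 : normc (0 : R[i]) = 0.
Proof. exact: ComplexField.Normc.normc0. Qed.

Lemma normc1 : normc (1 : R[i]) = 1.
Proof. exact: ComplexField.Normc.normc1. Qed.

Lemma normc_real (x : R) : normc x%:C = `|x|.
Proof. by rewrite /= expr0n addr0 sqrtr_sqr. Qed.

Lemma normc_eq0 z : (normc z == 0) = (z == 0).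
Proof.
by apply/eqP/eqP => [/ComplexField.Normc.eq0_normc//|->]; rewrite normc0.
Qed.

Lemma normc_gt0 z : (0 < normc z) = (z != 0).
Proof. by rewrite lt_neqAle normc_ge0 andbT eq_sym normc_eq0. Qed.

Lemma normc_sqr z : normc z ^+ 2 = complex.Re z ^+ 2 + complex.Im z ^+ 2.
Proof. by case: z => a b /=; rewrite sqr_sqrtr// addr_ge0 ?sqr_ge0. Qed.

Lemma normc_conj z : normc z^* = normc z.
Proof. by case: z => a b /=; rewrite sqrrN. Qed.

Lemma mulcJ z : z * z^* = (normc z ^+ 2)%:C.
Proof. by rewrite normc_sqr; case: z => a b /=; simpc; congr Complex; ring. Qed.

Lemma Re_le_normc z : `|complex.Re z| <= normc z.
Proof.
rewrite -(ler_pXn2r (_ : 0 < 2)%N) ?nnegrE ?normc_ge0//.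
by rewrite real_normK ?num_real// normc_sqr lerDl sqr_ge0.
Qed.

Lemma Im_le_normc z : `|complex.Im z| <= normc z.
Proof.
rewrite -(ler_pXn2r (_ : 0 < 2)%N) ?nnegrE ?normc_ge0//.
by rewrite real_normK ?num_real// normc_sqr lerDr sqr_ge0.
Qed.

Lemma normc_le_ReIm z : normc z <= `|complex.Re z| + `|complex.Im z|.
Proof.
rewrite -(ler_pXn2r (_ : 0 < 2)%N) ?nnegrE ?normc_ge0 ?addr_ge0//.
rewrite normc_sqr sqrrD !real_normK ?num_real//.
by rewrite lerD2r lerDl mulrn_wge0// mulr_ge0.
Qed.

Lemma ltcR_norm z (x : R) : (`|z| < x%:C) = (normc z < x).
Proof. by rewrite norm_normcE ltcR. Qed.

Lemma gtc0_real (e : R[i]) : 0 < e -> exists2 x, 0 < x & e = x%:C.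
Proof.
by case: e => a b; rewrite ltcE/= => /andP[/eqP -> a0]; exists a.
Qed.

(** Limits of complex-valued functions are phrased with the real-valued modulus,
    so that all epsilons are real numbers; the topology of the normed space R[i]^o
    has radii in R[i]. *)
Definition nbhsc z : set_system R[i] :=
  [set P | exists2 e, 0 < e & forall w, normc (w - z) < e -> P w].

Definition cvgc {T : Type} (F : set_system T) (f : T -> R[i]) (a : R[i]) :=
  forall e, 0 < e -> F [set x | normc (a - f x) < e].

Global Instance nbhsc_filter z : ProperFilter (nbhsc z).
Proof.
split; first by move=> [e e0 /(_ z)]; apply; rewrite subrr normc0.
split=> [|P Q [e e0 eP] [d d0 dQ]|P Q PQ [e e0 eP]]; first by exists 1.
  exists (Num.min e d) => [|w]; first by rewrite lt_min e0.
  by rewrite lt_min => /andP[/eP ? /dQ].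
by exists e => // w /eP /PQ.
Qed.

Lemma cvgc_cst {T : Type} {F : set_system T} {FF : Filter F} (a : R[i]) :
  cvgc F (fun=> a) a.
Proof. by move=> e e0; apply: nearW => x; rewrite /= subrr normc0. Qed.

Lemma cvgc_id z : cvgc (nbhsc z) id z.
Proof. by move=> e e0; exists e => // w; rewrite /= normc_distC. Qed.

Lemma cvgc_comp {T : Type} {F : set_system T} {FF : Filter F} (f : T -> R[i])
    (g : R[i] -> R[i]) a b :
  cvgc F f a -> cvgc (nbhsc a) g b -> cvgc F (g \o f) b.
Proof.
move=> fa gb e e0; have [d d0 dg] := gb e e0.
by apply: filterS (fa d d0) => x /=; rewrite normc_distC => /dg.
Qed.

Lemma cvgc_compl {T S : Type} {F : set_system T} {G : set_system S}
    (f : S -> T) (g : T -> R[i]) b :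
  f @ G `=>` F -> cvgc F g b -> cvgc G (g \o f) b.
Proof. by move=> fa gb e e0; exact: fa (gb e e0). Qed.

Lemma cvgc_ReIm {T : Type} {F : set_system T} {FF : Filter F} (f : T -> R[i]) a :
  cvgc F f a <->
  (complex.Re (f x) @[x --> F] --> complex.Re a /\
   complex.Im (f x) @[x --> F] --> complex.Im a).
Proof.
split=> [H|[HR HI]].
  split; apply/cvgrPdist_lt => e e0; apply: filterS (H _ e0) => x;
  apply: le_lt_trans.
    by rewrite -raddfB; exact: Re_le_normc.
  by rewrite -raddfB; exact: Im_le_normc.
move=> e e0; have e20 : 0 < e / 2 by rewrite divr_gt0.
near=> x.
have H1 : `|complex.Re a - complex.Re (f x)| < e / 2.
  by near: x; move/cvgrPdist_lt : HR; exact.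
have H2 : `|complex.Im a - complex.Im (f x)| < e / 2.
  by near: x; move/cvgrPdist_lt : HI; exact.
apply: (le_lt_trans (normc_le_ReIm _)).
by rewrite !raddfB/= [e]splitr ltrD.
Unshelve. all: by end_near. Qed.

Section limits.
Context {T : Type} {F : set_system T} {FF : Filter F}.
Implicit Types (f g : T -> R[i]) (a b : R[i]).

Lemma cvgcD f g a b : cvgc F f a -> cvgc F g b -> cvgc F (fun x => f x + g x) (a + b).
Proof.
move=> /cvgc_ReIm[f1 f2] /cvgc_ReIm[g1 g2]; apply/cvgc_ReIm; split.
  under eq_fun do rewrite raddfD; rewrite raddfD; exact: cvgD.
under eq_fun do rewrite raddfD; rewrite raddfD; exact: cvgD.
Qed.

Lemma cvgcM f g a b : cvgc F f a -> cvgc F g b -> cvgc F (fun x => f x * g x) (a * b).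
Proof.
have ReM (z w : R[i]) : complex.Re (z * w) =
    complex.Re z * complex.Re w - complex.Im z * complex.Im w.
  by case: z w => [? ?] [].
have ImM (z w : R[i]) : complex.Im (z * w) =
    complex.Re z * complex.Im w + complex.Im z * complex.Re w.
  by case: z w => [? ?] [].
move=> /cvgc_ReIm[f1 f2] /cvgc_ReIm[g1 g2]; apply/cvgc_ReIm; split.
  under eq_fun do rewrite ReM; rewrite ReM; apply: cvgB; exact: cvgM.
under eq_fun do rewrite ImM; rewrite ImM; apply: cvgD; exact: cvgM.
Qed.

Lemma cvgcZ f a b : cvgc F f a -> cvgc F (fun x => b * f x) (b * a).
Proof. by move=> fa; apply: cvgcM => //; exact: cvgc_cst. Qed.

Lemma cvgcN f a : cvgc F f a -> cvgc F (fun x => - f x) (- a).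
Proof. by move=> H e /H; apply: filterS => x /=; rewrite -normcN opprD !opprK. Qed.

Lemma cvgcB f g a b : cvgc F f a -> cvgc F g b -> cvgc F (fun x => f x - g x) (a - b).
Proof. by move=> fa /cvgcN gb; exact: cvgcD fa gb. Qed.

Lemma cvgcV f a : a != 0 -> cvgc F f a -> cvgc F (fun x => (f x)^-1) a^-1.
Proof.
move=> a0 fa e e0; have na0 : 0 < normc a by rewrite normc_gt0.
have d0 : 0 < Num.min (normc a / 2) (e * normc a ^+ 2 / 2).
  by rewrite lt_min !(divr_gt0, mulr_gt0, exprn_gt0).
apply: filterS (fa _ d0) => x /=; rewrite lt_min => /andP[h1 h2].
have fx : normc a / 2 < normc (f x).
  by have := normcD (a - f x) (f x); rewrite subrK; lra.
have fx0 : f x != 0 by rewrite -normc_gt0; lra.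
rewrite (_ : a^-1 - (f x)^-1 = (f x - a) / (a * f x)); last first.
  by field; rewrite a0 fx0.
rewrite normcM normcV normcM normc_distC ltr_pdivrMr; last first.
  by rewrite mulr_gt0// normc_gt0.
apply: (lt_le_trans h2); rewrite expr2 mulrA -!mulrA !ler_wpM2l// ?normc_ge0 ?ltW//.
Qed.

Lemma cvgc_real (f : T -> R) (a : R) :
  f x @[x --> F] --> a -> cvgc F (fun x => (f x)%:C) a%:C.
Proof. by move=> fa; apply/cvgc_ReIm; split => //=; exact: cvg_cst. Qed.

Lemma cvgc_normc f a : cvgc F f a -> normc (f x) @[x --> F] --> normc a.
Proof.
move=> fa; apply/cvgrPdist_lt => e e0.
apply: filterS (fa e e0) => x; apply: le_lt_trans.
rewrite ler_norml; have := normcD (a - f x) (f x); have := normcD (f x - a) a.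
by rewrite !subrK (normc_distC (f x)); lra.
Qed.

End limits.

Lemma cvg_normcP {T : Type} {F : set_system T} {FF : Filter F} (f : T -> R[i]) a :
  (f x : R[i]^o) @[x --> F] --> (a : R[i]^o) <-> cvgc F f a.
Proof.
split=> [/cvgrPdist_lt H e e0|H].
  have := H (e%:C); rewrite ltcR => /(_ e0).
  by apply: filterS => x; rewrite /= ltcR_norm.
apply/cvgrPdist_lt => _ /gtc0_real[e e0 ->].
by apply: filterS (H _ e0) => x; rewrite /= ltcR_norm.
Qed.

End ComplexTopology.

(** * Goursat's theorem on rectangles *)

Section SegmentIntegral.
Variable R : realType.
Implicit Types (a b c e : R) (f g : R -> R).

Definition seg_int a b f : R := \int[@lebesgue_measure R]_(x in `[a, b]) f x.

Definition seg_cont a b f := forall x, a <= x <= b -> {for x, continuous f}.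

Lemma seg_cont_integrable a b f : seg_cont a b f ->
  (@lebesgue_measure R).-integrable `[a, b] (EFin \o f).
Proof.
move=> cf; apply: continuous_compact_integrable; first exact: segment_compact.
apply/continuous_in_subspaceT => x; rewrite inE/= in_itv/=.
exact: cf.
Qed.

Lemma seg_intD a b f g : seg_cont a b f -> seg_cont a b g ->
  seg_int a b (fun x => f x + g x) = seg_int a b f + seg_int a b g.
Proof. by move=> *; apply: RintegralD => //; exact: seg_cont_integrable. Qed.

Lemma seg_intB a b f g : seg_cont a b f -> seg_cont a b g ->
  seg_int a b (fun x => f x - g x) = seg_int a b f - seg_int a b g.
Proof. by move=> *; apply: RintegralB => //; exact: seg_cont_integrable. Qed.

Lemma seg_intZ a b f c : seg_cont a b f ->
  seg_int a b (fun x => c * f x) = c * seg_int a b f.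
Proof. by move=> *; apply: RintegralZl => //; exact: seg_cont_integrable. Qed.

Lemma seg_int_cst a b c : a <= b -> seg_int a b (fun=> c) = c * (b - a).
Proof.
move=> ab; rewrite /seg_int Rintegral_cst//= lebesgue_measure_itv/= lte_fin.
by move: ab; rewrite le_eqVlt => /predU1P[->|->]; rewrite ?ltxx ?subrr.
Qed.

Lemma eq_seg_int a b f g : (forall x, a <= x <= b -> f x = g x) ->
  seg_int a b f = seg_int a b g.
Proof. by move=> fg; apply: eq_Rintegral => x; rewrite inE/= in_itv/= => /fg. Qed.

Lemma seg_int_split a c b f : a <= c -> c <= b -> seg_cont a b f ->
  seg_int a b f = seg_int a c f + seg_int c b f.
Proof.
move=> ac cb /seg_cont_integrable fi.
rewrite /seg_int; apply/eqP; rewrite addrC -subr_eq; apply/eqP.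
rewrite Rintegral_itvB//= ?bnd_simp//.
rewrite Rintegral_itv_obnd_cbnd//; apply: integrableS fi => //.
by apply: subset_itvr; rewrite bnd_simp.
Qed.

Lemma seg_cont_cst a b c : seg_cont a b (fun=> c).
Proof. by move=> x _; exact: cst_continuous. Qed.

Lemma seg_contB a b f g : seg_cont a b f -> seg_cont a b g ->
  seg_cont a b (fun x => f x - g x).
Proof. by move=> cf cg x xab; apply: cvgB; [exact: cf|exact: cg]. Qed.

Lemma seg_contM a b f g : seg_cont a b f -> seg_cont a b g ->
  seg_cont a b (fun x => f x * g x).
Proof. by move=> cf cg x xab; apply: cvgM; [exact: cf|exact: cg]. Qed.

Lemma seg_int_le a b f e : a <= b -> seg_cont a b f ->
  (forall x, a <= x <= b -> `|f x| <= e) -> `|seg_int a b f| <= e * (b - a).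
Proof.
move=> ab cf fe; have fi := seg_cont_integrable cf.
apply: (le_trans (le_normr_Rintegral _ fi)) => //.
rewrite -seg_int_cst//; apply: le_Rintegral => //.
- apply: (@seg_cont_integrable a b (fun x => `|f x|)) => x xab.
  by apply: cvg_norm; exact: cf.
- exact: (seg_cont_integrable (@seg_cont_cst a b e)).
Qed.

Lemma seg_int_near a b f c e : a <= b -> seg_cont a b f ->
  (forall x, a <= x <= b -> `|f x - c| <= e) ->
  `|seg_int a b f - c * (b - a)| <= e * (b - a).
Proof.
move=> ab cf fe; rewrite -seg_int_cst// -seg_intB//; last exact: seg_cont_cst.
by apply: seg_int_le => //; exact/seg_contB/seg_cont_cst.
Qed.

End SegmentIntegral.

Section Goursat.
Variable R : realType.
Implicit Types (A B : R -> R -> R) (s t e : R).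

(** The form A ds + B dt is differentiable at (s, t); it is closed there because
    the coefficient a2 is shared by dA/dt and dB/ds. *)
Definition closed_form_at A B s t := exists a1 a2 b2, forall e, 0 < e ->
  exists2 d, 0 < d & forall s' t', `|s' - s| < d -> `|t' - t| < d ->
    `|A s' t' - A s t - a1 * (s' - s) - a2 * (t' - t)|
      <= e * (`|s' - s| + `|t' - t|) /\
    `|B s' t' - B s t - a2 * (s' - s) - b2 * (t' - t)|
      <= e * (`|s' - s| + `|t' - t|).

Definition boundary_int A B s s' t t' :=
  seg_int s s' (fun x => A x t - A x t') + seg_int t t' (fun y => B s' y - B s y).

Lemma affine_approx_continuous (f : R -> R) (x a : R) :
  (forall e, 0 < e -> exists2 d, 0 < d & forall y, `|y - x| < d ->
     `|f y - f x - a * (y - x)| <= e * `|y - x|) -> {for x, continuous f}.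
Proof.
move=> H; have [d d0 Hd] := H 1 ltr01.
apply/cvgrPdist_le => e e0.
have k0 : 0 < 1 + `|a| by rewrite ltr_wpDr.
near=> y.
have yd : `|y - x| < d.
  by near: y; exists d => //= y; rewrite /ball/= distrC.
have ye : `|y - x| <= e / (1 + `|a|).
  near: y; exists (e / (1 + `|a|)) => /=; first by rewrite divr_gt0.
  by move=> y; rewrite /ball/= distrC => /ltW.
have := Hd _ yd; rewrite mul1r => Hy.
rewrite distrC (_ : f y - f x = (f y - f x - a * (y - x)) + a * (y - x)); last by ring.
rewrite (le_trans (ler_normD _ _))// normrM.
rewrite (@le_trans _ _ ((1 + `|a|) * `|y - x|))//; first by rewrite mulrDl mul1r lerD2r.
by rewrite -ler_pdivlMl// mulrC.
Unshelve. all: by end_near. Qed.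

Lemma closed_form_cont1 A B s t : closed_form_at A B s t ->
  {for s, continuous (A^~ t)} /\ {for s, continuous (B^~ t)}.
Proof.
move=> [a1 [a2 [b2 H]]]; split.
  apply: (@affine_approx_continuous _ _ a1) => e /H[d d0 Hd]; exists d => // y yd.
  have [|+ _] := Hd y t yd; first by rewrite subrr normr0.
  by rewrite subrr normr0 mulr0 subr0 addr0.
apply: (@affine_approx_continuous _ _ a2) => e /H[d d0 Hd]; exists d => // y yd.
have [|_] := Hd y t yd; first by rewrite subrr normr0.
by rewrite subrr normr0 mulr0 subr0 addr0.
Qed.

Lemma closed_form_cont2 A B s t : closed_form_at A B s t ->
  {for t, continuous (A s)} /\ {for t, continuous (B s)}.
Proof.
move=> [a1 [a2 [b2 H]]]; split.
  apply: (@affine_approx_continuous _ _ a2) => e /H[d d0 Hd]; exists d => // y yd.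
  have [||+ _] := Hd s y; rewrite ?subrr ?normr0//.
  by rewrite mulr0 subr0 add0r.
apply: (@affine_approx_continuous _ _ b2) => e /H[d d0 Hd]; exists d => // y yd.
have [||_] := Hd s y; rewrite ?subrr ?normr0//.
by rewrite mulr0 subr0 add0r.
Qed.

Section rectangle.
Variables (A B : R -> R -> R) (s0 s1 t0 t1 : R).
Hypothesis closedAB : forall s t, s0 <= s <= s1 -> t0 <= t <= t1 ->
  closed_form_at A B s t.

Lemma closed_form_seg1 (s s' t : R) : s0 <= s -> s' <= s1 -> t0 <= t <= t1 ->
  seg_cont s s' (A^~ t) /\ seg_cont s s' (B^~ t).
Proof.
move=> ss ss' tt; split => x xs;
  by have [] := @closed_form_cont1 A B x t _ => //; apply: closedAB => //; lra.
Qed.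

Lemma closed_form_seg2 (s t t' : R) : s0 <= s <= s1 -> t0 <= t -> t' <= t1 ->
  seg_cont t t' (A s) /\ seg_cont t t' (B s).
Proof.
move=> ss ss' tt; split => x xs;
  by have [] := @closed_form_cont2 A B s x _ => //; apply: closedAB => //; lra.
Qed.

Lemma boundary_int_split1 (s c s' t t' : R) : s0 <= s -> s <= c -> c <= s' -> s' <= s1 ->
  t0 <= t -> t <= t' -> t' <= t1 ->
  boundary_int A B s s' t t' = boundary_int A B s c t t' + boundary_int A B c s' t t'.
Proof.
move=> h1 h2 h3 h4 h5 h6 h7; rewrite /boundary_int (@seg_int_split _ s c s')//; last first.
  have [|||c1 _] := @closed_form_seg1 s s' t; [lra|lra|lra|].
  have [|||c2 _] := @closed_form_seg1 s s' t'; [lra|lra|lra|].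
  exact: seg_contB c1 c2.
have [|||_ c1] := @closed_form_seg2 s t t'; [lra|lra|lra|].
have [|||_ c2] := @closed_form_seg2 c t t'; [lra|lra|lra|].
have [|||_ c3] := @closed_form_seg2 s' t t'; [lra|lra|lra|].
rewrite (@eq_seg_int _ t t' (fun y => B s' y - B s y)
   (fun y => (B s' y - B c y) + (B c y - B s y))); last by move=> x _; ring.
rewrite (@seg_intD _ t t' (fun y => B s' y - B c y) (fun y => B c y - B s y));
  [ring|exact: seg_contB c3 c2|exact: seg_contB c2 c1].
Qed.

Lemma boundary_int_split2 (s s' t c t' : R) : s0 <= s -> s <= s' -> s' <= s1 ->
  t0 <= t -> t <= c -> c <= t' -> t' <= t1 ->
  boundary_int A B s s' t t' = boundary_int A B s s' t c + boundary_int A B s s' c t'.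
Proof.
move=> h1 h2 h3 h4 h5 h6 h7; rewrite /boundary_int (@seg_int_split _ t c t')//; last first.
  have [|||_ c1] := @closed_form_seg2 s' t t'; [lra|lra|lra|].
  have [|||_ c2] := @closed_form_seg2 s t t'; [lra|lra|lra|].
  exact: seg_contB c1 c2.
have [|||c1 _] := @closed_form_seg1 s s' t; [lra|lra|lra|].
have [|||c2 _] := @closed_form_seg1 s s' c; [lra|lra|lra|].
have [|||c3 _] := @closed_form_seg1 s s' t'; [lra|lra|lra|].
rewrite (@eq_seg_int _ s s' (fun y => A y t - A y t')
   (fun y => (A y t - A y c) + (A y c - A y t'))); last by move=> x _; ring.
rewrite (@seg_intD _ s s' (fun y => A y t - A y c) (fun y => A y c - A y t'));
  [ring|exact: seg_contB c1 c2|exact: seg_contB c2 c3].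
Qed.

(** The boundary integrals of the four quarters add up to that of the rectangle. *)
Lemma boundary_int_quarter (s t h l e : R) : 0 <= h -> 0 <= l ->
  s0 <= s -> s + 2 * h <= s1 -> t0 <= t -> t + 2 * l <= t1 ->
  4 * e <= `|boundary_int A B s (s + 2 * h) t (t + 2 * l)| ->
  exists s' t', [/\ s' = s \/ s' = s + h, t' = t \/ t' = t + l &
    e <= `|boundary_int A B s' (s' + h) t' (t' + l)| ].
Proof.
move=> h0 l0 a1 a2 a3 a4.
rewrite (@boundary_int_split1 s (s + h)); try lra.
rewrite (@boundary_int_split2 s (s + h) t (t + l)); try lra.
rewrite (@boundary_int_split2 (s + h) _ t (t + l)); try lra.
rewrite (_ : s + 2 * h = s + h + h); last by ring.
rewrite (_ : t + 2 * l = t + l + l); last by ring.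
move=> H; apply: contrapT => N.
have P s' t' : (s' = s \/ s' = s + h) -> (t' = t \/ t' = t + l) ->
    `|boundary_int A B s' (s' + h) t' (t' + l)| < e.
  by move=> *; rewrite ltNge; apply/negP => ?; apply: N; exists s', t'.
have := P s t (or_introl erefl) (or_introl erefl).
have := P (s + h) t (or_intror erefl) (or_introl erefl).
have := P s (t + l) (or_introl erefl) (or_intror erefl).
have := P (s + h) (t + l) (or_intror erefl) (or_intror erefl).
move: H; move: (boundary_int _ _ _ _ _ _) (boundary_int _ _ _ _ _ _)
  (boundary_int _ _ _ _ _ _) (boundary_int _ _ _ _ _ _) => w z y x.
have := ler_normD (x + y) (z + w); have := ler_normD x y; have := ler_normD z w.
lra.
Qed.

(** Near a point, the contributions of the affine parts of A and B cancel
    because the form is closed. *)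
Lemma boundary_int_small (s t e : R) : s0 <= s <= s1 -> t0 <= t <= t1 -> 0 < e ->
  exists2 d, 0 < d & forall x y h l, 0 <= h < d -> 0 <= l < d ->
    x <= s <= x + h -> y <= t <= y + l ->
    s0 <= x -> x + h <= s1 -> t0 <= y -> y + l <= t1 ->
    `|boundary_int A B x (x + h) y (y + l)| <= 2 * e * (h + l) ^+ 2.
Proof.
move=> hs ht e0; have [a1 [a2 [b2 H]]] := closedAB hs ht.
have [d d0 Hd] := H e e0; exists d => // x y h l hd ld xs yt xa xb ya yb.
have K s' t' : x <= s' <= x + h -> y <= t' <= y + l ->
   `|A s' t' - A s t - a1 * (s' - s) - a2 * (t' - t)| <= e * (h + l) /\
   `|B s' t' - B s t - a2 * (s' - s) - b2 * (t' - t)| <= e * (h + l).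
  move=> ss tt.
  have e1 : `|s' - s| <= h by rewrite ler_norml; lra.
  have e2 : `|t' - t| <= l by rewrite ler_norml; lra.
  have [||k1 k2] := Hd s' t'; try lra.
  have : e * (`|s' - s| + `|t' - t|) <= e * (h + l) by rewrite ler_pM2l// lerD.
  lra.
rewrite /boundary_int.
have I1 : `|seg_int x (x + h) (fun z => A z y - A z (y + l))
      - (- a2 * l) * (x + h - x)| <= (2 * e * (h + l)) * (x + h - x).
  apply: seg_int_near; first lra.
    have [|||c1 _] := @closed_form_seg1 x (x + h) y; [lra|lra|lra|].
    have [|||c2 _] := @closed_form_seg1 x (x + h) (y + l); [lra|lra|lra|].
    exact: seg_contB c1 c2.
  move=> z zx; have [] := K z y; try lra; have [] := K z (y + l); try lra.
  by rewrite !ler_norml; lra.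
have I2 : `|seg_int y (y + l) (fun z => B (x + h) z - B x z)
      - (a2 * h) * (y + l - y)| <= (2 * e * (h + l)) * (y + l - y).
  apply: seg_int_near; first lra.
    have [|||_ c1] := @closed_form_seg2 (x + h) y (y + l); [lra|lra|lra|].
    have [|||_ c2] := @closed_form_seg2 x y (y + l); [lra|lra|lra|].
    exact: seg_contB c1 c2.
  move=> z zx; have [] := K x z; try lra; have [] := K (x + h) z; try lra.
  by rewrite !ler_norml; lra.
move: I1 I2; have -> : x + h - x = h by ring.
have -> : y + l - y = l by ring.
set I := seg_int _ _ _; set J := seg_int _ _ _; move=> I1 I2; rewrite (_ : I + J = (I - - a2 * l * h) + (J - a2 * h * l)); last by ring.
apply: (le_trans (ler_normD _ _)); apply: (le_trans (lerD I1 I2)).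
by rewrite (_ : _ + _ = 2 * e * (h + l) ^+ 2)//; ring.
Qed.

End rectangle.
End Goursat.

Section GoursatTheorem.
Variable R : realType.
Implicit Types (A B : R -> R -> R) (s t e : R).

(** Goursat: bisection yields rectangles shrinking to a point on which the
    boundary integral does not decrease faster than the area. *)
Theorem goursat A B s0 s1 t0 t1 :
    (forall s t, s0 <= s <= s1 -> t0 <= t <= t1 -> closed_form_at A B s t) ->
  s0 <= s1 -> t0 <= t1 -> boundary_int A B s0 s1 t0 t1 = 0.
Proof.
move=> closedAB s01 t01; apply/eqP; rewrite -normr_le0 leNgt; apply/negP => I0.
set I := `|_| in I0.
pose h k := (s1 - s0) / 2 ^+ k; pose l k := (t1 - t0) / 2 ^+ k.
have hS k : h k = 2 * h k.+1 by rewrite /h exprS; field.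
have lS k : l k = 2 * l k.+1 by rewrite /l exprS; field.
have h0 k : 0 <= h k by rewrite divr_ge0 ?subr_ge0// exprn_ge0.
have l0 k : 0 <= l k by rewrite divr_ge0 ?subr_ge0// exprn_ge0.
(* u is the lower left corner of a rectangle of the k-th generation carrying at
   least its share 4^-k of the boundary integral. *)
pose good k (u : R * R) := [/\ s0 <= u.1, u.1 + h k <= s1, t0 <= u.2, u.2 + l k <= t1 &
  I / 4 ^+ k <= `|boundary_int A B u.1 (u.1 + h k) u.2 (u.2 + l k)|].
have step k u : exists v : R * R, good k u -> good k.+1 v /\
    (u.1 <= v.1 <= u.1 + h k.+1) /\ (u.2 <= v.2 <= u.2 + l k.+1).
  case: (pselect (good k u)) => [[g1 g2 g3 g4 g5]|ng]; last by exists u.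
  have [|||||||s' [t' [hs' ht' q]]] :=
    @boundary_int_quarter R A B s0 s1 t0 t1 closedAB u.1 u.2 (h k.+1) (l k.+1) (I / 4 ^+ k.+1); try rewrite -?hS -?lS//.
    apply: le_trans g5; rewrite exprS invfM.
    by rewrite (_ : 4 * (I * (4^-1 * (4 ^+ k)^-1)) = I / 4 ^+ k) //; field; rewrite expf_neq0.
  exists (s', t') => _; rewrite /good/=; move: (hS k) (lS k) (h0 k.+1) (l0 k.+1) => *.
  by split; [split=> //|split]; case: hs' => hE; case: ht' => tE; lra.
have {}step k : exists f : R * R -> R * R, forall u, good k u -> good k.+1 (f u) /\
    (u.1 <= (f u).1 <= u.1 + h k.+1) /\ (u.2 <= (f u).2 <= u.2 + l k.+1).
  by have [f] := choice (step k); exists f.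
have [f Hf] := choice step.
pose u := fix u k := if k is k'.+1 then f k' (u k') else (s0, t0).
have gu k : good k (u k).
  elim: k => [|k IH]; last by have [] := Hf k _ IH.
  rewrite /good/= /h /l !expr0 !divr1 (_ : s0 + _ = s1); last by ring.
  by rewrite (_ : t0 + _ = t1); [split|ring].
have us k : (u k).1 <= (u k.+1).1 <= (u k).1 + h k.+1 /\
            (u k).2 <= (u k.+1).2 <= (u k).2 + l k.+1.
  by have [_] := Hf k _ (gu k).
have limit (v w : nat -> R) : (forall k, v k <= v k.+1 <= v k + w k.+1) ->
    (forall k, 0 <= w k) -> (forall k, w k = 2 * w k.+1) ->
    exists x, forall k, v k <= x <= v k + w k.
  move=> vw w0 wS.
  have inc i j : v i <= v (j + i)%N.
    by elim: j => // j IH; rewrite addSn (le_trans IH)//; have := vw (j + i)%N; lra.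
  have dec i j : v (j + i)%N + w (j + i)%N <= v i + w i.
    elim: j => // j IH; rewrite addSn (le_trans _ IH)//.
    by have := vw (j + i)%N; have := wS (j + i)%N; lra.
  have ub i j : v j <= v i + w i.
    have [ij|ji] := leqP i j.
      by rewrite -(subnK ij); have := dec i (j - i)%N; have := w0 (j - i + i)%N; lra.
    by have := inc j (i - j)%N; rewrite subnK 1?ltnW//; have := w0 i; lra.
  have hs : has_sup (range v).
    by split; [exists (v 0%N), 0%N|exists (v 0%N + w 0%N) => _ [j _ <-]].
  exists (sup (range v)) => k; apply/andP; split.
    by apply: ub_le_sup; [case: hs|exists k].
  by apply: ge_sup; [case: hs|move=> _ [j _ <-]].
have [s Hs] := limit (fun k => (u k).1) h (fun k => (us k).1) h0 hS.
have [t Ht] := limit (fun k => (u k).2) l (fun k => (us k).2) l0 lS.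
have hs : s0 <= s <= s1 by have [] := gu 0%N; have := Hs 0%N; lra.
have ht : t0 <= t <= t1 by have [] := gu 0%N; have := Ht 0%N; lra.
set L := (s1 - s0) + (t1 - t0).
have L0 : 0 <= L by rewrite /L; lra.
(* With this e the bound of boundary_int_small on a rectangle of the k-th
   generation is less than I / 4^k. *)
pose e := I / (4 * (L ^+ 2 + 1)).
have L1 : 0 < L ^+ 2 + 1 by rewrite ltr_wpDl// sqr_ge0.
have e0 : 0 < e by rewrite divr_gt0// mulr_gt0.
have [d d0 Hd] := boundary_int_small closedAB hs ht e0.
pose k := Num.bound (L / d).
have kd : L / 2 ^+ k < d.
  rewrite ltr_pdivrMr ?exprn_gt0// mulrC -ltr_pdivrMr//.
  apply: (@lt_trans _ _ k%:R); first by apply: archi_boundP; rewrite divr_ge0// ltW.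
  by rewrite -natrX ltr_nat ltn_expl.
have hlk : h k + l k = L / 2 ^+ k by rewrite -mulrDl.
have [g1 g2 g3 g4 g5] := gu k.
have := Hd (u k).1 (u k).2 (h k) (l k); move: (h0 k) (l0 k) (Hs k) (Ht k) => hk lk sk tk.
move=> H; have {H} : `|boundary_int A B (u k).1 ((u k).1 + h k) (u k).2 ((u k).2 + l k)| <=
  2 * e * (h k + l k) ^+ 2 by apply: H => //; lra.
apply/negP; rewrite -ltNge (lt_le_trans _ g5)// hlk.
rewrite (_ : 4 ^+ k = (2 ^+ k) ^+ 2); last by rewrite exprAC; congr (_ ^+ _); ring.
rewrite exprMn exprVn mulrA ltr_pM2r ?invr_gt0 ?exprn_gt0//.
rewrite /e (_ : 2 * _ * _ = I * (L ^+ 2 / (2 * (L ^+ 2 + 1)))); last by field; rewrite gt_eqF.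
rewrite -[ltRHS]mulr1 ltr_pM2l// ltr_pdivrMr ?mulr_gt0// mul1r.
by have := sqr_ge0 L; lra.
Qed.

End GoursatTheorem.

(** * Complex-valued functions on segments and complex derivatives *)

Section ComplexSegmentIntegral.
Variable R : realType.
Implicit Types (a b : R) (F G : R -> R[i]).

Definition cseg_int a b F : R[i] :=
  Complex (seg_int a b (fun x => complex.Re (F x)))
          (seg_int a b (fun x => complex.Im (F x))).

Definition cseg_cont a b F :=
  forall x, a <= x <= b -> cvgc (nbhs x) F (F x).

Lemma cseg_contP a b F : cseg_cont a b F <->
  seg_cont a b (fun x => complex.Re (F x)) /\ seg_cont a b (fun x => complex.Im (F x)).
Proof.
split=> [H|[HR HI] x xab]; last first.
  by apply/cvgc_ReIm; split; [exact: HR|exact: HI].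
by split=> x xab; have /cvgc_ReIm[] := H x xab.
Qed.

Lemma cseg_contM a b F G : cseg_cont a b F -> cseg_cont a b G ->
  cseg_cont a b (fun x => F x * G x).
Proof. by move=> cF cG x xab; apply: cvgcM; [exact: cF|exact: cG]. Qed.

Lemma cseg_contD a b F G : cseg_cont a b F -> cseg_cont a b G ->
  cseg_cont a b (fun x => F x + G x).
Proof. by move=> cF cG x xab; apply: cvgcD; [exact: cF|exact: cG]. Qed.

Lemma cseg_contB a b F G : cseg_cont a b F -> cseg_cont a b G ->
  cseg_cont a b (fun x => F x - G x).
Proof. by move=> cF cG x xab; apply: cvgcB; [exact: cF|exact: cG]. Qed.

Lemma cseg_cont_cst a b z : cseg_cont a b (fun=> z).
Proof. by move=> x xab; exact: cvgc_cst. Qed.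

Lemma cseg_contX a b F k : cseg_cont a b F -> cseg_cont a b (fun x => F x ^+ k).
Proof.
move=> cF; elim: k => [|k IH]; first exact: cseg_cont_cst.
have -> : (fun x => F x ^+ k.+1) = (fun x => F x * F x ^+ k).
  by apply/funext => x; rewrite exprS.
exact: (cseg_contM cF IH).
Qed.

Lemma cseg_cont_sum a b N (F : nat -> R -> R[i]) : (forall k, cseg_cont a b (F k)) ->
  cseg_cont a b (fun x => \sum_(k < N) F k x).
Proof.
move=> cF; elim: N => [|N IH].
  have -> : (fun x => \sum_(k < 0) F k x) = (fun=> 0).
    by apply/funext => x; rewrite big_ord0.
  exact: cseg_cont_cst.
have -> : (fun x => \sum_(k < N.+1) F k x) = (fun x => \sum_(k < N) F k x + F N x).
  by apply/funext => x; rewrite big_ord_recr.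
exact: (cseg_contD IH (cF N)).
Qed.

Lemma cseg_contV a b F : cseg_cont a b F -> (forall x, a <= x <= b -> F x != 0) ->
  cseg_cont a b (fun x => (F x)^-1).
Proof. by move=> cF F0 x xab; apply: cvgcV; [exact: F0|exact: cF]. Qed.

Lemma cseg_cont_norm a b F : cseg_cont a b F -> seg_cont a b (fun x => normc (F x)).
Proof.
by move=> cF x xab; apply: cvgc_normc; exact: cF.
Qed.

Lemma eq_cseg_int a b F G : (forall x, a <= x <= b -> F x = G x) ->
  cseg_int a b F = cseg_int a b G.
Proof. by move=> FG; congr Complex; apply: eq_seg_int => x /FG ->. Qed.

Lemma cseg_intD a b F G : cseg_cont a b F -> cseg_cont a b G ->
  cseg_int a b (fun x => F x + G x) = cseg_int a b F + cseg_int a b G.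
Proof.
move=> /cseg_contP[cF1 cF2] /cseg_contP[cG1 cG2].
rewrite /cseg_int; simpc; rewrite -!seg_intD//.
by congr Complex; apply: eq_seg_int => x _; rewrite raddfD.
Qed.

Lemma cseg_intZ a b F z : cseg_cont a b F ->
  cseg_int a b (fun x => z * F x) = z * cseg_int a b F.
Proof.
move=> /cseg_contP[cF1 cF2]; case: z => z1 z2; rewrite /cseg_int; simpc.
have cZ c (f : R -> R) : seg_cont a b f -> seg_cont a b (fun x => c * f x).
  by move=> cf; apply: seg_contM => //; exact: seg_cont_cst.
rewrite -!seg_intZ// -seg_intB -?seg_intD//; do ?exact: cZ.
by congr Complex; apply: eq_seg_int => x _; case: (F x).
Qed.

Lemma cseg_intB a b F G : cseg_cont a b F -> cseg_cont a b G ->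
  cseg_int a b (fun x => F x - G x) = cseg_int a b F - cseg_int a b G.
Proof.
move=> cF cG; have cN := cseg_contM (@cseg_cont_cst a b (-1)) cG.
rewrite -(mulN1r (cseg_int a b G)) -cseg_intZ// -(cseg_intD cF cN).
by apply: eq_cseg_int => x _; rewrite mulN1r.
Qed.

Lemma cseg_int_cst a b z : a <= b -> cseg_int a b (fun=> z) = z * (b - a)%:C.
Proof.
by move=> ab; rewrite /cseg_int !seg_int_cst//; case: z => z1 z2; simpc.
Qed.

Lemma cseg_int_sum a b N (F : nat -> R -> R[i]) : (forall k, cseg_cont a b (F k)) ->
  a <= b ->
  cseg_int a b (fun x => \sum_(k < N) F k x) = \sum_(k < N) cseg_int a b (F k).
Proof.
move=> cF ab; elim: N => [|N IH].
  rewrite big_ord0 (@eq_cseg_int _ _ _ (fun=> 0)) ?cseg_int_cst ?mul0r//.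
  by move=> x _; rewrite big_ord0.
rewrite big_ord_recr/= -IH -cseg_intD//; last exact: cseg_cont_sum.
by apply: eq_cseg_int => x _; rewrite big_ord_recr.
Qed.

Lemma cseg_int_le a b F e : a <= b -> cseg_cont a b F ->
  (forall x, a <= x <= b -> normc (F x) <= e) ->
  normc (cseg_int a b F) <= 2 * e * (b - a).
Proof.
move=> ab /cseg_contP[cF1 cF2] Fe; rewrite (le_trans (normc_le_ReIm _))//=.
rewrite -mulrA mulr_natl mulr2n lerD//; apply: seg_int_le => // x /Fe.
  by apply: le_trans; exact: Re_le_normc.
by apply: le_trans; exact: Im_le_normc.
Qed.

End ComplexSegmentIntegral.

Section Cis.
Variable R : realType.
Implicit Types t : R.

Definition cis t : R[i] := Complex (cos t) (sin t).

Lemma cis0 : cis 0 = 1. Proof. by rewrite /cis cos0 sin0. Qed.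

Lemma cis2pi : cis (2 * pi) = 1.
Proof. by rewrite /cis mulrC mulr_natr cos2pi sin2pi. Qed.

Lemma normc_cis t : normc (cis t) = 1.
Proof. by rewrite /= cos2Dsin2 sqrtr1. Qed.

Lemma cis_neq0 t : cis t != 0.
Proof. by rewrite -normc_gt0 normc_cis. Qed.

Lemma continuous_cis t : cvgc (nbhs t) cis (cis t).
Proof.
apply/cvgc_ReIm; split => /=; [exact: continuous_cos|exact: continuous_sin].
Qed.

End Cis.

Section Caratheodory.
Variable R : realType.
Implicit Types (f : R[i] -> R[i]) (A B : R -> R -> R[i]) (s t : R) (z w : R[i]).

Lemma caratheodory_real (h : R -> R) t d : is_derive t 1 h d ->
  exists2 q : R -> R, (forall s, h s - h t = q s * (s - t)) & q @ t --> d.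
Proof.
move=> hd.
pose q s := if s == t then d else (h s - h t) / (s - t).
exists q => [s|].
  by rewrite /q; case: eqVneq => [->|st]; rewrite ?subrr ?mulr0// divfK// subr_eq0.
have qt : q t = d by rewrite /q eqxx.
rewrite -qt; apply/continuous_withinNx.
have [hD hE] := hd.
have : (fun x : R => x^-1 *: (h (x *: 1 + t) - h t)) @ 0^' --> d.
  rewrite -hE; exact: hD.
rewrite qt => H; apply/cvgrPdist_lt => e e0.
move/cvgrPdist_lt : H => /(_ e e0); rewrite !near_withinE => -[r/= r0 Hr].
exists r => //= s; rewrite /ball/= => st sNt.
have := Hr (s - t); rewrite /ball/= sub0r normrN distrC => /(_ st).
rewrite subr_eq0 => /(_ sNt); rewrite /q (negbTE sNt).
by rewrite [(s - t) *: 1]mulr1 subrK [_ *: _]mulrC.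
Qed.

(** Differentiability in the form of Caratheodory: it makes the chain and
    product rules algebraic. *)
Definition cdiff_at f z d := exists2 g : R[i] -> R[i],
  (forall w, f w - f z = g w * (w - z)) &
  cvgc (nbhsc z) g d.

Definition cdiff f z := exists d, cdiff_at f z d.

Lemma cdiff_continuous f z : cdiff f z -> cvgc (nbhsc z) f (f z).
Proof.
move=> [d [g fg gd]].
have E : f = (fun w => f z + g w * (w - z)).
  by apply/funext => w; rewrite -fg addrC subrK.
have E2 : f z = f z + d * (z - z) by rewrite subrr mulr0 addr0.
rewrite [X in cvgc _ X _]E [X in cvgc _ _ X]E2.
apply: cvgcD; first exact: cvgc_cst.
by apply: cvgcM => //; apply: cvgcB; [exact: cvgc_id|exact: cvgc_cst].
Qed.

(** The two-variable analogue of Caratheodory's derivative: a and b are the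
    partial derivatives of A at (s, t). *)
Definition real_diff2 A s t a b := exists (al be : R * R -> R[i]),
  [/\ forall s' t', A s' t' - A s t =
        al (s', t') * (s' - s)%:C + be (s', t') * (t' - t)%:C,
      cvgc (nbhs (s, t)) al a & cvgc (nbhs (s, t)) be b].

Lemma real_diff2_remainder A s t a b : real_diff2 A s t a b -> forall e, 0 < e ->
  exists2 d, 0 < d & forall s' t', `|s' - s| < d -> `|t' - t| < d ->
    normc (A s' t' - A s t - a * (s' - s)%:C - b * (t' - t)%:C)
      <= e * (`|s' - s| + `|t' - t|).
Proof.
move=> [al [be [AE ala beb]]] e e0.
have H := filterI (ala e e0) (beb e e0).
have /nbhs_ballP[d /= d0 Hd] : nbhs ((s, t) : R * R) ([set u | normc (a - al u) < e] `&` [set u | normc (b - be u) < e]) by exact: H.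
exists d => // s' t' sd td; rewrite AE.
rewrite (_ : _ - _ = (al (s', t') - a) * (s' - s)%:C + (be (s', t') - b) * (t' - t)%:C);
  last by ring.
rewrite (le_trans (normcD _ _))// !normcM !normc_real mulrDr.
have /Hd[/= e1 e2] : ball (s, t) d (s', t') by split; rewrite /ball/= distrC.
by rewrite lerD// ler_wpM2r// normc_distC ltW.
Qed.

Lemma Re_remainder z w a b (x y : R) :
  complex.Re (z - w - a * x%:C - b * y%:C) =
  complex.Re z - complex.Re w - complex.Re a * x - complex.Re b * y.
Proof. by case: z w a b => [? ?] [? ?] [? ?] [? ?] /=; ring. Qed.

Lemma Im_remainder z w a b (x y : R) :
  complex.Im (z - w - a * x%:C - b * y%:C) =
  complex.Im z - complex.Im w - complex.Im a * x - complex.Im b * y.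
Proof. by case: z w a b => [? ?] [? ?] [? ?] [? ?] /=; ring. Qed.

(** With complex coefficients the form A ds + B dt is closed when dA/dt = dB/ds;
    its real and imaginary parts are then closed real forms. *)
Lemma closed_form_ReIm A B s t a1 a2 b2 :
  real_diff2 A s t a1 a2 -> real_diff2 B s t a2 b2 ->
  closed_form_at (fun s t => complex.Re (A s t)) (fun s t => complex.Re (B s t)) s t /\
  closed_form_at (fun s t => complex.Im (A s t)) (fun s t => complex.Im (B s t)) s t.
Proof.
move=> /real_diff2_remainder HA /real_diff2_remainder HB; split.
  exists (complex.Re a1), (complex.Re a2), (complex.Re b2) => e e0.
  have [d1 d10 H1] := HA e e0; have [d2 d20 H2] := HB e e0.
  exists (Num.min d1 d2) => [|s' t']; first by rewrite lt_min d10.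
  rewrite !lt_min => /andP[s1 s2] /andP[t1 t2]; split.
    apply: le_trans (H1 _ _ s1 t1); by rewrite -Re_remainder Re_le_normc.
  apply: le_trans (H2 _ _ s2 t2); by rewrite -Re_remainder Re_le_normc.
exists (complex.Im a1), (complex.Im a2), (complex.Im b2) => e e0.
have [d1 d10 H1] := HA e e0; have [d2 d20 H2] := HB e e0.
exists (Num.min d1 d2) => [|s' t']; first by rewrite lt_min d10.
rewrite !lt_min => /andP[s1 s2] /andP[t1 t2]; split.
  apply: le_trans (H1 _ _ s1 t1); by rewrite -Im_remainder Im_le_normc.
apply: le_trans (H2 _ _ s2 t2); by rewrite -Im_remainder Im_le_normc.
Qed.

Lemma cis_caratheodory t : exists2 q : R -> R[i],
  (forall s, cis s - cis t = q s * (s - t)%:C) &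
  cvgc (nbhs t) q ('i%C * cis t).
Proof.
have [qc qcE qcd] := caratheodory_real (is_derive_cos t).
have [qs qsE qsd] := caratheodory_real (is_derive_sin t).
exists (fun s => Complex (qc s) (qs s)) => [s|].
  by rewrite /cis; simpc; rewrite qcE qsE; congr Complex; ring.
by apply/cvgc_ReIm; split => /=; rewrite ?mul0r ?mul1r ?sub0r ?add0r.
Qed.

End Caratheodory.

(** * Cauchy's integral on circles *)

Section RealDiff2.
Variable R : realType.
Implicit Types (f : R[i] -> R[i]) (A B : R -> R -> R[i]) (s t : R) (z w : R[i]).

Lemma cvg_fst_sub s t : cvgc (nbhs (s, t)) (fun u : R * R => (u.1 - s)%:C : R[i]) 0.
Proof.
rewrite -[0]/(0%:C) -(subrr s); apply: cvgc_real.
by apply: cvgB; [exact: cvg_fst|exact: cvg_cst].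
Qed.

Lemma cvg_snd_sub s t : cvgc (nbhs (s, t)) (fun u : R * R => (u.2 - t)%:C : R[i]) 0.
Proof.
rewrite -[0]/(0%:C) -(subrr t); apply: cvgc_real.
by apply: cvgB; [exact: cvg_snd|exact: cvg_cst].
Qed.

Lemma real_diff2_continuous A s t a b : real_diff2 A s t a b ->
  cvgc (nbhs (s, t)) (fun u => A u.1 u.2) (A s t).
Proof.
move=> [al [be [AE ala beb]]].
have -> : (fun u => A u.1 u.2) =
    (fun u => A s t + (al u * (u.1 - s)%:C + be u * (u.2 - t)%:C)).
  by apply/funext => -[s' t']; rewrite -AE addrC subrK.
have E : A s t = A s t + (a * 0 + b * 0) by rewrite !mulr0 !addr0.
rewrite [X in cvgc _ _ X]E; apply: cvgcD; first exact: cvgc_cst.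
by apply: cvgcD; apply: cvgcM => //; [exact: cvg_fst_sub|exact: cvg_snd_sub].
Qed.

Lemma real_diff2_comp f A s t a b d : cdiff_at f (A s t) d -> real_diff2 A s t a b ->
  real_diff2 (fun s t => f (A s t)) s t (d * a) (d * b).
Proof.
move=> [g fE gd] dA; have cA := real_diff2_continuous dA.
have gA : cvgc (nbhs (s, t)) (fun u => g (A u.1 u.2)) d by exact: (cvgc_comp cA gd).
move: dA => [al [be [AE ala beb]]].
exists (fun u => g (A u.1 u.2) * al u), (fun u => g (A u.1 u.2) * be u); split.
- by move=> s' t'; rewrite fE AE mulrDr !mulrA.
- exact: cvgcM.
- exact: cvgcM.
Qed.

Lemma real_diff2Z A s t a b z : real_diff2 A s t a b ->
  real_diff2 (fun s t => z * A s t) s t (z * a) (z * b).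
Proof.
move=> [al [be [AE ala beb]]]; exists (fun u => z * al u), (fun u => z * be u).
split; [|exact: cvgcZ|exact: cvgcZ].
by move=> s' t'; rewrite -mulrBr AE mulrDr !mulrA.
Qed.

Lemma real_diff2M A s t a b (k q : R -> R[i]) l :
  (forall t', k t' - k t = q t' * (t' - t)%:C) -> cvgc (nbhs t) q l ->
  real_diff2 A s t a b ->
  real_diff2 (fun s t => A s t * k t) s t (a * k t) (b * k t + A s t * l).
Proof.
move=> kE ql [al [be [AE ala beb]]].
have q2 : cvgc (nbhs (s, t)) (fun u : R * R => q u.2) l.
  by apply: (cvgc_compl _ ql); exact: cvg_snd.
have k2 : cvgc (nbhs (s, t)) (fun u : R * R => k u.2) (k t).
  have -> : (fun u : R * R => k u.2) = (fun u => k t + q u.2 * (u.2 - t)%:C).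
    by apply/funext => u; rewrite -kE addrC subrK.
  have E : k t = k t + l * 0 by rewrite mulr0 addr0.
  rewrite [X in cvgc _ _ X]E; apply: cvgcD; first exact: cvgc_cst.
  by apply: cvgcM => //; exact: cvg_snd_sub.
exists (fun u => al u * k u.2), (fun u => be u * k u.2 + A s t * q u.2); split.
- move=> s' t' /=.
  have -> : A s' t' * k t' - A s t * k t =
      (A s' t' - A s t) * k t' + A s t * (k t' - k t) by ring.
  by rewrite AE kE; ring.
- exact: cvgcM.
- by apply: cvgcD; [exact: cvgcM|exact: cvgcZ].
Qed.

Lemma cdiff_cst a z : cdiff (fun=> a) z.
Proof.
by exists 0, (fun=> 0) => [w|]; [rewrite mul0r subrr|exact: cvgc_cst].
Qed.

Lemma cdiffM f g z : cdiff f z -> cdiff g z -> cdiff (fun w => f w * g w) z.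
Proof.
move=> df dg; have cg := cdiff_continuous dg.
move: df dg => [a [f' fE f'a]] [b [g' gE g'b]].
exists (a * g z + f z * b), (fun w => f' w * g w + f z * g' w) => [w|].
  have -> : f w * g w - f z * g z = (f w - f z) * g w + f z * (g w - g z) by ring.
  by rewrite fE gE; ring.
by apply: cvgcD; [exact: cvgcM|exact: cvgcZ].
Qed.

Lemma cdiffX f z k : cdiff f z -> cdiff (fun w => f w ^+ k) z.
Proof.
move=> df; elim: k => [|k IH]; first exact: cdiff_cst.
have -> : (fun w => f w ^+ k.+1) = (fun w => f w * f w ^+ k).
  by apply/funext => x; rewrite exprS.
exact: cdiffM.
Qed.

Lemma cdiff_near f z d (g : R[i] -> R[i]) :
  (\forall w \near nbhsc z, f w - f z = g w * (w - z)) -> cvgc (nbhsc z) g d ->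
  cdiff f z.
Proof.
move=> fE gd; exists d; pose h w := if w == z then d else (f w - f z) / (w - z).
exists h => [w|].
  rewrite /h; case: eqVneq => [->|wz]; first by rewrite !subrr mulr0.
  by rewrite divfK// subr_eq0.
move=> e e0; apply: filterS2 fE (gd e e0) => w fE ge /=.
rewrite /h; case: eqVneq => [_|wz]; first by rewrite subrr normc0.
by rewrite fE mulfK// subr_eq0.
Qed.

Lemma cdiffV z : z != 0 -> cdiff (fun w => w^-1) z.
Proof.
move=> z0; apply: (@cdiff_near _ _ (- (z^-1 * z^-1)) (fun w => - (w^-1 * z^-1))).
  exists (normc z); first by rewrite normc_gt0.
  move=> w wz; have w0 : w != 0.
    by apply: contraTneq wz => ->; rewrite sub0r normcN ltxx.
  by field; rewrite w0 z0.
apply: cvgcN; apply: cvgcM; last exact: cvgc_cst.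
by apply: cvgcV => //; exact: cvgc_id.
Qed.

Lemma expR_caratheodory s : exists2 q : R -> R,
  (forall s', expR s' - expR s = q s' * (s' - s)) & q @ s --> expR s.
Proof. exact: (caratheodory_real (is_derive_expR s)). Qed.

End RealDiff2.

Section CircleForm.
Variable R : realType.
Implicit Types (f : R[i] -> R[i]) (s t : R) (z w : R[i]).

Definition circle (r t : R) : R[i] := r%:C * cis t.

(** The segment from z to the circle, in logarithmic parametrization. *)
Definition ray (r : R) z s t : R[i] := z + (expR s)%:C * (circle r t - z).

(** The density of (2 pi i)^-1 d(zeta) / (zeta - z) on the circle with respect to
    dt / (2 pi). *)
Definition cauchy_factor (r : R) z t : R[i] := circle r t / (circle r t - z).

Variables (r : R) (z : R[i]).
Hypothesis r0 : 0 < r.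
Hypothesis zr : normc z < r.

Lemma normc_circle t : normc (circle r t) = r.
Proof. by rewrite normcM normc_cis mulr1 normc_real gtr0_norm. Qed.

Lemma circle_neq t : circle r t - z != 0.
Proof.
rewrite subr_eq0; apply: contraTneq zr => <-.
by rewrite normc_circle ltxx.
Qed.

Lemma circle_caratheodory t : exists2 q : R -> R[i],
  (forall s, circle r s - circle r t = q s * (s - t)%:C) &
  cvgc (nbhs t) q ('i%C * circle r t).
Proof.
have [q qE qd] := cis_caratheodory t.
exists (fun s => r%:C * q s) => [s|]; first by rewrite -mulrBr qE mulrA.
by rewrite [_ * circle _ _]mulrCA; exact: cvgcZ.
Qed.

Lemma ray_diff2 s t : real_diff2 (ray r z) s t
  ((expR s)%:C * (circle r t - z)) ((expR s)%:C * ('i%C * circle r t)).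
Proof.
have [q qE qd] := circle_caratheodory t.
have [h hE hd] := expR_caratheodory s.
have q2 : cvgc (nbhs (s, t)) (fun u : R * R => q u.2) ('i%C * circle r t).
  by apply: (cvgc_compl _ qd); exact: cvg_snd.
have h2 : cvgc (nbhs (s, t)) (fun u : R * R => (h u.1)%:C) (expR s)%:C.
  apply: (@cvgc_compl _ _ _ _ _ fst (fun x => (h x)%:C)); first exact: cvg_fst.
  exact: cvgc_real.
have c2 : cvgc (nbhs (s, t)) (fun u : R * R => circle r u.2) (circle r t).
  apply: (@cvgc_compl _ _ _ _ _ snd (circle r)); first exact: cvg_snd.
  by apply: cvgcZ; exact: continuous_cis.
exists (fun u => (h u.1)%:C * (circle r u.2 - z)), (fun u => (expR s)%:C * q u.2).
split.
- move=> s' t' /=; rewrite /ray.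
  have -> : z + (expR s')%:C * (circle r t' - z) - (z + (expR s)%:C * (circle r t - z))
     = (expR s' - expR s)%:C * (circle r t' - z)
       + (expR s)%:C * (circle r t' - circle r t) by rewrite rmorphB/=; ring.
  by rewrite qE hE rmorphM/=; ring.
- by apply: cvgcM => //; apply: cvgcB => //; exact: cvgc_cst.
- exact: cvgcZ.
Qed.

Lemma cauchy_factor_caratheodory t : exists2 q : R -> R[i],
  (forall s, cauchy_factor r z s - cauchy_factor r z t = q s * (s - t)%:C) &
  cvgc (nbhs t) q (- z * ('i%C * circle r t) / ((circle r t - z) * (circle r t - z))).
Proof.
have [q qE qd] := circle_caratheodory t.
exists (fun s => - z * q s / ((circle r s - z) * (circle r t - z))) => [s|].
  have -> : cauchy_factor r z s - cauchy_factor r z t =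
     - z * (circle r s - circle r t) / ((circle r s - z) * (circle r t - z)).
    by rewrite /cauchy_factor; field; rewrite !circle_neq.
  by rewrite qE; ring.
apply: cvgcM; first exact: cvgcZ.
apply: cvgcV; first by rewrite mulf_neq0 ?circle_neq.
apply: cvgcM; last exact: cvgc_cst.
apply: cvgcB; last exact: cvgc_cst.
by apply: cvgcZ; exact: continuous_cis.
Qed.

(** On the pullback of f(zeta) dzeta / (zeta - z) to the coordinates (s, t),
    closed by the chain rule, the sides t = 0 and t = 2 pi cancel. *)
Lemma circle_int_const f a b : a <= b ->
  (forall s t, a <= s <= b -> cdiff f (ray r z s t)) ->
  cseg_int 0 (2 * pi) (fun t => f (ray r z a t) * cauchy_factor r z t) =
  cseg_int 0 (2 * pi) (fun t => f (ray r z b t) * cauchy_factor r z t).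
Proof.
move=> ab df.
pose A s t := - 'i%C * f (ray r z s t).
pose B s t := f (ray r z s t) * cauchy_factor r z t.
have cl s t : a <= s <= b ->
    closed_form_at (fun s t => complex.Re (A s t)) (fun s t => complex.Re (B s t)) s t /\
    closed_form_at (fun s t => complex.Im (A s t)) (fun s t => complex.Im (B s t)) s t.
  move=> sab; have [d fd] := df s t sab.
  have dfz := real_diff2_comp fd (ray_diff2 s t).
  have [q qE ql] := cauchy_factor_caratheodory t.
  apply: (closed_form_ReIm (real_diff2Z (- 'i%C) dfz)).
  have := real_diff2M qE ql dfz.
  rewrite (_ : _ * cauchy_factor r z t = - 'i%C * (d * ((expR s)%:C * ('i%C * circle r t))));
    first by move=> H; exact: H.
  rewrite (_ : - 'i%C * (d * ((expR s)%:C * ('i%C * circle r t))) =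
     - ('i%C ^+ 2) * d * (expR s)%:C * circle r t); last by ring.
  rewrite sqr_i opprK mul1r /cauchy_factor; field; exact: circle_neq.
have pi0 : 0 <= 2 * pi :> R by rewrite mulr_ge0// pi_ge0.
have per s : A s 0 = A s (2 * pi) by rewrite /A /ray /circle cis0 cis2pi.
have GR := goursat (fun s t sab _ => (cl s t sab).1) ab pi0.
have GI := goursat (fun s t sab _ => (cl s t sab).2) ab pi0.
have aab : a <= a <= b by rewrite lexx ab.
have bab : a <= b <= b by rewrite lexx ab.
have H0 : seg_int a b (fun=> 0) = 0 :> R by rewrite seg_int_cst// mul0r.
move: GR GI; rewrite /boundary_int.
rewrite (@eq_seg_int _ a b _ (fun=> 0)) ?H0 ?add0r => [GR|s _]; last by rewrite per subrr.
rewrite (@eq_seg_int _ a b _ (fun=> 0)) ?H0 ?add0r => [GI|s _]; last by rewrite per subrr.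
have ER : seg_int 0 (2 * pi) (fun t => complex.Re (B b t)) =
    seg_int 0 (2 * pi) (fun t => complex.Re (B a t)).
  have c1 : seg_cont 0 (2 * pi) (fun t => complex.Re (B b t)).
    by move=> t _; have [_] := closed_form_cont2 (cl b t bab).1.
  have c2 : seg_cont 0 (2 * pi) (fun t => complex.Re (B a t)).
    by move=> t _; have [_] := closed_form_cont2 (cl a t aab).1.
  by apply/eqP; rewrite -subr_eq0 -(seg_intB c1 c2); apply/eqP; exact: GR.
have EI : seg_int 0 (2 * pi) (fun t => complex.Im (B b t)) =
    seg_int 0 (2 * pi) (fun t => complex.Im (B a t)).
  have c1 : seg_cont 0 (2 * pi) (fun t => complex.Im (B b t)).
    by move=> t _; have [_] := closed_form_cont2 (cl b t bab).2.
  have c2 : seg_cont 0 (2 * pi) (fun t => complex.Im (B a t)).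
    by move=> t _; have [_] := closed_form_cont2 (cl a t aab).2.
  by apply/eqP; rewrite -subr_eq0 -(seg_intB c1 c2); apply/eqP; exact: GI.
exact: (f_equal2 (@Complex R) (esym ER) (esym EI)).
Qed.

End CircleForm.

(** * Means over circles and Taylor coefficients *)

Section CircleMean.
Variable R : realType.
Implicit Types (f : R[i] -> R[i]) (F G : R -> R[i]) (r s t : R) (z w : R[i]).

Definition circle_mean F : R[i] := ((2 * pi)^-1)%:C * cseg_int 0 (2 * pi) F.

Lemma twopi_gt0 : 0 < 2 * pi :> R.
Proof. by rewrite mulr_gt0// pi_gt0. Qed.

Lemma eq_circle_mean F G : (forall t, F t = G t) -> circle_mean F = circle_mean G.
Proof. by move=> FG; congr (_ * _); exact: eq_cseg_int. Qed.

Lemma circle_meanZ F z : cseg_cont 0 (2 * pi) F ->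
  circle_mean (fun t => z * F t) = z * circle_mean F.
Proof. by move=> cF; rewrite /circle_mean cseg_intZ// mulrCA. Qed.

Lemma circle_meanB F G : cseg_cont 0 (2 * pi) F -> cseg_cont 0 (2 * pi) G ->
  circle_mean (fun t => F t - G t) = circle_mean F - circle_mean G.
Proof. by move=> cF cG; rewrite /circle_mean cseg_intB// mulrBr. Qed.

Lemma circle_mean_sum N (F : nat -> R -> R[i]) : (forall k, cseg_cont 0 (2 * pi) (F k)) ->
  circle_mean (fun t => \sum_(k < N) F k t) = \sum_(k < N) circle_mean (F k).
Proof.
by move=> cF; rewrite /circle_mean cseg_int_sum ?ltW ?twopi_gt0// mulr_sumr.
Qed.

Lemma circle_mean_cst z : circle_mean (fun=> z) = z.
Proof.
rewrite /circle_mean cseg_int_cst ?ltW ?twopi_gt0// subr0 mulrCA -rmorphM/=.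
by rewrite mulVf ?gt_eqF ?twopi_gt0// mulr1.
Qed.

Lemma circle_mean_le F e : cseg_cont 0 (2 * pi) F ->
  (forall t, 0 <= t <= 2 * pi -> normc (F t) <= e) -> normc (circle_mean F) <= 2 * e.
Proof.
move=> cF Fe; rewrite normcM normc_real gtr0_norm ?invr_gt0 ?twopi_gt0//.
rewrite ler_pdivrMl ?twopi_gt0//.
have := cseg_int_le (ltW twopi_gt0) cF Fe.
by rewrite subr0 [_ * (2 * e)]mulrC.
Qed.

Lemma cseg_cont_circle a b r : cseg_cont a b (@circle R r).
Proof. by move=> t _; apply: cvgcZ; exact: continuous_cis. Qed.

Lemma circle_neq0 r t : 0 < r -> circle r t != 0.
Proof. by move=> r0; rewrite -normc_gt0 normc_circle. Qed.

Lemma cseg_cont_cauchy_factor a b r z : 0 < r -> normc z < r ->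
  cseg_cont a b (cauchy_factor r z).
Proof.
move=> r0 zr; apply: cseg_contM; first exact: cseg_cont_circle.
apply: cseg_contV => [|t _]; last exact: circle_neq.
by apply: cseg_contB; [exact: cseg_cont_circle|exact: cseg_cont_cst].
Qed.

Lemma cdiff_cseg_cont f (c : R -> R[i]) a b : (forall t, a <= t <= b -> cdiff f (c t)) ->
  cseg_cont a b c -> cseg_cont a b (fun t => f (c t)).
Proof.
move=> df cc t tab; exact: (cvgc_comp (cc t tab) (cdiff_continuous (df t tab))).
Qed.

(** Cauchy's integral for the k-th Taylor coefficient at 0, over the circle of
    radius r. *)
Definition taylor_coef f r k := circle_mean (fun t => f (circle r t) / circle r t ^+ k).

(** The Cauchy integral of f(w) / w^k over concentric circles is constant, this
    function being holomorphic between them. *)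
Lemma taylor_coef_radius f r1 r2 k : 0 < r1 -> r1 <= r2 ->
  (forall w, normc w <= r2 -> cdiff f w) ->
  taylor_coef f r1 k = taylor_coef f r2 k.
Proof.
move=> r10 r12 df.
suff H : cseg_int 0 (2 * pi) (fun t => f (circle r1 t) / circle r1 t ^+ k) =
    cseg_int 0 (2 * pi) (fun t => f (circle r2 t) / circle r2 t ^+ k).
  by rewrite /taylor_coef /circle_mean H.
have zr : normc (0 : R[i]) < r1 by rewrite normc0.
have r20 : 0 < r2 by exact: lt_le_trans r12.
have l0 : 0 <= ln (r2 / r1) by apply: ln_ge0; rewrite (ler_pdivlMr _ _ r10) mul1r.
have rayE s t : ray r1 0 s t = (expR s)%:C * circle r1 t.
  by rewrite /ray subr0 add0r.
have cfE t : cauchy_factor r1 (0 : R[i]) t = 1.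
  by rewrite /cauchy_factor subr0 divff// circle_neq0.
have := @circle_int_const R r1 0 r10 zr (fun w => f w / w ^+ k) 0 (ln (r2 / r1)) l0.
move=> /(_ _)/wrap[s t /andP[s0 sl]|].
  have wr : normc (ray r1 0 s t) <= r2.
    rewrite rayE normcM normc_circle// normc_real gtr0_norm ?expR_gt0//.
    rewrite -ler_pdivlMr// -[leRHS]lnK ?ler_expR//.
    by rewrite posrE divr_gt0.
  apply: cdiffM; first exact: df.
  have -> : (fun w : R[i] => (w ^+ k)^-1) = (fun w => w^-1 ^+ k).
    by apply/funext => w; rewrite exprVn.
  apply: cdiffX; apply: cdiffV.
  by rewrite rayE mulf_neq0 ?circle_neq0// -normc_gt0 normc_real normr_gt0 gt_eqF// expR_gt0.
rewrite (@eq_cseg_int _ _ _ (fun t => _) (fun t => f (circle r1 t) / circle r1 t ^+ k)).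
  move=> ->; apply: eq_cseg_int => t _; rewrite cfE mulr1.
  suff -> : ray r1 0 (ln (r2 / r1)) t = circle r2 t by [].
  have e : expR (ln (r2 / r1)) * r1 = r2.
    by rewrite lnK ?posrE ?divr_gt0// divfK// gt_eqF.
  by rewrite rayE /circle -[in RHS]e (rmorphM (real_complex R)) (mulrA (expR _)%:C).
by move=> t _; rewrite cfE mulr1 rayE expR0 mul1r.
Qed.

(** The mean is multiplied by 2^-(k+1) when the radius doubles, although it is a
    Taylor coefficient of the constant 1, hence does not depend on the radius. *)
Lemma circle_mean_negpow r k : 0 < r -> circle_mean (fun t => (circle r t ^+ k.+1)^-1) = 0.
Proof.
move=> r0; have c k' : cseg_cont 0 (2 * pi) (fun t => (circle r t ^+ k')^-1).
  apply: cseg_contV; first by apply: cseg_contX; exact: cseg_cont_circle.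
  by move=> t _; rewrite expf_neq0// circle_neq0.
have H r' : taylor_coef (fun=> 1) r' k.+1 = circle_mean (fun t => (circle r' t ^+ k.+1)^-1).
  by apply: eq_circle_mean => t; rewrite mul1r.
have := @taylor_coef_radius (fun=> 1) r (2 * r) k.+1 r0.
move=> /(_ _ _)/wrap[|w _|]; [lra|exact: cdiff_cst|].
have E t : (circle (2 * r) t ^+ k.+1)^-1 = (2^-1 ^+ k.+1)%:C * (circle r t ^+ k.+1)^-1.
  have -> : circle (2 * r) t = 2%:C * circle r t.
    by rewrite /circle (rmorphM (real_complex R)) (mulrA 2%:C).
  by rewrite exprMn invfM (rmorphXn (real_complex R)) (fmorphV (real_complex R)) exprVn.
rewrite (H r) (H (2 * r)) (eq_circle_mean E).
rewrite circle_meanZ// => /eqP; rewrite -subr_eq0 -{1}[circle_mean _]mul1r -mulrBl.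
rewrite mulf_eq0 => /orP[|/eqP//].
have -> : 1 - (2^-1 ^+ k.+1)%:C = (1 - 2^-1 ^+ k.+1)%:C :> R[i].
  by rewrite (rmorphB (real_complex R)).
rewrite -normc_eq0 normc_real normr_eq0 subr_eq0 eq_sym pexpr_eq1//.
by move=> /eqP h; exfalso; lra.
Qed.

End CircleMean.

(** * Cauchy's formula and Taylor expansions *)

Section CauchyFormula.
Variable R : realType.
Implicit Types (f : R[i] -> R[i]) (F G : R -> R[i]) (r s t : R) (z w : R[i]).

(** Geometric expansion of the Cauchy kernel, with remainder. *)
Lemma cauchy_factor_expansion F r z M N : 0 < r -> normc z < r ->
  cseg_cont 0 (2 * pi) F -> (forall t, 0 <= t <= 2 * pi -> normc (F t) <= M) ->
  normc (circle_mean (fun t => F t * cauchy_factor r z t) -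
    \sum_(k < N) circle_mean (fun t => F t / circle r t ^+ k) * z ^+ k) <=
  2 * (M * ((normc z / r) ^+ N * (r / (r - normc z)))).
Proof.
move=> r0 zr cF FM.
have cV k : cseg_cont 0 (2 * pi) (fun t => (circle r t ^+ k)^-1).
  apply: cseg_contV; first by apply: cseg_contX; exact: cseg_cont_circle.
  by move=> t _; rewrite expf_neq0// circle_neq0.
have cK := @cseg_cont_cauchy_factor R 0 (2 * pi) r z r0 zr.
have cFK := cseg_contM cF cK.
have ck k : cseg_cont 0 (2 * pi) (fun t => z ^+ k * (F t / circle r t ^+ k)).
  by apply: cseg_contM; [exact: cseg_cont_cst|exact: cseg_contM].
have -> : \sum_(k < N) circle_mean (fun t => F t / circle r t ^+ k) * z ^+ k =
    circle_mean (fun t => \sum_(k < N) z ^+ k * (F t / circle r t ^+ k)).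
  rewrite (circle_mean_sum N ck); apply: eq_bigr => k _.
  by rewrite (circle_meanZ _ (cseg_contM cF (cV k))) mulrC.
rewrite -(circle_meanB cFK (cseg_cont_sum N ck)).
apply: circle_mean_le (cseg_contB cFK (cseg_cont_sum N ck)) _.
move=> t t2; pose c := circle r t; pose q := z / c.
have c0 : c != 0 by rewrite circle_neq0.
have cz : c - z != 0 by rewrite circle_neq.
have q1 : 1 - q != 0 by rewrite /q subr_eq0; apply: contraNneq cz => /(congr1 ( *%R^~ c));
  rewrite mul1r divfK// => ->; rewrite subrr.
have -> : \sum_(k < N) z ^+ k * (F t / circle r t ^+ k) = F t * \sum_(k < N) q ^+ k.
  rewrite mulr_sumr; apply: eq_bigr => k _; by rewrite /q (exprMn k z c^-1) (exprVn c k) -/c; ring.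
have qE : \sum_(k < N) q ^+ k = (1 - q ^+ N) / (1 - q).
  by rewrite -[X in X - _](expr1n _ N) subrXX mulrC mulKf//;
    apply: eq_bigr => k _; rewrite expr1n mul1r.
rewrite qE /cauchy_factor -/c (_ : c / (c - z) = (1 - q)^-1); last first.
  by rewrite /q; field; rewrite c0 cz.
have -> : F t / (1 - q) - F t * ((1 - q ^+ N) / (1 - q)) = F t * (q ^+ N * (1 - q)^-1).
  by field.
have rz : 0 < r - normc z by lra.
have qn : normc q = normc z / r by rewrite /q normcM normcV normc_circle.
have n1q : 0 < normc (1 - q) by rewrite normc_gt0.
have K : (normc (1 - q))^-1 <= r / (r - normc z).
  have -> : r / (r - normc z) = (1 - normc z / r)^-1 by field; rewrite !gt_eqF.
  have h := normcD (1 - q) q; rewrite subrK normc1 qn in h.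
  rewrite lef_pV2 ?posrE//; first by lra.
  by rewrite subr_gt0 ltr_pdivrMr// mul1r.
have q0 : 0 <= normc z / r by rewrite divr_ge0 ?normc_ge0// ltW.
rewrite !normcM normcV normcX qn; apply: ler_pM (FM t t2) _.
- exact: normc_ge0.
- by apply: mulr_ge0; [exact: exprn_ge0|rewrite invr_ge0 ltW].
- by apply: ler_wpM2l K; exact: exprn_ge0.
Qed.

Lemma le_geometric_eq0 (x C q : R) : 0 <= q < 1 -> (forall N : nat, x <= C * q ^+ N) -> x <= 0.
Proof.
move=> /andP[q0 q1] H.
have : (fun N : nat => C * q ^+ N) @ \oo --> C * 0.
  by apply: cvgM; [exact: cvg_cst|apply: cvg_expr; rewrite ger0_norm].
rewrite mulr0 => /cvgrPdist_lt H0; apply/ler_addgt0Pr => e /H0[N _ /(_ N (leqnn N))] /=.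
by rewrite sub0r normrN ltr_norml; have := H N; lra.
Qed.

Lemma geometric_le_eq0 z (x C q : R) : 0 <= q < 1 ->
  (forall N : nat, normc (z - x%:C) <= C * q ^+ N) -> z = x%:C.
Proof.
move=> q01 H; apply/eqP; rewrite -subr_eq0 -normc_eq0 eq_le normc_ge0 andbT.
exact: le_geometric_eq0 q01 H.
Qed.

(** In the geometric expansion only the constant term has a nonzero mean. *)
Lemma cauchy_factor_mean r z : 0 < r -> normc z < r ->
  circle_mean (cauchy_factor r z) = 1.
Proof.
move=> r0 zr; have q01 : 0 <= normc z / r < 1.
  by rewrite divr_ge0 ?normc_ge0 ?ltW//= ltr_pdivrMr ?mul1r.
apply: (@geometric_le_eq0 _ 1 (2 * (r / (r - normc z)) * (normc z / r)) _ q01) => N.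
have c1 : cseg_cont 0 (2 * pi) (fun=> 1 : R[i]) by exact: cseg_cont_cst.
have n1 (t : R) (_ : 0 <= t <= 2 * pi) : normc (1 : R[i]) <= 1 by rewrite normc1.
have := @cauchy_factor_expansion (fun=> 1) r z 1 N.+1 r0 zr c1 n1.
rewrite (@eq_circle_mean R (fun t => 1 * cauchy_factor r z t) (cauchy_factor r z)); last first.
  by move=> t; rewrite mul1r.
have T k : circle_mean (fun t => 1 / circle r t ^+ k) = (k == 0%N)%:R.
  case: k => [|k].
    rewrite (@eq_circle_mean R _ (fun=> 1)) ?circle_mean_cst// => t.
    by rewrite expr0 divr1.
  rewrite (@eq_circle_mean R _ (fun t => (circle r t ^+ k.+1)^-1)).
    exact: circle_mean_negpow.
  by move=> t; rewrite div1r.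
rewrite (eq_bigr (fun k : 'I_N.+1 => (k == 0%N :> nat)%:R * z ^+ k)) => [|k _]; last by rewrite T.
rewrite big_ord_recl big1 ?addr0 => [|k _]; last by rewrite mul0r.
rewrite !mul1r => H; apply: (le_trans H).
by rewrite le_eqVlt; apply/orP; left; apply/eqP; rewrite exprS; ring.
Qed.

End CauchyFormula.

Section Taylor.
Variable R : realType.
Implicit Types (f : R[i] -> R[i]) (F G : R -> R[i]) (s t : R) (z w : R[i]).

Lemma ray_dist r z s t : normc (ray r z s t - z) = expR s * normc (circle r t - z).
Proof.
by rewrite /ray addrAC subrr add0r normcM normc_real gtr0_norm ?expR_gt0.
Qed.

Lemma ray_le r z s t : 0 < r -> normc z < r -> s <= 0 -> normc (ray r z s t) <= r.
Proof.
move=> r0 zr s0; have es : expR s <= 1 by rewrite -expR0 ler_expR.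
have -> : ray r z s t = (1 - expR s)%:C * z + (expR s)%:C * circle r t.
  by rewrite /ray (rmorphB (real_complex R)); ring.
apply: (le_trans (normcD _ _)); rewrite (normcM _ z) (normcM _ (circle r t)) !normc_real normc_circle//.
rewrite !ger0_norm ?expR_ge0 ?subr_ge0//.
have : (1 - expR s) * normc z <= (1 - expR s) * r.
  by rewrite ler_wpM2l ?subr_ge0// ltW.
lra.
Qed.

Lemma ray0 r z t : ray r z 0 t = circle r t.
Proof. by rewrite /ray expR0 mul1r addrC subrK. Qed.

(** The curve t |-> z + e^s (r e^(it) - z) shrinks to z as s tends to -oo, while
    the mean of f against the Cauchy kernel along it does not change. *)
Lemma cauchy_formula f r z : 0 < r -> normc z < r ->
  (forall w, normc w <= r -> cdiff f w) ->
  f z = circle_mean (fun t => f (circle r t) * cauchy_factor r z t).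
Proof.
move=> r0 zr df.
have cK := @cseg_cont_cauchy_factor R 0 (2 * pi) r z r0 zr.
have cray s : s <= 0 -> cseg_cont 0 (2 * pi) (fun t => f (ray r z s t)).
  move=> s0; apply: cdiff_cseg_cont => [t _|]; first by apply: df; exact: ray_le.
  apply: cseg_contD; first exact: cseg_cont_cst.
  apply: cseg_contM; first exact: cseg_cont_cst.
  by apply: cseg_contB; [exact: cseg_cont_circle|exact: cseg_cont_cst].
have kap t : normc (cauchy_factor r z t) <= r / (r - normc z).
  have rz : 0 < r - normc z by lra.
  rewrite normcM normcV normc_circle// ler_pM2l// lef_pV2 ?posrE ?normc_gt0 ?circle_neq//.
  by have := normcD (circle r t - z) z; rewrite subrK normc_circle//; lra.
have K0 : 0 < r / (r - normc z) by rewrite divr_gt0//; lra.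
set I := circle_mean _.
have IE s : s <= 0 -> I = circle_mean (fun t => f (ray r z s t) * cauchy_factor r z t).
  move=> s0; rewrite /circle_mean (@circle_int_const R r z r0 zr f s 0 s0).
    by apply: eq_circle_mean => t; rewrite ray0.
  by move=> u t /andP[_ u0]; apply: df; exact: ray_le.
apply/eqP; rewrite eq_sym -subr_eq0 -normc_eq0 eq_le normc_ge0 andbT.
apply/ler_addgt0Pr => e e0; rewrite add0r.
have e1 : 0 < e / (2 * (r / (r - normc z))) by rewrite divr_gt0// mulr_gt0.
have [d d0 Hd] := cdiff_continuous (df z (ltW zr)) e1.
pose s := Num.min 0 (ln (d / (4 * r))).
have s0 : s <= 0 by rewrite ge_min lexx.
have sd t : normc (ray r z s t - z) < d.
  rewrite ray_dist; apply: (@le_lt_trans _ _ (d / (4 * r) * (2 * r))); last first.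
    by rewrite (_ : _ * _ = d / 2); [lra|field; rewrite gt_eqF].
  apply: ler_pM; rewrite ?expR_ge0 ?normc_ge0//.
    rewrite -[leRHS]lnK ?posrE ?divr_gt0 ?mulr_gt0// ler_expR.
    by rewrite ge_min lexx orbT.
  by apply: (le_trans (normcB _ _)); rewrite normc_circle//; lra.
have cfs := cseg_contM (cray s s0) cK.
have cz : cseg_cont 0 (2 * pi) (fun t => f z * cauchy_factor r z t).
  by apply: cseg_contM => //; exact: cseg_cont_cst.
rewrite (IE s s0).
have -> : f z = circle_mean (fun t => f z * cauchy_factor r z t).
  by rewrite circle_meanZ// cauchy_factor_mean// mulr1.
rewrite -circle_meanB//.
apply: (le_trans (circle_mean_le (e := e / (2 * (r / (r - normc z))) * (r / (r - normc z))) _ _)).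
- exact: cseg_contB.
- move=> t _; rewrite -mulrBl normcM ler_pM ?normc_ge0//.
  by rewrite normc_distC ltW//; exact: Hd.
- by rewrite le_eqVlt; apply/orP; left; apply/eqP; field; rewrite !gt_eqF//; lra.
Qed.

(** Cauchy's formula, with the Cauchy kernel expanded in powers of z. *)
Theorem taylor_remainder f r z M N : 0 < r -> normc z < r ->
  (forall w, normc w <= r -> cdiff f w) ->
  (forall t, 0 <= t <= 2 * pi -> normc (f (circle r t)) <= M) ->
  normc (f z - \sum_(k < N) taylor_coef f r k * z ^+ k) <=
  2 * (M * ((normc z / r) ^+ N * (r / (r - normc z)))).
Proof.
move=> r0 zr df fM; rewrite (cauchy_formula r0 zr df).
apply: cauchy_factor_expansion => //.
apply: cdiff_cseg_cont => [t _|]; last exact: cseg_cont_circle.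
by apply: df; rewrite normc_circle.
Qed.

Lemma taylor_coef0 f r : 0 < r -> (forall w, normc w <= r -> cdiff f w) ->
  taylor_coef f r 0 = f 0.
Proof.
move=> r0 df; rewrite (@cauchy_formula f r 0)// ?normc0//.
apply: eq_circle_mean => t; rewrite /cauchy_factor subr0 divff ?circle_neq0//.
by rewrite expr0 invr1.
Qed.

Lemma circle_bounded f r : (forall w, normc w <= r -> cdiff f w) -> 0 < r ->
  exists2 M, 0 <= M & forall t, 0 <= t <= 2 * pi -> normc (f (circle r t)) <= M.
Proof.
move=> df r0.
have cf : cseg_cont 0 (2 * pi) (fun t => f (circle r t)).
  apply: cdiff_cseg_cont => [t _|]; last exact: cseg_cont_circle.
  by apply: df; rewrite normc_circle.
have [|c _ Hc] := @EVT_max R (fun t => normc (f (circle r t))) 0 (2 * pi) (ltW (twopi_gt0 R)).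
  apply: continuous_in_subspaceT => t; rewrite inE/= in_itv/=.
  exact: cseg_cont_norm cf t.
exists (normc (f (circle r c))) => [|t t2]; first exact: normc_ge0.
by apply: Hc; rewrite in_itv.
Qed.

End Taylor.

(** * Holomorphic functions on complex normed spaces *)

Section RealNorm.
Variables (R : realType) (E : normedModType R[i]).
Implicit Types (x y : E).

(** The norm of a normed space over R[i] takes values in R[i]; its real part
    carries the same information. *)
Definition nrm x : R := complex.Re `|x|.

Lemma nrmE x : `|x| = (nrm x)%:C.
Proof.
have : 0 <= `|x| by exact: normr_ge0.
by rewrite /nrm; case: `|x| => a b; rewrite lecE/= => /andP[/eqP -> _].
Qed.

Lemma nrm_ge0 x : 0 <= nrm x.
Proof. by rewrite -lecR -nrmE; exact: normr_ge0. Qed.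

Lemma nrmD x y : nrm (x + y) <= nrm x + nrm y.
Proof. by have := ler_normD x y; rewrite !nrmE -(rmorphD (real_complex R)) lecR. Qed.

Lemma Re_mul_real (u v : R) : complex.Re (u%:C * v%:C) = u * v.
Proof. by rewrite /= mul0r subr0. Qed.

Lemma nrmZ a x : nrm (a *: x) = normc a * nrm x.
Proof.
by rewrite {1}/nrm normrZ norm_normcE nrmE; exact: Re_mul_real.
Qed.

Lemma nrm0 : nrm 0 = 0.
Proof. by rewrite /nrm normr0. Qed.

Lemma nrm_eq0 x : (nrm x == 0) = (x == 0).
Proof.
apply/eqP/eqP => [H|->]; last exact: nrm0.
by apply/eqP; rewrite -normr_eq0 nrmE H.
Qed.

Lemma nrm_gt0 x : (0 < nrm x) = (x != 0).
Proof. by rewrite lt_neqAle nrm_ge0 andbT eq_sym nrm_eq0. Qed.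

Lemma nbhs_nrmP (x : E) (P : set E) :
  nbhs x P <-> exists2 d, 0 < d & forall y, nrm (y - x) < d -> P y.
Proof.
split.
  rewrite -nbhs_ballE => -[_/= /gtc0_real[d d0 ->] dP]; exists d => // y yd.
  by apply: dP; rewrite -ball_normE/= distrC nrmE ltcR.
move=> [d d0 dP]; rewrite -nbhs_ballE; exists d%:C; first by rewrite /= ltcR.
by move=> y; rewrite -ball_normE/= distrC nrmE ltcR; exact: dP.
Qed.

End RealNorm.

Section HDiff.
Variables (R : realType).
Implicit Types (E F : normedModType R[i]).

Definition bounded_lin E F (L : E -> F) := [/\ forall x y, L (x + y) = L x + L y,
  forall a x, L (a *: x) = a *: L x &
  exists2 C, 0 < C & forall x, nrm (L x) <= C * nrm x].

(** Complex differentiability, stated with real-valued norms so that estimates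
    take place in R. *)
Definition hdiff E (f : E -> R[i]) x := exists2 L : E -> R[i]^o, bounded_lin L &
  forall e, 0 < e -> exists2 d, 0 < d & forall h, nrm h < d ->
    normc (f (x + h) - f x - L h) <= e * nrm h.

Lemma nrm_normc (z : R[i]) : nrm (z : R[i]^o) = normc z.
Proof. by []. Qed.

Lemma differentiable_hdiff E (f : E -> R[i]) x :
  differentiable (f : E -> R[i]^o) x -> hdiff f x.
Proof.
move=> /diff_locallyP[cd /eqaddoP H].
exists ('d (f : E -> R[i]^o) x); last first.
  move=> e e0; have e0' : 0 < e%:C :> R[i] by rewrite ltcR.
  have /nbhs_nrmP[d d0 Hd] := H _ e0'; exists d => // h hd.
  have := Hd h; rewrite subr0 => /(_ hd).
  rewrite (nrmE (id h)) -(rmorphM (real_complex R)) -lecR; apply: le_trans.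
  rewrite le_eqVlt; apply/orP; left; apply/eqP.
  rewrite (addrC x h) -addrA -opprD.
  by [].
split.
- by move=> u v; rewrite linearD.
- by move=> a u; rewrite linearZ.
- have /linear_bounded_continuous/linear_boundedP/pinfty_ex_gt0[_ /gtc0_real[C C0 ->] HC] := cd.
  by exists C => // u; have := HC u; rewrite !nrmE -(rmorphM (real_complex R)) lecR.
Qed.

Lemma hdiff_differentiable E (f : E -> R[i]) x :
  hdiff f x -> differentiable (f : E -> R[i]^o) x.
Proof.
move=> [L [LD LZ [C C0 LC]] Lf].
pose L' := HB.pack_for {linear E -> R[i]^o} L
  (GRing.isLinear.Build R[i] E R[i]^o *:%R L (fun a u v =>
    eq_trans (LD (a *: u) v) (congr1 (fun z => z + L v) (LZ a u)))).
have cL : continuous L'.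
  apply/linear_bounded_continuous/linear_boundedP.
  near=> r => u; have rC : C%:C <= r by near: r; apply: nbhs_pinfty_ge; rewrite gtr0_real// ltcR.
  apply: (@le_trans _ _ (C%:C * `|u|)); last by rewrite ler_wpM2r.
  by rewrite !nrmE -(rmorphM (real_complex R)) lecR; exact: LC.
have H : (f : E -> R[i]^o) \o shift x = cst (f x : R[i]^o) + L' +o_ (0 : E) id.
  apply/eqaddoE/eqaddoP => _ /gtc0_real[e e0 ->].
  have [d d0 Hd] := Lf e e0; apply/nbhs_nrmP; exists d => // h; rewrite subr0 => hd.
  rewrite (nrmE (id h)) -(rmorphM (real_complex R)); apply: le_trans (_ : (normc (f (x + h) - f x - L h))%:C <= _).
    by rewrite (addrC x h) -addrA -opprD.
  by rewrite lecR; exact: Hd.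
apply/diff_locallyP; rewrite (diff_unique cL H); split => //.
Unshelve. all: by end_near. Qed.

End HDiff.

Section HDiffTheory.
Variables (R : realType) (E : normedModType R[i]).
Implicit Types (f g : E -> R[i]) (x y h : E).

Lemma hdiff_cst (a : R[i]) x : hdiff (fun=> a) x.
Proof.
exists (fun=> 0); first split.
- by move=> *; rewrite addr0.
- by move=> *; rewrite scaler0.
- by exists 1 => // u; rewrite nrm0 mul1r nrm_ge0.
move=> e e0; exists 1 => // u _.
by rewrite !subrr normc0 mulr_ge0 ?nrm_ge0// ltW.
Qed.

Lemma hdiffD f g x : hdiff f x -> hdiff g x -> hdiff (fun y => f y + g y) x.
Proof.
move=> [L [LD LZ [C C0 LC]] Lf] [M [MD MZ [B B0 MB]] Mg].
exists (fun u => L u + M u); first split.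
- by move=> u v; rewrite LD MD addrACA.
- by move=> a u; rewrite LZ MZ scalerDr.
- exists (C + B) => [|u]; first by rewrite addr_gt0.
  by rewrite (le_trans (nrmD _ _))// mulrDl lerD.
move=> e e0; have e2 : 0 < e / 2 by lra.
have [d1 d10 H1] := Lf _ e2; have [d2 d20 H2] := Mg _ e2.
exists (Num.min d1 d2) => [|u]; first by rewrite lt_min d10.
rewrite lt_min => /andP[/H1 h1 /H2 h2].
have -> : f (x + u) + g (x + u) - (f x + g x) - (L u + M u) =
  (f (x + u) - f x - L u) + (g (x + u) - g x - M u) by ring.
by rewrite (le_trans (normcD _ _))//; lra.
Qed.

Lemma hdiffZ (a : R[i]) f x : hdiff f x -> hdiff (fun y => a * f y) x.
Proof.
move=> [L [LD LZ [C C0 LC]] Lf].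
have a1 : 0 < 1 + normc a by rewrite ltr_wpDr ?normc_ge0.
exists (fun u => a * L u); first split.
- by move=> u v; rewrite LD mulrDr.
- by move=> b u; rewrite LZ [RHS]mulrCA.
- exists ((1 + normc a) * C) => [|u]; first by rewrite mulr_gt0.
  rewrite nrm_normc normcM -mulrA ler_pM ?normc_ge0//; last exact: LC.
  by rewrite lerDr.
move=> e e0; have e2 : 0 < e / (1 + normc a) by rewrite divr_gt0.
have [d d0 H] := Lf _ e2; exists d => // u /H h1.
rewrite -!mulrBr normcM.
have : normc a * normc (f (x + u) - f x - L u)
    <= (1 + normc a) * (e / (1 + normc a) * nrm u).
  by rewrite ler_pM ?normc_ge0// lerDr.
suff -> : (1 + normc a) * (e / (1 + normc a) * nrm u) = e * nrm u by [].
by field; rewrite gt_eqF.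
Qed.

Lemma hdiffB f g x : hdiff f x -> hdiff g x -> hdiff (fun y => f y - g y) x.
Proof.
move=> df /(@hdiffZ (-1)) dg; have := hdiffD df dg.
have -> : (fun y => f y + -1 * g y) = (fun y => f y - g y); last by [].
by apply/funext => y; rewrite mulN1r.
Qed.

Lemma hdiff_sum N (F : nat -> E -> R[i]) x :
  (forall k, (k < N)%N -> hdiff (F k) x) -> hdiff (fun y => \sum_(k < N) F k y) x.
Proof.
elim: N => [|N IH] H.
  have -> : (fun y => \sum_(k < 0) F k y) = (fun=> 0).
    by apply/funext => y; rewrite big_ord0.
  exact: hdiff_cst.
have -> : (fun y => \sum_(k < N.+1) F k y) = (fun y => \sum_(k < N) F k y + F N y).
  by apply/funext => y; rewrite big_ord_recr.
by apply: hdiffD; [apply: IH => k kN; apply: H; rewrite ltnS ltnW|exact: H].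
Qed.

Lemma hdiff_near f g x d : 0 < d -> (forall y, nrm (y - x) < d -> f y = g y) ->
  hdiff f x -> hdiff g x.
Proof.
move=> d0 fg [L LL Lf]; exists L => // e /Lf[c c0 H].
exists (Num.min c d) => [|u]; first by rewrite lt_min c0.
rewrite lt_min => /andP[/H + ud]; rewrite (fg x) ?subrr ?nrm0// (fg (x + u))//.
by rewrite addrC addKr.
Qed.

Lemma hdiff_continuous f x : hdiff f x -> forall e, 0 < e ->
  exists2 d, 0 < d & forall y, nrm (y - x) < d -> normc (f y - f x) < e.
Proof.
move=> [L [LD LZ [C C0 LC]] Lf] e e0; have [d d0 H] := Lf 1 ltr01.
have C1 : 0 < 1 + C by rewrite addr_gt0.
exists (Num.min d (e / (1 + C))) => [|y]; first by rewrite lt_min d0 divr_gt0.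
rewrite lt_min ltr_pdivlMr// => /andP[yd ye].
have := H _ yd; rewrite mul1r (addrC x) subrK => h1.
have h2 := LC (y - x); rewrite nrm_normc in h2.
have -> : f y - f x = (f y - f x - L (y - x)) + L (y - x) by rewrite subrK.
by rewrite (le_lt_trans (normcD _ _))//; lra.
Qed.

Lemma hdiff_line f x h (a : R[i]) : hdiff f (x + a *: h) ->
  cdiff (fun b => f (x + b *: h)) a.
Proof.
move=> [L [LD LZ [C C0 LC]] Lf].
apply: (@cdiff_near _ _ _ (L h) (fun b => if b == a then L h else
   (f (x + b *: h) - f (x + a *: h)) / (b - a))).
  apply: nearW => b; case: eqVneq => [->|ba]; first by rewrite !subrr mulr0.
  by rewrite divfK// subr_eq0.
move=> e e0; have h1 : 0 < 1 + nrm h by rewrite ltr_wpDr ?nrm_ge0.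
have [d d0 H] := Lf (e / 2 / (1 + nrm h)) ltac:(by rewrite !divr_gt0).
exists (d / (1 + nrm h)) => [|b bd /=]; first by rewrite divr_gt0.
case: eqVneq => [_|ba]; first by rewrite subrr normc0.
have ba0 : 0 < normc (b - a) by rewrite normc_gt0 subr_eq0.
have := H ((b - a) *: h); rewrite nrmZ => /(_ _)/wrap[|].
  rewrite ltr_pdivlMr// in bd; apply: le_lt_trans bd.
  by rewrite ler_pM2l// lerDr.
have -> : x + a *: h + (b - a) *: h = x + b *: h.
  by rewrite scalerBl -addrA [a *: h + _]addrC subrK.
have LE : L ((b - a) *: h) = (b - a) * L h by rewrite LZ.
rewrite LE => H1.
have -> : L h - (f (x + b *: h) - f (x + a *: h)) / (b - a) =
  - (f (x + b *: h) - f (x + a *: h) - (b - a) * L h) / (b - a).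
  by field; rewrite subr_eq0.
rewrite normcM normcN normcV ltr_pdivrMr//; apply: (le_lt_trans H1).
have -> : e / 2 / (1 + nrm h) * (normc (b - a) * nrm h) =
    e / 2 * (nrm h / (1 + nrm h)) * normc (b - a) by ring.
rewrite ltr_pM2r//.
have n1 : nrm h / (1 + nrm h) <= 1 by rewrite ler_pdivrMr// mul1r lerDr.
have : e / 2 * (nrm h / (1 + nrm h)) <= e / 2 * 1 by rewrite ler_pM2l//; lra.
lra.
Qed.

(** Schwarz-type estimate: the first Taylor remainder on the complex line
    through x and x + h. *)
Lemma hdiff_lipschitz f x d M h : 0 < d ->
  (forall y, nrm (y - x) < d -> hdiff f y) ->
  (forall y, nrm (y - x) < d -> normc (f y) <= M) ->
  nrm h <= d / 4 -> normc (f (x + h) - f x) <= 8 * M / d * nrm h.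
Proof.
move=> d0 df fM hd.
have M0 : 0 <= M by apply: le_trans (fM x _); rewrite ?normc_ge0// subrr nrm0.
have [->|h0] := eqVneq h 0.
  by rewrite addr0 subrr normc0 nrm0 mulr0.
have nh : 0 < nrm h by rewrite nrm_gt0.
pose r := d / 2 / nrm h.
have r2 : 2 <= r by rewrite /r ler_pdivlMr//; lra.
have r0 : 0 < r by lra.
have rE : r * nrm h = d / 2 by rewrite /r divfK// gt_eqF.
have ball b : normc b <= r -> nrm (x + b *: h - x) < d.
  move=> br; rewrite addrC addKr nrmZ.
  have : normc b * nrm h <= r * nrm h by rewrite ler_pM2r.
  lra.
pose ph b := f (x + b *: h).
have dph b : normc b <= r -> cdiff ph b.
  by move=> br; apply: hdiff_line; apply: df; exact: ball.
have phM t : 0 <= t <= 2 * pi -> normc (ph (circle r t)) <= M.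
  by move=> _; apply: fM; apply: ball; rewrite normc_circle.
have := @taylor_remainder R ph r 1 M 1 r0 _ dph phM; rewrite normc1.
move=> /(_ _)/wrap[|]; first lra.
rewrite big_ord_recl big_ord0 addr0 expr0 mulr1 taylor_coef0// expr1.
rewrite /ph scale0r addr0 scale1r => H; apply: (le_trans H).
have -> : 2 * (M * (1 / r * (r / (r - 1)))) = M * (2 / (r - 1)).
  by field; rewrite !gt_eqF//; lra.
have -> : 8 * M / d * nrm h = M * (4 / r).
  by rewrite /r; field; rewrite !gt_eqF.
apply: ler_wpM2l => //; rewrite ler_pdivrMr; last lra.
by rewrite mulrAC ler_pdivlMr//; lra.
Qed.

End HDiffTheory.

(** * Uniform limits of holomorphic functions *)

Section Approximation.
Variable R : realType.
Implicit Types (X Y Q B : R) (z : R[i]).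

Lemma le_harmonic X Y Q : (forall n : nat, X <= Y + n.+1%:R^-1 * Q) -> X <= Y.
Proof.
move=> H; have [Q0|Q0] := leP Q 0.
  by have := H 0%N; rewrite invr1 mul1r; lra.
apply/ler_addgt0Pr => e e0; pose n := Num.bound (Q / e).
have Qn : Q / e < n%:R by apply: archi_boundP; rewrite divr_ge0 ?ltW.
apply: (le_trans (H n)); rewrite lerD2l ler_pdivrMl//.
rewrite ltr_pdivrMr// in Qn.
have : n%:R * e <= n.+1%:R * e by rewrite ler_pM2r// ler_nat.
lra.
Qed.

Lemma harmonic_eq0 z Q : (forall n : nat, normc z <= n.+1%:R^-1 * Q) -> z = 0.
Proof.
move=> H; apply/eqP; rewrite -normc_eq0 eq_le normc_ge0 andbT.
by apply: (@le_harmonic _ _ Q) => n; rewrite add0r.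
Qed.

(** The limit is the supremum of the sequence u n - B / (n + 1), which is bounded
    above by each u m + B / (m + 1). *)
Lemma harmonic_cauchy (u : nat -> R) B :
  (forall n m : nat, `|u n - u m| <= (n.+1%:R^-1 + m.+1%:R^-1) * B) ->
  exists l, forall n : nat, `|u n - l| <= n.+1%:R^-1 * B.
Proof.
move=> H; pose v n := u n - n.+1%:R^-1 * B.
have vu n m : v n <= u m + m.+1%:R^-1 * B.
  have := H n m; rewrite /v mulrDl ler_norml.
  by set p := _ * B; set q := _ * B; lra.
have hs : has_sup (range v).
  by split; [exists (v 0%N), 0%N|exists (u 0%N + 1%:R^-1 * B) => _ [j _ <-]].
exists (sup (range v)) => n.
have h1 : v n <= sup (range v) by apply: ub_le_sup; [case: hs|exists n].
have h2 : sup (range v) <= u n + n.+1%:R^-1 * B.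
  by apply: ge_sup; [case: hs|move=> _ [j _ <-]].
by rewrite ler_norml; move: h1 h2; rewrite /v; set p := _ * B; lra.
Qed.

Lemma harmonic_ccauchy (u : nat -> R[i]) B :
  (forall n m : nat, normc (u n - u m) <= (n.+1%:R^-1 + m.+1%:R^-1) * B) ->
  exists l, forall n : nat, normc (u n - l) <= n.+1%:R^-1 * (2 * B).
Proof.
move=> H.
have [|l Hl] := @harmonic_cauchy (fun n => complex.Re (u n)) B.
  by move=> n m; apply: le_trans (H n m); rewrite -raddfB; exact: Re_le_normc.
have [|k Hk] := @harmonic_cauchy (fun n => complex.Im (u n)) B.
  by move=> n m; apply: le_trans (H n m); rewrite -raddfB; exact: Im_le_normc.
exists (Complex l k) => n; apply: (le_trans (normc_le_ReIm _)).
by rewrite !raddfB/= mulr_natl mulr2n mulrDr; apply: lerD; [exact: Hl|exact: Hk].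
Qed.

End Approximation.

Section UniformLimit.
Variables (R : realType) (E : normedModType R[i]).
Implicit Types (f g : E -> R[i]) (x y h : E).

Definition hdiff_remainder f x (L : E -> R[i]) := forall e, 0 < e ->
  exists2 d, 0 < d & forall h, nrm h < d ->
    normc (f (x + h) - f x - L h) <= e * nrm h.

Lemma hdiff_remainderB f g x L M :
  hdiff_remainder f x L -> hdiff_remainder g x M ->
  hdiff_remainder (fun y => f y - g y) x (fun h => L h - M h).
Proof.
move=> fL gM e e0; have e2 : 0 < e / 2 by lra.
have [d1 d10 H1] := fL _ e2; have [d2 d20 H2] := gM _ e2.
exists (Num.min d1 d2) => [|u]; first by rewrite lt_min d10.
rewrite lt_min => /andP[/H1 h1 /H2 h2].
have -> : f (x + u) - g (x + u) - (f x - g x) - (L u - M u) =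
  (f (x + u) - f x - L u) - (g (x + u) - g x - M u) by ring.
by rewrite (le_trans (normcB _ _))//; lra.
Qed.

Lemma hdiff_remainder_bound f x L d (B : R) : 0 < d -> hdiff_remainder f x L ->
  (forall (a : R[i]) h, L (a *: h) = a * L h) ->
  (forall h, nrm h <= d -> normc (f (x + h) - f x) <= B * nrm h) ->
  forall h, normc (L h) <= B * nrm h.
Proof.
move=> d0 fL LZ fB h; apply/ler_addgt0Pr => e e0.
have h1 : 0 < 1 + nrm h by rewrite ltr_wpDr ?nrm_ge0.
have e1 : 0 < e / (1 + nrm h) by rewrite divr_gt0.
have [c c0 H] := fL _ e1.
pose t := Num.min c d / 2 / (1 + nrm h).
have m0 : 0 < Num.min c d by rewrite lt_min c0.
have t0 : 0 < t by rewrite /t !divr_gt0.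
have nth : nrm (t%:C *: h) = t * nrm h by rewrite nrmZ normc_real gtr0_norm.
have th : t * nrm h < Num.min c d.
  have : t * nrm h <= t * (1 + nrm h) by rewrite ler_pM2l// lerDr.
  by rewrite {2}/t divfK ?gt_eqF//; lra.
move: th; rewrite lt_min => /andP[tc td].
have b1 := H (t%:C *: h); rewrite nth in b1; have {}b1 := b1 tc.
have b2 := fB (t%:C *: h); rewrite nth in b2; have {}b2 := b2 (ltW td).
have LE := LZ t%:C h.
have : t * normc (L h) <= t * (B * nrm h + e).
  have -> : t * normc (L h) = normc (L (t%:C *: h)).
    by rewrite LE normcM normc_real gtr0_norm.
  have -> : L (t%:C *: h) = (f (x + t%:C *: h) - f x)
      - (f (x + t%:C *: h) - f x - L (t%:C *: h)) by ring.
  apply: (le_trans (normcB _ _)).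
  have e2 : e / (1 + nrm h) * (t * nrm h) <= t * e.
    have -> : e / (1 + nrm h) * (t * nrm h) = t * e * (nrm h / (1 + nrm h)) by ring.
    have q1 : nrm h / (1 + nrm h) <= 1 by rewrite ler_pdivrMr// mul1r lerDr.
    by apply: ler_piMr q1; exact: (mulr_ge0 (ltW t0) (ltW e0)).
  by rewrite mulrDr; lra.
by rewrite ler_pM2l.
Qed.

(** Weierstrass: the Lipschitz estimate makes the differentials of a uniformly
    convergent sequence converge too. *)
Theorem hdiff_uniform_limit g x d : 0 < d ->
  (forall e, 0 < e -> exists2 f, (forall y, nrm (y - x) < d -> hdiff f y) &
     forall y, nrm (y - x) < d -> normc (f y - g y) <= e) ->
  hdiff g x.
Proof.
move=> d0 H.
have a0 n : 0 < n.+1%:R^-1 :> R by rewrite invr_gt0 ltr0n.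
have /choice[f Hf] : forall n : nat, exists f, (forall y, nrm (y - x) < d -> hdiff f y) /\
     forall y, nrm (y - x) < d -> normc (f y - g y) <= n.+1%:R^-1.
  by move=> n; have [f f1 f2] := H _ (a0 n); exists f.
have xx : nrm (x - x) < d by rewrite subrr nrm0.
have /choice[L HL] : forall n, exists L : E -> R[i]^o, bounded_lin L /\ hdiff_remainder (f n) x L.
  by move=> n; have [L bL fL] := (Hf n).1 x xx; exists L.
pose K := 8 / d.
have K0 : 0 < K by rewrite divr_gt0.
have d4 : 0 < d / 4 by lra.
have fnm n m h : nrm h <= d / 4 ->
    normc ((f n (x + h) - f m (x + h)) - (f n x - f m x)) <=
      K * (n.+1%:R^-1 + m.+1%:R^-1) * nrm h.
  move=> hd.
  have := @hdiff_lipschitz R E (fun y => f n y - f m y) x d (n.+1%:R^-1 + m.+1%:R^-1) h d0.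
  rewrite /K [8 * _ / d]mulrAC; apply => //.
    by move=> y yd; apply: hdiffB; [exact: (Hf n).1|exact: (Hf m).1].
  move=> y yd; have -> : f n y - f m y = (f n y - g y) - (f m y - g y) by ring.
  by apply: (le_trans (normcB _ _)); apply: lerD; [exact: (Hf n).2|exact: (Hf m).2].
have Lnm h n m : normc (L n h - L m h) <= (n.+1%:R^-1 + m.+1%:R^-1) * (K * nrm h).
  have := hdiff_remainder_bound d4 (hdiff_remainderB (HL n).2 (HL m).2) _ (fnm n m).
  rewrite (_ : (_ + _) * (K * nrm h) = K * (n.+1%:R^-1 + m.+1%:R^-1) * nrm h); last by ring.
  apply => a u; have [[_ Zn _] _] := HL n; have [[_ Zm _] _] := HL m.
  by rewrite Zn Zm mulrBr.
have /choice[l Hl] : forall h, exists z, forall n : nat,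
    normc (L n h - z) <= n.+1%:R^-1 * (2 * (K * nrm h)).
  by move=> h; exact: harmonic_ccauchy (Lnm h).
exists l; first split.
- move=> u v; apply/eqP; rewrite -subr_eq0; apply/eqP.
  apply: (@harmonic_eq0 _ _ (2 * (K * nrm (u + v)) + 2 * (K * nrm u) + 2 * (K * nrm v))) => n.
  have [[D _ _] _] := HL n.
  have -> : l (u + v) - (l u + l v) =
     (L n u - l u) + (L n v - l v) - (L n (u + v) - l (u + v)) by rewrite D; ring.
  apply: (le_trans (normcB _ _)); have := normcD (L n u - l u) (L n v - l v).
  by have := Hl u n; have := Hl v n; have := Hl (u + v) n; move: (n.+1%:R^-1) => c; lra.
- move=> a u; apply/eqP; rewrite -subr_eq0; apply/eqP.
  apply: (@harmonic_eq0 _ _ (2 * (K * nrm (a *: u)) + normc a * (2 * (K * nrm u)))) => n.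
  have [[_ Z _] _] := HL n.
  have Zu : L n (a *: u) = a * L n u by exact: Z.
  have -> : l (a *: u) - a * l u =
     a * (L n u - l u) - (L n (a *: u) - l (a *: u)) by rewrite Zu; ring.
  apply: (le_trans (normcB _ _)); rewrite normcM.
  have : normc a * normc (L n u - l u) <= normc a * (n.+1%:R^-1 * (2 * (K * nrm u))).
    by apply: ler_wpM2l; rewrite ?normc_ge0.
  by have := Hl (a *: u) n; move: (n.+1%:R^-1) => c; lra.
- have [[_ _ [C C0 LC]] _] := HL 0%N; exists (C + 2 * K) => [|u]; first by lra.
  have := Hl u 0%N; rewrite invr1 mul1r => h1.
  have h2 := LC u; rewrite nrm_normc in h2; rewrite nrm_normc.
  have -> : l u = L 0%N u - (L 0%N u - l u) by ring.
  by apply: (le_trans (normcB _ _)); lra.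
move=> e e0.
(* The three terms of the final estimate are at most K |h| / (n + 1),
   e |h| / 2 and 2 K |h| / (n + 1). *)
pose n := Num.bound (6 * K / e).
have ne : n.+1%:R^-1 * (6 * K) <= e.
  have Qn : 6 * K / e < n%:R by apply: archi_boundP; apply/ltW/divr_gt0 => //; lra.
  rewrite ler_pdivrMl//; rewrite ltr_pdivrMr// in Qn.
  have : n%:R * e <= n.+1%:R * e by rewrite ler_pM2r// ler_nat.
  lra.
have e2 : 0 < e / 2 by lra.
have [c c0 Hc] := (HL n).2 _ e2.
exists (Num.min c (d / 4)) => [|h]; first by rewrite lt_min c0.
rewrite lt_min => /andP[hc hd].
have xhd : nrm (x + h - x) < d by rewrite addrC addKr; lra.
have t1 : normc ((g (x + h) - f n (x + h)) - (g x - f n x)) <= K * n.+1%:R^-1 * nrm h.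
  apply: (@le_harmonic _ _ _ (K * nrm h + 2)) => m.
  have -> : (g (x + h) - f n (x + h)) - (g x - f n x) =
    ((f m (x + h) - f n (x + h)) - (f m x - f n x))
      - ((f m (x + h) - g (x + h)) - (f m x - g x)) by ring.
  apply: (le_trans (normcB _ _)).
  have := fnm m n h (ltW hd); have := normcB (f m (x + h) - g (x + h)) (f m x - g x).
  have := (Hf m).2 _ xhd; have := (Hf m).2 _ xx.
  move=> k1 k2 k3 k4.
  by move: k1 k2 k3 k4; move: (m.+1%:R^-1) (n.+1%:R^-1) => c1 c2; lra.
have -> : g (x + h) - g x - l h =
   ((g (x + h) - f n (x + h)) - (g x - f n x)) + (f n (x + h) - f n x - L n h)
     + (L n h - l h) by ring.
apply: (le_trans (normcD _ _)).
have := normcD ((g (x + h) - f n (x + h)) - (g x - f n x)) (f n (x + h) - f n x - L n h).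
have := Hl h n; have := Hc _ hc.
have : n.+1%:R^-1 * (6 * K) * nrm h <= e * nrm h by rewrite ler_wpM2r ?nrm_ge0.
by move: t1; move: (n.+1%:R^-1) => c1; lra.
Qed.

(** By induction on k: for small b the function
    (H z b - sum_(i < k) c_i(z) b^i) / b^k is holomorphic in z and differs from the
    k-th coefficient by O(b), uniformly in z. *)
Theorem hdiff_taylor_coef (H : E -> R[i] -> R[i]) x d s M k : 0 < d -> 0 < s ->
  (forall y b, nrm (y - x) < d -> normc b <= s -> cdiff (H y) b) ->
  (forall y b, nrm (y - x) < d -> normc b <= s -> normc (H y b) <= M) ->
  (forall y b, nrm (y - x) < d -> normc b < s -> hdiff (H^~ b) y) ->
  forall y, nrm (y - x) < d -> hdiff (fun z => taylor_coef (H z) s k) y.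
Proof.
move=> d0 s0 cH HM dH; elim/ltn_ind: k => k IH y yd.
have M0 : 0 <= M.
  by apply: le_trans (HM y 0 yd _); rewrite ?normc0 ?normc_ge0// ltW.
have c0 : 0 < d - nrm (y - x) by lra.
have inball z : nrm (z - y) < d - nrm (y - x) -> nrm (z - x) < d.
  have -> : z - x = (z - y) + (y - x) by rewrite addrA subrK.
  by have := nrmD (z - y) (y - x); lra.
apply: (hdiff_uniform_limit c0) => e e0.
pose Q := 4 * M / s ^+ k.+1.
have Q0 : 0 <= Q by rewrite divr_ge0 ?mulr_ge0// exprn_ge0// ltW.
pose b := Num.min (s / 2) (e / (1 + Q)).
have b0 : 0 < b by rewrite lt_min !divr_gt0// ltr_wpDr.
have bs : b <= s / 2 by rewrite ge_min lexx.
have be : b * Q <= e.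
  have : b <= e / (1 + Q) by rewrite ge_min lexx orbT.
  rewrite ler_pdivlMr ?ltr_wpDr// => h; apply: le_trans h.
  by rewrite ler_pM2l// lerDr.
have nb : normc (b%:C : R[i]) = b by rewrite normc_real gtr0_norm.
have bC0 : (b%:C : R[i]) != 0 by rewrite -normc_gt0 nb.
exists (fun z => (b%:C ^+ k)^-1 *
    (H z b%:C - \sum_(i < k) taylor_coef (H z) s i * b%:C ^+ i)) => z /inball zd.
  apply: hdiffZ; apply: hdiffB; first by apply: dH => //; rewrite nb; lra.
  apply: (@hdiff_sum _ _ k (fun i z => taylor_coef (H z) s i * b%:C ^+ i)) => i ik.
  have -> : (fun z => taylor_coef (H z) s i * b%:C ^+ i) =
      (fun z => b%:C ^+ i * taylor_coef (H z) s i) by apply/funext => u; rewrite mulrC.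
  by apply: hdiffZ; exact: IH.
have bk0 : (b%:C ^+ k : R[i]) != 0 by rewrite expf_neq0.
have -> : (b%:C ^+ k)^-1 * (H z b%:C - \sum_(i < k) taylor_coef (H z) s i * b%:C ^+ i)
    - taylor_coef (H z) s k =
   (b%:C ^+ k)^-1 * (H z b%:C - \sum_(i < k.+1) taylor_coef (H z) s i * b%:C ^+ i).
  by rewrite big_ord_recr/=; field.
rewrite normcM normcV normcX nb.
have bs' : normc (b%:C : R[i]) < s by rewrite nb; lra.
have T := @taylor_remainder R (H z) s b%:C M k.+1 s0 bs'
   (fun w ws => cH z w zd ws) (fun t _ => HM z _ zd _).
have {T} T := T (fun t => eq_ind_r (fun u => u <= s) (lexx s) (normc_circle s0 t)).
rewrite nb in T.
apply: (@le_trans _ _ ((b ^+ k)^-1 * (2 * (M * ((b / s) ^+ k.+1 * (s / (s - b))))))).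
  by rewrite ler_pM2l// invr_gt0 exprn_gt0.
apply: le_trans be.
have -> : (b ^+ k)^-1 * (2 * (M * ((b / s) ^+ k.+1 * (s / (s - b))))) =
   b * (2 * M / s ^+ k.+1 * (s / (s - b))).
  rewrite expr_div_n exprS; field; rewrite !gt_eqF ?exprn_gt0//; lra.
rewrite ler_pM2l// /Q (_ : 4 * M / s ^+ k.+1 = 2 * M / s ^+ k.+1 * 2); last by ring.
apply: ler_wpM2l; first by rewrite divr_ge0 ?mulr_ge0// exprn_ge0// ltW.
by rewrite ler_pdivrMr; lra.
Qed.

End UniformLimit.

(** * Measurability through real coordinates *)

Section Coordinates.
Context d (X : measurableType d) (R : realType) (J : finType) (c : J -> X -> R).

(** The topology on X pulled back by a finite family of real coordinates, given
    by its neighbourhood filters; measurable spaces of tuples carry none. *)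
Definition coord_nbhs (x : X) : set_system X :=
  [set P | exists2 e, 0 < e & forall y, (forall j, `|c j y - c j x| < e) -> P y].

Definition coord_open (A : set X) := forall x, A x -> coord_nbhs x A.

Global Instance coord_nbhs_filter x : ProperFilter (coord_nbhs x).
Proof.
split.
  by move=> [e e0 /(_ x)]; apply => j; rewrite subrr normr0.
split=> [|P Q [e e0 eP] [f f0 fQ]|P Q PQ [e e0 eP]]; first by exists 1.
  exists (Num.min e f) => [|y H]; first by rewrite lt_min e0.
  by split; [apply: eP|apply: fQ] => j; have := H j; rewrite lt_min => /andP[].
by exists e => // y /eP /PQ.
Qed.

Lemma cvg_coord x j : c j y @[y --> coord_nbhs x] --> c j x.
Proof.
by apply/cvgrPdist_lt => e e0; exists e => // y; rewrite distrC; apply.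
Qed.

Hypothesis mc : forall j, measurable_fun [set: X] (c j).

(** A coordinate-open set is a countable union of rational boxes. *)
Lemma measurable_coord_open A : coord_open A -> measurable A.
Proof.
move=> oA.
pose box (q : {ffun J -> rat} * nat) : set X :=
  \bigcap_(j in [set: J]) (c j @^-1` ball (ratr (q.1 j) : R) (q.2.+1%:R^-1 / 2)).
have mbox q : measurable (box q).
  apply: fin_bigcap_measurable => [|j _]; first exact: finite_finset.
  rewrite -[X in measurable X]setTI; apply: mc => //.
  by rewrite ball_itv; exact: measurable_itv.
have -> : A = \bigcup_(q in [set: {ffun J -> rat} * nat])
    (if pselect (box q `<=` A) then box q else set0).
  apply/seteqP; split => [x Ax|x [q _]]; last by case: pselect => // bA; exact: bA.
  have [e e0 eA] := oA x Ax.
  pose n := Num.bound e^-1.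
  have ne : n.+1%:R^-1 < e.
    rewrite invf_plt ?posrE//; apply: (@lt_trans _ _ n%:R); last by rewrite ltr_nat.
    by apply: archi_boundP; rewrite invr_ge0 ltW.
  have n0 : 0 < n.+1%:R^-1 :> R by rewrite invr_gt0 ltr0n.
  have /choice[q Hq] : forall j, exists q : rat, `|ratr q - c j x| < n.+1%:R^-1 / 2.
    move: (n.+1%:R^-1) n0 => w w0 j.
    have : c j x - w / 2 < c j x + w / 2 by lra.
    by move=> /rat_in_itvoo[q]; rewrite in_itv/= => h; exists q; rewrite ltr_norml; lra.
  exists (finfun q, n) => //=; case: pselect => [_ j _ /=|].
    by rewrite /ball/= ffunE.
  case=> y bx; apply: eA => j.
  have := bx j I; rewrite /ball/= ffunE; have := Hq j.
  by move: (n.+1%:R^-1) ne => w we; rewrite !ltr_norml; lra.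
apply: countable_bigcupT_measurable => [|q]; first exact: countableP.
by case: pselect => a /=; [exact: mbox|exact: measurable0].
Qed.

Lemma measurable_fun_coord (D : set X) (f : X -> R) : coord_open D ->
  (forall x, D x -> f y @[y --> coord_nbhs x] --> f x) -> measurable_fun D f.
Proof.
move=> oD cf; apply: (measurability _ (RGenOpens.measurableE R)).
move=> _ [_ [a [b ->] <-]]; apply: measurable_coord_open => x [Dx fx].
apply: filterI; first exact: oD.
by apply: (cf x Dx); apply: open_nbhs_nbhs; split => //; exact: interval_open.
Qed.

Lemma coord_openT : coord_open [set: X].
Proof. by move=> x _; exact: filterT. Qed.

End Coordinates.

Section SumOfCoordinates.
Context d1 d2 (X1 : measurableType d1) (X2 : measurableType d2) (R : realType).
Context (J1 J2 : finType) (c1 : J1 -> X1 -> R) (c2 : J2 -> X2 -> R).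

Definition coord_sum (j : J1 + J2) (x : X1 * X2) : R :=
  match j with inl i => c1 i x.1 | inr i => c2 i x.2 end.

Lemma measurable_coord_sum :
  (forall j, measurable_fun setT (c1 j)) -> (forall j, measurable_fun setT (c2 j)) ->
  forall j, measurable_fun setT (coord_sum j).
Proof.
move=> m1 m2 [j|j] /=; first exact: (measurableT_comp (m1 j)).
exact: (measurableT_comp (m2 j)).
Qed.

Lemma coord_nbhs_fst x : fst @ coord_nbhs coord_sum x `=>` coord_nbhs c1 x.1.
Proof.
move=> P [e e0 eP]; exists e => // y H; apply: eP => j.
exact: (H (inl j)).
Qed.

Lemma coord_nbhs_snd x : snd @ coord_nbhs coord_sum x `=>` coord_nbhs c2 x.2.
Proof.
move=> P [e e0 eP]; exists e => // y H; apply: eP => j.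
exact: (H (inr j)).
Qed.

End SumOfCoordinates.

Section VectorLimits.
Variables (R : realType).

(** Limits in a normed space over R[i], again with a real-valued norm. *)
Definition cvge (E : normedModType R[i]) {T : Type} (F : set_system T) (f : T -> E) (a : E) :=
  forall e, 0 < e -> F [set x | nrm (f x - a) < e].

Context {T : Type} {F : set_system T} {FF : Filter F}.

Lemma cvge_cst (E : normedModType R[i]) (a : E) : cvge F (fun=> a) a.
Proof. by move=> e e0; apply: nearW => x; rewrite /= subrr nrm0. Qed.

Lemma cvgeD (E : normedModType R[i]) (f g : T -> E) a b :
  cvge F f a -> cvge F g b -> cvge F (fun x => f x + g x) (a + b).
Proof.
move=> fa gb e e0; have e2 : 0 < e / 2 by lra.
apply: filterS2 (fa _ e2) (gb _ e2) => x /= h1 h2.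
rewrite opprD addrACA; apply: le_lt_trans (nrmD _ _) _; lra.
Qed.

Lemma cvgeZ (E : normedModType R[i]) (f : T -> R[i]) a (v : E) :
  cvgc F f a -> cvge F (fun x => f x *: v) (a *: v).
Proof.
move=> fa e e0; have v1 : 0 < 1 + nrm v by rewrite ltr_wpDr ?nrm_ge0.
have e1 : 0 < e / (1 + nrm v) by rewrite divr_gt0.
apply: filterS (fa _ e1) => x /=; rewrite normc_distC ltr_pdivlMr// => h.
rewrite -scalerBl nrmZ; apply: le_lt_trans h.
by apply: ler_wpM2l; rewrite ?normc_ge0// lerDr.
Qed.

Lemma cvge_sum (E : normedModType R[i]) n (f : 'I_n -> T -> E) (a : 'I_n -> E) :
  (forall i, cvge F (f i) (a i)) -> cvge F (fun x => \sum_(i < n) f i x) (\sum_(i < n) a i).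
Proof.
elim: n f a => [|n IH] f a H.
  have -> : (fun x => \sum_(i < 0) f i x) = (fun=> 0).
    by apply/funext => x; rewrite big_ord0.
  by rewrite big_ord0; exact: cvge_cst.
have -> : (fun x => \sum_(i < n.+1) f i x) =
    (fun x => f ord0 x + \sum_(i < n) f (lift ord0 i) x).
  by apply/funext => x; rewrite big_ord_recl.
by rewrite big_ord_recl; apply: cvgeD => //; apply: IH => i; exact: H.
Qed.

Lemma nrm_pair (E1 E2 : normedModType R[i]) (x : E1 * E2) e :
  nrm x < e <-> nrm x.1 < e /\ nrm x.2 < e.
Proof.
have -> : nrm x = Num.max (nrm x.1) (nrm x.2).
  rewrite {1}/nrm prod_normE !nrmE.
  case: (leP (nrm x.1) (nrm x.2)) => h.
    by rewrite max_r// lecR.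
  by rewrite max_l// lecR ltW.
by rewrite gt_max; split => /andP.
Qed.

Lemma cvge_pair (E1 E2 : normedModType R[i]) (f : T -> E1) (g : T -> E2) a b :
  cvge F f a -> cvge F g b -> cvge F (fun x => (f x, g x)) (a, b).
Proof.
move=> fa gb e e0; apply: filterS2 (fa e e0) (gb e e0) => x /= h1 h2.
by apply/nrm_pair.
Qed.

Lemma cvge_hdiff (E : normedModType R[i]) (f : T -> E) a (g : E -> R[i]) :
  cvge F f a -> hdiff g a -> cvgc F (g \o f) (g a).
Proof.
move=> fa dg e e0; have [d d0 H] := hdiff_continuous dg e0.
by apply: filterS (fa d d0) => x /= /H; rewrite normc_distC.
Qed.

Lemma cvge_nbhs (E : normedModType R[i]) (f : T -> E) a (P : set E) :
  cvge F f a -> nbhs a P -> F (f @^-1` P).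
Proof.
by move=> fa /nbhs_nrmP[d d0 H]; apply: filterS (fa d d0) => x /= /H.
Qed.

Lemma cvge_continuous (E : normedModType R[i]) (f : T -> E) a (g : E -> R) :
  cvge F f a -> {for a, continuous g} -> g (f x) @[x --> F] --> g a.
Proof. by move=> fa ga P /ga; exact: cvge_nbhs. Qed.

End VectorLimits.

Section TupleCoordinates.
Variables (R : realType) (n : nat).

Definition tuple_coord (j : 'I_n * bool) (x : n.-tuple (Rpair R)) : R :=
  if j.2 then (tnth x j.1).1 else (tnth x j.1).2.

Lemma measurable_tuple_coord j : measurable_fun setT (tuple_coord j).
Proof.
rewrite /tuple_coord; case: j => i [] /=.
  exact: (measurableT_comp (f := fst) measurable_fst (measurable_tnth i)).
exact: (measurableT_comp (f := snd) measurable_snd (measurable_tnth i)).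
Qed.

Lemma cvgc_tuple_coord x i :
  cvgc (coord_nbhs tuple_coord x) (fun y => to_complex (tnth y i)) (to_complex (tnth x i)).
Proof.
apply/cvgc_ReIm; split; first exact: (@cvg_coord _ _ _ _ tuple_coord x (i, true)).
exact: (@cvg_coord _ _ _ _ tuple_coord x (i, false)).
Qed.

End TupleCoordinates.

(** * Uniqueness of invariant measures *)

Section MeasurePreserving.
Local Open Scope ereal_scope.
Context d (X : measurableType d) (R : realType).

Definition mpres (mu : set X -> \bar R) (T : X -> X) :=
  measurable_fun setT T /\ forall A, measurable A -> mu (T @^-1` A) = mu A.

Lemma mpres_integral (mu : {measure set X -> \bar R}) T (f : X -> \bar R) :
  mpres mu T -> measurable_fun setT f -> (forall x, 0 <= f x) ->
  \int[mu]_x f (T x) = \int[mu]_x f x.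
Proof.
move=> [mT HT] mf f0.
have H := @ge0_integral_pushforward _ _ _ _ _ T mT mu setT f measurableT mf (fun x _ => f0 x).
rewrite preimage_setT in H; rewrite -[LHS]H.
apply: (@eq_measure_integral _ _ _ _ mu) => A mA _.
exact: HT.
Qed.

End MeasurePreserving.

Section ProductMpres.
Local Open Scope ereal_scope.
Context d1 d2 (X1 : measurableType d1) (X2 : measurableType d2) (R : realType).
Variables (m1 : {sigma_finite_measure set X1 -> \bar R})
          (m2 : {sigma_finite_measure set X2 -> \bar R}).

Lemma mpres_prod T1 T2 : mpres m1 T1 -> mpres m2 T2 ->
  mpres (prod_measure m1 m2) (fun x => (T1 x.1, T2 x.2)).
Proof.
move=> [mT1 HT1] [mT2 HT2].
have mT : measurable_fun setT (fun x : X1 * X2 => (T1 x.1, T2 x.2)).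
  by apply: measurable_fun_pair; exact: measurableT_comp.
split=> // A mA.
have := @product_measure_unique _ _ _ _ _ m1 m2
  (measure_function_pushforward__canonical__measure_function_Measure
     (prod_measure m1 m2) mT).
move=> H; apply: esym; apply: H mA => B C mB mC.
transitivity ((m1 \x m2) ((T1 @^-1` B) `*` (T2 @^-1` C))); first by [].
have p1 : measurable (T1 @^-1` B) by rewrite -(setTI (T1 @^-1` B)); exact: mT1.
have p2 : measurable (T2 @^-1` C) by rewrite -(setTI (T2 @^-1` C)); exact: mT2.
rewrite product_measure1E//.
exact: (f_equal2 (fun a b : \bar R => a * b) (HT1 B mB) (HT2 C mC)).
Qed.

Lemma mpres_id (mu : set X1 -> \bar R) : mpres mu id.
Proof. by split => //; exact: measurable_id. Qed.

Lemma tonelli_prod (f : X1 * X2 -> \bar R) : measurable_fun setT f -> (forall x, 0 <= f x) ->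
  \int[prod_measure m1 m2]_z f z = \int[m1]_x \int[m2]_y f (x, y).
Proof. by move=> mf f0; exact: fubini_tonelli1. Qed.

End ProductMpres.

Section Haar.
Local Open Scope ereal_scope.
Context d (X : measurableType d) (R : realType).
Variable mu : {sigma_finite_measure set X -> \bar R}.
Variables (add : X -> X -> X) (opp : X -> X).
Hypotheses (addA : forall x y z, add x (add y z) = add (add x y) z)
  (addC : forall x y, add x y = add y x) (addK : forall x y, add (add x y) (opp y) = x)
  (oppB : forall x y, opp (add x (opp y)) = add y (opp x)).
Hypotheses (madd : measurable_fun setT (fun u : X * X => add u.1 u.2))
  (mopp : measurable_fun setT opp)
  (inv : forall a, mpres mu (add^~ a)).
Variables (T S : X -> X).
Hypotheses (mT : measurable_fun setT T) (TS : forall x, T (S x) = x)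
  (TD : forall x y, T (add x y) = add (T x) (T y)).

(** The computation behind the uniqueness of Haar measure: T maps mu to an
    invariant measure, which is compared to mu by means of a test function g. *)
Lemma haar_uniqueness (f g : X -> \bar R) :
  measurable_fun setT f -> measurable_fun setT g ->
  (forall x, 0 <= f x) -> (forall x, 0 <= g x) -> (forall x, g (opp x) = g x) ->
  \int[mu]_x f x * \int[mu]_x g (T x) = \int[mu]_x f (T x) * \int[mu]_x g x.
Proof.
move=> mf mg f0 g0 gN.
have mgT : measurable_fun setT (g \o T) by exact: measurableT_comp.
have mfT : measurable_fun setT (f \o T) by exact: measurableT_comp.
have If0 : 0 <= \int[mu]_x f x by apply: integral_ge0 => x _.
have Ig0 : 0 <= \int[mu]_x g x by apply: integral_ge0 => x _.
have mfst : measurable_fun setT (fst : X * X -> X) by exact: measurable_fst.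
have msnd : measurable_fun setT (snd : X * X -> X) by exact: measurable_snd.
rewrite -ge0_integralZl//.
transitivity (\int[mu]_y \int[mu]_x (f (add x (T y)) * g (T y))).
  apply: eq_integral => y _.
  rewrite ge0_integralZr//=.
    by rewrite (mpres_integral (inv (T y)) mf f0).
  by apply: (measurableT_comp mf); case: (inv (T y)).
(* Translate x by T y in the integral of f, and exchange the integrals. *)
pose F1 (u : X * X) := f (add u.1 (T u.2)) * g (T u.2).
have mF1 : measurable_fun setT F1.
  apply: emeasurable_funM; last exact: (measurableT_comp mgT).
  apply: (measurableT_comp mf).
  apply: (@measurableT_comp _ _ _ _ _ _ (fun u : X * X => add u.1 u.2)
           _ (fun u : X * X => (u.1, T u.2))) => //.
  by apply: measurable_fun_pair => //; exact: measurableT_comp.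
have F10 u : 0 <= F1 u by rewrite mule_ge0.
rewrite -(@fubini_tonelli _ _ _ _ _ mu mu F1)//.
(* Translating y by S x turns F2 into F1, as T (y + S x) = T y + x. *)
pose F2 (u : X * X) := f (T u.2) * g (add (T u.2) (opp u.1)).
have mF2 : measurable_fun setT F2.
  apply: emeasurable_funM; first exact: (measurableT_comp mfT).
  apply: (measurableT_comp mg).
  apply: (@measurableT_comp _ _ _ _ _ _ (fun u : X * X => add u.1 u.2)
           _ (fun u : X * X => (T u.2, opp u.1))) => //.
  by apply: measurable_fun_pair; exact: measurableT_comp.
have F20 u : 0 <= F2 u by rewrite mule_ge0.
transitivity (\int[mu]_x \int[mu]_y F2 (x, y)).
  apply: eq_integral => x _.
  have mF2x : measurable_fun setT (fun y => F2 (x, y)).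
    by apply: measurableT_comp => //; exact: measurable_pair1.
  rewrite -(mpres_integral (inv (S x)) mF2x (fun y => F20 (x, y))).
  apply: eq_integral => y _; rewrite /F1 /F2/= TD TS addK.
  by rewrite (addC x).
rewrite (@fubini_tonelli _ _ _ _ _ mu mu F2)//.
rewrite -ge0_integralZr//.
apply: eq_integral => y _; rewrite /F2/=.
have mgx : measurable_fun setT (fun x => g (add x (opp (T y)))).
  by apply: (measurableT_comp mg); case: (inv (opp (T y))).
transitivity (f (T y) * \int[mu]_x g (add x (opp (T y)))); last first.
  by rewrite (mpres_integral (inv (opp (T y))) mg g0).
rewrite -ge0_integralZl//.
by apply: eq_integral => x _; rewrite -gN oppB.
Qed.

End Haar.

(** * Lebesgue measure under additive maps *)

Section Translations.
Variable R : realType.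

Lemma mpres_shift_R (a : R) : mpres (@lebesgue_R R) (fun x : measurableTypeR R => x + a).
Proof.
pose T (x : measurableTypeR R) : measurableTypeR R := (x : R) + a.
have mT : measurable_fun setT T.
  by apply: (@measurable_funD _ _ R) => //; exact: measurable_cst.
split=> // A mA.
have H := @lebesgue_measure_unique R (@measure_function_pushforward__canonical__measure_function_Measure _ _
     (measurableTypeR R) (measurableTypeR R) R (@lebesgue_R R) T mT).
apply: esym; apply: H mA => X [[x y] _ <-] /=.
transitivity (lebesgue_measure (`]x - a, y - a] : set R)%classic).
  rewrite !lebesgue_measure_itv/= !lte_fin ltrD2r; case: ifP => // _.
  by rewrite -!EFinB; congr EFin; ring.
congr (lebesgue_measure _); apply/seteqP; split => z /=;
  by rewrite !in_itv/= ltrBlDr lerBrDr.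
Qed.

Definition padd (x y : Rpair R) : Rpair R := ((x.1 : R) + y.1, (x.2 : R) + y.2).
Definition popp (x : Rpair R) : Rpair R := (- (x.1 : R), - (x.2 : R)).

Lemma mpres_shift_pair a : mpres (@lebesgue_pair R) (padd^~ a).
Proof. exact: (mpres_prod (mpres_shift_R a.1) (mpres_shift_R a.2)). Qed.

Definition tadd n (x y : n.-tuple (Rpair R)) : n.-tuple (Rpair R) :=
  [tuple padd (tnth x i) (tnth y i) | i < n].
Definition topp n (x : n.-tuple (Rpair R)) : n.-tuple (Rpair R) :=
  [tuple popp (tnth x i) | i < n].

Lemma measurable_padd d (X : measurableType d) (f g : X -> Rpair R) :
  measurable_fun setT f -> measurable_fun setT g ->
  measurable_fun setT (fun x => padd (f x) (g x)).
Proof.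
move=> mf mg; apply: measurable_fun_pair; apply: (@measurable_funD _ _ R).
- exact: (measurableT_comp measurable_fst mf).
- exact: (measurableT_comp measurable_fst mg).
- exact: (measurableT_comp measurable_snd mf).
- exact: (measurableT_comp measurable_snd mg).
Qed.

Lemma measurable_popp : measurable_fun setT popp.
Proof.
apply: measurable_fun_pair; apply: (@measurable_funN _ _ R).
  exact: measurable_fst.
exact: measurable_snd.
Qed.

Lemma measurable_tuple d (X : measurableType d) n (f : 'I_n -> X -> Rpair R) :
  (forall i, measurable_fun setT (f i)) ->
  measurable_fun setT (fun x => [tuple f i x | i < n]).
Proof.
move=> mf; apply/measurable_fun_tnthP => i.
rewrite (_ : _ \o _ = f i)//.
by apply/funext => x /=; rewrite tnth_mktuple.
Qed.

Lemma measurable_tadd n : measurable_fun setT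
  (fun u : n.-tuple (Rpair R) * n.-tuple (Rpair R) => tadd u.1 u.2).
Proof.
apply: measurable_tuple => i; apply: measurable_padd.
  exact: (measurableT_comp (measurable_tnth i)).
exact: (measurableT_comp (measurable_tnth i)).
Qed.

Lemma measurable_topp n : measurable_fun setT (@topp n).
Proof.
apply: measurable_tuple => i; apply: (measurableT_comp measurable_popp).
exact: measurable_tnth.
Qed.

Lemma tadd_cons n (x y : Rpair R) (s t : n.-tuple (Rpair R)) :
  tadd (cons_pair (x, s)) (cons_pair (y, t)) = cons_pair (padd x y, tadd s t).
Proof.
apply: eq_from_tnth => i; rewrite tnth_mktuple.
case: (unliftP ord0 i) => [j ->|->]; last by rewrite !tnth0.
by rewrite !tnthS tnth_mktuple.
Qed.

Lemma cons_pair_eta n (t : n.+1.-tuple (Rpair R)) :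
  t = cons_pair (thead t, [tuple of behead t]).
Proof. by rewrite [LHS]tuple_eta; exact: val_inj. Qed.

Lemma measurable_cons_pair n : measurable_fun setT (@cons_pair R n).
Proof. exact: measurable_cons. Qed.

(** By induction on n: Lebesgue measure on n.+1 coordinates is a product. *)
Lemma mpres_shift n (a : n.-tuple (Rpair R)) : mpres (@lebesgue_Cn R n) (@tadd n ^~ a).
Proof.
elim: n a => [|n IH] a.
  by rewrite (_ : @tadd 0 ^~ a = id); [exact: mpres_id|apply/funext => x; apply: eq_from_tnth => -[]].
split.
  apply: measurable_tuple => i; apply: measurable_padd; first exact: measurable_tnth.
  exact: measurable_cst.
move=> A mA.
have mcA : measurable (@cons_pair R n @^-1` A).
  by rewrite -(setTI (_ @^-1` _)); exact: measurable_cons_pair.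
have [_ H] := mpres_prod (mpres_shift_pair (thead a)) (IH [tuple of behead a]).
rewrite -[RHS]/(prod_measure (@lebesgue_pair R) (lebesgue_Cn R n) (@cons_pair R n @^-1` A)).
rewrite -(H _ mcA).
rewrite -[LHS]/(prod_measure (@lebesgue_pair R) (lebesgue_Cn R n)
  (@cons_pair R n @^-1` (@tadd n.+1 ^~ a @^-1` A))).
have E x t : tadd (cons_pair (x, t)) a =
    cons_pair (padd x (thead a), tadd t [tuple of behead a]).
  by rewrite {1}(cons_pair_eta a) tadd_cons.
apply: (f_equal (prod_measure (@lebesgue_pair R) (lebesgue_Cn R n))).
by apply/seteqP; split => -[x t]; rewrite /preimage [mkset]lock /= -lock /mkset E.
Qed.

Lemma padd_group :
  [/\ forall x y z, padd x (padd y z) = padd (padd x y) z,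
      forall x y, padd x y = padd y x,
      forall x y, padd (padd x y) (popp y) = x &
      forall x y, popp (padd x (popp y)) = padd y (popp x)].
Proof.
rewrite /padd /popp; split.
- by move=> [a b] [c d] [e f] /=; rewrite !addrA.
- by move=> [a b] [c d] /=; rewrite (addrC a) (addrC b).
- by move=> [a b] [c d] /=; rewrite !addrK.
- by move=> [a b] [c d] /=; rewrite !opprB.
Qed.

Lemma tadd_group n :
  [/\ forall x y z : n.-tuple (Rpair R), tadd x (tadd y z) = tadd (tadd x y) z,
      forall x y : n.-tuple (Rpair R), tadd x y = tadd y x,
      forall x y : n.-tuple (Rpair R), tadd (tadd x y) (topp y) = x &
      forall x y : n.-tuple (Rpair R), topp (tadd x (topp y)) = tadd y (topp x)].
Proof.
have [pA pC pK pB] := padd_group; split.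
- by move=> x y z; apply: eq_from_tnth => i; rewrite !tnth_mktuple pA.
- by move=> x y; apply: eq_from_tnth => i; rewrite !tnth_mktuple pC.
- by move=> x y; apply: eq_from_tnth => i; rewrite !tnth_mktuple pK.
- by move=> x y; apply: eq_from_tnth => i; rewrite !tnth_mktuple pB.
Qed.

(** Haar's argument compares the measures of A and of its preimage by means of
    the test function g, whose integral is the same before and after T. *)
Lemma lebesgue_Cn_invariant n (T S : n.-tuple (Rpair R) -> n.-tuple (Rpair R))
    (g : n.-tuple (Rpair R) -> \bar R) :
  measurable_fun setT T -> (forall x, T (S x) = x) ->
  (forall x y, T (tadd x y) = tadd (T x) (T y)) ->
  measurable_fun setT g -> (forall x, 0 <= g x)%E -> (forall x, g (topp x) = g x) ->
  (forall x, g (T x) = g x) ->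
  (0 < \int[lebesgue_Cn R n]_x g x < +oo)%E ->
  mpres (lebesgue_Cn R n) T.
Proof.
move=> mT TS TD mg g0 gN gT /andP[Ig0 Igoo]; split => // A mA.
have [aA aC aK aB] := tadd_group n.
have mTA : measurable (T @^-1` A) by rewrite -(setTI (T @^-1` A)); exact: mT.
have H := @haar_uniqueness _ _ _ (lebesgue_Cn R n) (@tadd n) (@topp n) aC aK aB
  (measurable_tadd (n := n)) (measurable_topp (n := n)) (@mpres_shift n) T S mT TS TD
  (EFin \o \1_A) g.
have {H} := H _ mg _ g0 gN.
rewrite (eq_integral _ _ (fun x _ => gT x)).
have -> : (\int[lebesgue_Cn R n]_x (EFin \o \1_A) x)%E = lebesgue_Cn R n A.
  by rewrite integral_indic// setIT.
have -> : (\int[lebesgue_Cn R n]_x (EFin \o \1_A) (T x))%E = lebesgue_Cn R n (T @^-1` A).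
  rewrite -[in RHS](setIT (T @^-1` A)) -integral_indic//.
move=> /(_ _ _)/wrap[||].
- by apply/measurable_EFinP; exact: measurable_indic.
- by move=> x; rewrite lee_fin.
have : (\int[lebesgue_Cn R n]_x g x)%E \is a fin_num by rewrite ge0_fin_numE// ltW.
move: Ig0; case: (\int[lebesgue_Cn R n]_x g x)%E => [r| |]//; rewrite lte_fin => r0 _ E.
have rr : (r%:E * (r^-1)%:E = 1)%E by rewrite -EFinM mulfV// gt_eqF.
by rewrite -[LHS]mule1 -[RHS]mule1 -rr !muleA -E.
Qed.

End Translations.

(** * Polar coordinates in the plane *)

Section PolarCoordinates.
Variable R : realType.
Local Notation mu2 := (@lebesgue_pair R).
Local Notation leb := (@lebesgue_measure R).

Definition psq (z : Rpair R) : R := (z.1 : R) ^+ 2 + (z.2 : R) ^+ 2.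

Lemma psq_ge0 z : 0 <= psq z.
Proof. by rewrite addr_ge0 ?sqr_ge0. Qed.

Lemma psq_normc z : psq z = normc (to_complex z) ^+ 2.
Proof. by rewrite normc_sqr. Qed.

Lemma measurable_psq : measurable_fun setT psq.
Proof.
apply: (@measurable_funD _ _ R).
  exact: (measurableT_comp (f := fun x : R => x ^+ 2) _ measurable_fst).
exact: (measurableT_comp (f := fun x : R => x ^+ 2) _ measurable_snd).
Qed.

Definition square (a : R) : set (Rpair R) :=
  (`[- a, a]%classic : set (measurableTypeR R)) `*` (`[- a, a]%classic : set (measurableTypeR R)).

Lemma measurable_square a : measurable (square a).
Proof. by apply: measurableX; exact: measurable_itv. Qed.

Lemma area_square a : 0 < a -> mu2 (square a) = ((2 * a) ^+ 2)%:E.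
Proof.
move=> a0; pose I : set (measurableTypeR R) := `[- a, a]%classic.
transitivity (leb I * leb I)%E.
  by apply: product_measure1E; exact: measurable_itv.
rewrite /I lebesgue_measure_itv/= lte_fin (_ : - a < a); last lra.
by rewrite -EFinB -EFinM; congr EFin; ring.
Qed.

Definition disc (t : R) : set (Rpair R) := [set z | psq z <= t].

Lemma measurable_disc t : measurable (disc t).
Proof.
rewrite (_ : disc t = setT `&` psq @^-1` `]-oo, t]%classic).
  by apply: measurable_psq => //; exact: measurable_itv.
by rewrite setTI; apply/seteqP; split => z /=; rewrite in_itv.
Qed.

Lemma area_disc_fin t : mu2 (disc t) \is a fin_num.
Proof.
have [t0|t0] := ltP t 0.
  rewrite (_ : disc t = set0) ?measure0//; apply/seteqP; split => // z /=.
  by rewrite /disc/=; have := psq_ge0 z; lra.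
have a0 : 0 < 1 + t by lra.
rewrite ge0_fin_numE ?measure_ge0//.
apply: (@le_lt_trans _ _ (mu2 (square (1 + t)))); last by rewrite area_square// ltry.
apply: le_measure; rewrite ?inE; [exact: measurable_disc|exact: measurable_square|].
have K (x y : R) : x ^+ 2 + y ^+ 2 <= t -> - (1 + t) <= x <= 1 + t.
  move=> h; rewrite -ler_norml -(@ler_pXn2r _ 2) ?nnegrE//; last lra.
  rewrite real_normK ?num_real// sqrrD.
  by have := sqr_ge0 y; have := sqr_ge0 t; lra.
move=> [x y] h; split; rewrite /= in_itv/=; first exact: (K _ _ h).
by apply: (K y x); rewrite addrC.
Qed.

(** Haar's argument for the dilation of ratio s, with a square as test function. *)
Lemma area_disc_scale s t : 0 < s -> mu2 (disc (s ^+ 2 * t)) = ((s ^+ 2)%:E * mu2 (disc t))%E.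
Proof.
move=> s0; have [pA pC pK pB] := padd_group R.
pose T (z : Rpair R) : Rpair R := (s * (z.1 : R), s * (z.2 : R)).
pose S (z : Rpair R) : Rpair R := (s^-1 * (z.1 : R), s^-1 * (z.2 : R)).
have mT : measurable_fun setT T.
  apply: measurable_fun_pair; apply: (@measurable_funM _ _ R);
    by [exact: measurable_cst|exact: measurable_fst|exact: measurable_snd].
have TS z : T (S z) = z.
  by case: z => x y; rewrite /T /S /= !mulrA mulfV ?gt_eqF// !mul1r.
have TD x y : T (padd x y) = padd (T x) (T y) by rewrite /T /padd /= !mulrDr.
have mpadd : measurable_fun setT (fun u : Rpair R * Rpair R => padd u.1 u.2).
  by apply: measurable_padd; [exact: measurable_fst|exact: measurable_snd].
have indT (A : set (Rpair R)) : measurable A ->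
    (\int[mu2]_x (EFin \o \1_A) (T x) = mu2 (T @^-1` A))%E.
  move=> mA; rewrite -[in RHS](setIT (T @^-1` A)) -integral_indic//.
  by rewrite -(setTI (T @^-1` A)); exact: mT.
have indI (A : set (Rpair R)) : measurable A ->
    (\int[mu2]_x (EFin \o \1_A) x = mu2 A)%E.
  by move=> mA; rewrite integral_indic// setIT.
have := @haar_uniqueness _ _ _ mu2 (@padd R) (@popp R) pC pK pB mpadd
  (measurable_popp (R := R)) (@mpres_shift_pair R) T S mT TS TD
  (EFin \o \1_(disc (s ^+ 2 * t))) (EFin \o \1_(square 1)).
move=> /(_ _ _ _ _ _)/wrap[|||||].
- by apply/measurable_EFinP; apply: measurable_indic; exact: measurable_disc.
- by apply/measurable_EFinP; apply: measurable_indic; exact: measurable_square.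
- by move=> x; rewrite lee_fin.
- by move=> x; rewrite lee_fin.
- move=> [x y] /=; congr (_%:E); rewrite !indicE; congr (_%:R); congr nat_of_bool.
  by apply/idP/idP; rewrite !inE /square/= !in_itv/=; lra.
rewrite !indT ?indI; do ?[exact: measurable_disc|exact: measurable_square].
have -> : T @^-1` square 1 = square s^-1.
  apply/seteqP; split => -[x y]; rewrite /square/= !in_itv/= => -[h1 h2].
    split; rewrite -ler_norml -(ler_pM2l s0) mulfV ?gt_eqF// -{1}(gtr0_norm s0) -normrM ler_norml//.
  by split; rewrite -ler_norml normrM gtr0_norm// -ler_pdivlMl// mulr1 ler_norml.
have -> : T @^-1` disc (s ^+ 2 * t) = disc t.
  apply/seteqP; split => -[x y]; rewrite /disc/psq/= !exprMn -mulrDr ler_pM2l ?exprn_gt0//.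
rewrite !area_square ?invr_gt0//.
have := area_disc_fin (s ^+ 2 * t); have := area_disc_fin t.
case: (mu2 (disc t)) => [a| |]//; case: (mu2 (disc (s ^+ 2 * t))) => [b| |]// _ _.
rewrite -!EFinM => -[h]; congr EFin.
have s1 : (2 * s^-1) ^+ 2 != 0 by rewrite expf_neq0// mulf_neq0// invr_eq0 gt_eqF.
by apply: (mulIf s1); rewrite h; field; rewrite gt_eqF.
Qed.

(** The area of the unit disc; it is only identified with pi after the formula
    for polar integrals is known. *)
Definition disc_const : R := fine (mu2 (disc 1)).

Lemma area_disc t : 0 <= t -> mu2 (disc t) = (t * disc_const)%:E.
Proof.
rewrite le_eqVlt => /predU1P[<-|t0].
  have := @area_disc_scale 2 0 _; rewrite mulr0 => /(_ _)/wrap[|]; first by [].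
  have := area_disc_fin 0; case: (mu2 (disc 0)) => [a| |]// _.
  by rewrite -EFinM => -[h]; congr EFin; lra.
have st : 0 < Num.sqrt t by rewrite sqrtr_gt0.
have := area_disc_scale 1 st; rewrite sqr_sqrtr ?ltW// mulr1 => ->.
by rewrite /disc_const EFinM fineK// area_disc_fin.
Qed.

Lemma disc_const_gt0 : 0 < disc_const.
Proof.
rewrite -lte_fin /disc_const fineK ?area_disc_fin//.
have h0 : 0 < 2^-1 :> R by lra.
apply: (@lt_le_trans _ _ (mu2 (square 2^-1))).
  by rewrite area_square// lte_fin exprn_gt0// mulr_gt0.
apply: le_measure; rewrite ?inE; [exact: measurable_square|exact: measurable_disc|].
move=> [x y] [] /=; rewrite !in_itv/= -!ler_norml => hx hy.
have K (u : R) : `|u| <= 2^-1 -> u ^+ 2 <= 2^-1 ^+ 2.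
  by move=> hu; rewrite -[u ^+ 2]real_normK ?num_real// ler_pXn2r// nnegrE// ltW.
by rewrite /disc /psq/=; have := K x hx; have := K y hy; rewrite !expr2; lra.
Qed.

End PolarCoordinates.

Section PolarIntegral.
Variable R : realType.
Local Notation mu2 := (@lebesgue_pair R).
Local Notation leb := (@lebesgue_measure R).
Local Notation c := (disc_const R).

Let psq' : Rpair R -> measurableTypeR R := @psq R.

Let mpsq' : measurable_fun setT psq' := @measurable_psq R.

Let nu := measure_function_pushforward__canonical__measure_function_Measure mu2 mpsq'.

Let neg : set (measurableTypeR R) := `]-oo, 0[%classic.

Let mneg : measurable neg. Proof. exact: measurable_itv. Qed.

Let c0 : 0 <= c^-1. Proof. by rewrite invr_ge0 ltW// disc_const_gt0. Qed.

Let m' := measure_add (mscale (NngNum c0) nu) (mrestr (lebesgue_R R) mneg).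

Let m'E A : m' A = ((c^-1)%:E * mu2 (psq' @^-1` A) + leb (A `&` neg))%E.
Proof. by rewrite /m' measure_addE. Qed.

(** The half-open intervals ]a, b] have the same measure on both sides, since
    a disc of squared radius t has area c t; Lebesgue measure on the whole line is
    recovered by adding its restriction to the negative numbers. *)
Lemma lebesgue_disc_decomposition (A : set (measurableTypeR R)) : measurable A ->
  leb A = ((c^-1)%:E * mu2 (psq' @^-1` A) + leb (A `&` neg))%E.
Proof.
move=> mA; etransitivity; last exact: m'E.
apply: (lebesgue_measure_unique (mu := m')) mA.
move=> X [[a b] _ <-]; apply: esym; etransitivity; first exact: m'E.
apply: esym => /=.
have cn : c != 0 by rewrite gt_eqF// disc_const_gt0.
have [ba|ab] := leP b a.
  rewrite set_itv_ge; last by rewrite bnd_simp -leNgt.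
  by rewrite preimage_set0 set0I !measure0 mule0 adde0.
have [b0|b0] := ltP b 0.
  rewrite (_ : psq' @^-1` _ = set0) ?measure0 ?mule0 ?add0e; last first.
    apply/seteqP; split => // z /=; rewrite in_itv/= => /andP[_].
    by have := psq_ge0 z; rewrite /psq'; lra.
  congr (leb _); apply/esym/setIidPl => x; rewrite /neg /= !in_itv/=; lra.
have [a0|a0] := ltP a 0.
  rewrite (_ : psq' @^-1` _ = disc b); last first.
    apply/seteqP; split => z; rewrite /disc /= in_itv/= /psq'; have := psq_ge0 z; lra.
  rewrite (_ : _ `&` neg = `]a, 0[%classic); last first.
    by apply/seteqP; split => z; rewrite /neg /= !in_itv/=; lra.
  rewrite area_disc// !lebesgue_measure_itv/= !lte_fin ab a0.
  by rewrite -EFinM -!EFinB -EFinD; congr EFin; field.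
rewrite (_ : psq' @^-1` _ = disc b `\` disc a); last first.
  apply/seteqP; split => z; rewrite /disc /= in_itv/= /psq'; last by move=> [? /negP]; lra.
  by move=> h; split; [lra|apply/negP; lra].
rewrite (_ : _ `&` neg = set0) ?measure0 ?adde0; last first.
  by apply/seteqP; split => z //; rewrite /neg /= !in_itv/=; lra.
have E : mu2 (disc b `\` disc a) = (mu2 (disc b) - mu2 (disc b `&` disc a))%E.
  apply: measureD; [exact: measurable_disc|exact: measurable_disc|].
  by have := area_disc_fin b; rewrite ge0_fin_numE// measure_ge0.
rewrite E (_ : disc b `&` disc a = disc a); last first.
  by apply/setIidPr => z; rewrite /disc/=; lra.
rewrite !area_disc ?lebesgue_measure_itv/= ?lte_fin ?ab//.
by rewrite -?EFinB -?EFinM -?EFinB; congr EFin; field.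
Qed.

(** The image of the area under |z|^2 is a multiple of Lebesgue measure on
    [0, +oo[. *)
Lemma polar_integral_const (F : R -> \bar R) :
  measurable_fun setT F -> (forall x, 0 <= F x)%E ->
  (\int[mu2]_z F (psq z) = c%:E * \int[leb]_(t in `[0%R, +oo[) F t)%E.
Proof.
move=> mF F0; set D : set R := `[0, +oo[%classic.
have mD : measurable D by exact: measurable_itv.
have TD : psq' @^-1` D = setT.
  by apply/seteqP; split => z // _; rewrite /D /= in_itv/= andbT psq_ge0.
have mFD : measurable_fun D F by exact: measurable_funTS.
have := @ge0_integral_pushforward _ _ _ _ _ psq' mpsq' mu2 D F mD mFD (fun x _ => F0 x).
rewrite TD => <-.
have cge : 0 <= c by rewrite ltW// disc_const_gt0.
transitivity (\int[mscale (NngNum cge) leb]_(t in D) F t)%E; last first.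
  by rewrite ge0_integral_mscale.
apply: (@eq_measure_integral _ _ _ _ (mscale (NngNum cge) leb)) => A mA AD.
transitivity (c%:E * leb A)%E; last by [].
transitivity (mu2 (psq' @^-1` A)); first by [].
rewrite (lebesgue_disc_decomposition mA) (_ : A `&` neg = set0); last first.
  by apply/seteqP; split => x // [/AD]; rewrite /D /neg /= !in_itv/= andbT; lra.
rewrite measure0 adde0 muleA -EFinM mulfV ?mul1e//.
by rewrite gt_eqF// disc_const_gt0.
Qed.

(** Both sides of the polar formula are known for the Gaussian e^(-|z|^2). *)
Lemma disc_const_pi : c = pi.
Proof.
have me : measurable_fun setT (fun t : R => (expR (- t))%:E).
  apply/measurable_EFinP; apply: continuous_measurable_fun => x.
  by apply: continuous_comp; [exact: continuousN|exact: continuous_expR].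
have := @polar_integral_const (fun t => (expR (- t))%:E) me _.
move=> /(_ _)/wrap[|]; first by move=> x; rewrite lee_fin expR_ge0.
have -> : (\int[leb]_(t in `[0%R, +oo[) (expR (- t))%:E = 1)%E.
  rewrite -(@integral_exponential_pdf R 1 ltr01) [LHS]integral_mkcond.
  apply: eq_integral => x _; rewrite /exponential_pdf !patchE; case: ifP => // _.
  by rewrite mul1r mulN1r.
rewrite mule1 => H; apply: EFin_inj; rewrite -H.
pose g (x : R) := (gauss_fun x)%:E : \bar R.
have mg : measurable_fun setT g by apply/measurable_EFinP; exact: measurable_gauss_fun.
have g0 x : (0 <= g x)%E by rewrite lee_fin gauss_fun_ge0.
have Ig : (\int[leb]_x g x = (Num.sqrt pi)%:E)%E by exact: integralT_gauss.
have mgg : measurable_fun setT (fun z : Rpair R => (g z.1 * g z.2)%E).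
  apply: emeasurable_funM; first exact: (measurableT_comp mg measurable_fst).
  exact: (measurableT_comp mg measurable_snd).
have gg0 (z : Rpair R) : (0 <= g z.1 * g z.2)%E by exact: mule_ge0.
have -> : (\int[mu2]_z (expR (- psq z))%:E = \int[mu2]_z (g z.1 * g z.2))%E.
  apply: eq_integral => z _; rewrite /g /gauss_fun -EFinM -expRD /psq; congr (expR _)%:E.
  by ring.
rewrite (tonelli_prod (lebesgue_R R) (lebesgue_R R) mgg gg0).
transitivity (\int[leb]_x (g x * (Num.sqrt pi)%:E))%E.
  by apply: eq_integral => x _; rewrite /= ge0_integralZl//; congr (_ * _)%E; exact: Ig.
rewrite ge0_integralZr// ?lee_fin ?sqrtr_ge0//.
by rewrite Ig -EFinM -expr2 sqr_sqrtr// pi_ge0.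
Qed.

Theorem polar_integral (F : R -> \bar R) :
  measurable_fun setT F -> (forall x, 0 <= F x)%E ->
  (\int[mu2]_z F (psq z) = pi%:E * \int[leb]_(t in `[0%R, +oo[) F t)%E.
Proof. by rewrite -disc_const_pi; exact: polar_integral_const. Qed.

End PolarIntegral.

(** * Moments of Euclidean balls *)

Section PowerIntegrals.
Variable R : realType.
Local Notation leb := (@lebesgue_measure R).

Lemma FTC_power (f F : R -> R) (T : R) : 0 < T -> continuous f ->
  (forall x : R, is_derive x (1 : R) F (f x)) ->
  (\int[leb]_(t in `[0%R, T]) (f t)%:E = (F T - F 0)%:E)%E.
Proof.
move=> T0 cf dF.
have cF : continuous F.
  by move=> x; apply/differentiable_continuous/derivable1_diffP; have [] := dF x.
rewrite (@continuous_FTC2 R f F 0 T T0) ?EFinB//.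
- exact: continuous_subspaceT.
- split.
  + by move=> x _; have [] := dF x.
  + by apply: cvg_at_right_filter; exact: cF.
  + by apply: cvg_at_left_filter; exact: cF.
- by move=> x _; rewrite derive1E; exact: derive_val.
Qed.

Lemma integral_truncated (f : R -> R) (T : R) : continuous f ->
  (\int[leb]_(t in `[0%R, +oo[) (if (t < T)%R then f t else 0)%:E =
   \int[leb]_(t in `[0%R, T]) (f t)%:E)%E.
Proof.
move=> cf; rewrite -[RHS]integral_itv_bndo_bndc; last first.
  by apply/measurable_EFinP/measurable_funTS; exact: continuous_measurable_fun.
rewrite [LHS]integral_mkcond [RHS]integral_mkcond; apply: eq_integral => x _.
rewrite !patchE; have [xT|Tx] := ltP x T.
  by rewrite (_ : (x \in `[0, +oo[%classic) = (x \in `[0, T[%classic))//;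
    apply/idP/idP; rewrite !inE/= !in_itv/= ?xT; lra.
rewrite [in RHS]ifF; first by case: ifP.
by apply/negP; rewrite inE/= in_itv/=; lra.
Qed.

Lemma integral_power (k : nat) (T : R) : 0 <= T ->
  (\int[leb]_(t in `[0%R, +oo[) (if (t < T)%R then t ^+ k else 0)%:E =
   (T ^+ k.+1 / k.+1%:R)%:E)%E.
Proof.
move=> T0; have ck : continuous (fun t : R => t ^+ k) by exact: exprn_continuous.
rewrite integral_truncated//.
move: T0; rewrite le_eqVlt => /predU1P[<-|T0].
  by rewrite set_itv1 integral_set1 expr0n/= mul0r.
have dF (x : R) : is_derive x (1 : R) (fun t : R => t ^+ k.+1 / k.+1%:R) (x ^+ k).
  have -> : (fun t : R => t ^+ k.+1 / k.+1%:R) = k.+1%:R^-1 *: ((id : R -> R) ^+ k.+1).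
    by apply/funext => t; rewrite mulrC exprfctE.
  apply: is_derive_eq.
  rewrite /GRing.scale/= mulr1 -mulr_natl.
  by rewrite mulrA mulVf ?mul1r ?pnatr_eq0.
by rewrite (FTC_power T0 ck dF) expr0n/= mul0r subr0.
Qed.

Lemma integral_copower (k : nat) (T : R) : 0 <= T ->
  (\int[leb]_(t in `[0%R, +oo[) (if (t < T)%R then (T - t) ^+ k else 0)%:E =
   (T ^+ k.+1 / k.+1%:R)%:E)%E.
Proof.
move=> T0; have ck : continuous (fun t : R => (T - t) ^+ k).
  move=> t; apply: (@continuous_comp _ _ _ (fun t => T - t) (fun t => t ^+ k)).
    by apply: continuousB; [exact: cst_continuous|exact: id].
  exact: exprn_continuous.
rewrite (@integral_truncated (fun t => (T - t) ^+ k))//.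
move: T0; rewrite le_eqVlt => /predU1P[<-|T0].
  by rewrite set_itv1 integral_set1 expr0n/= mul0r.
have dF (x : R) : is_derive x (1 : R) (fun t : R => - ((T - t) ^+ k.+1 / k.+1%:R)) ((T - x) ^+ k).
  have -> : (fun t : R => - ((T - t) ^+ k.+1 / k.+1%:R)) =
      (- k.+1%:R^-1) *: ((cst T - (id : R -> R)) ^+ k.+1).
    by apply/funext => t; rewrite -mulrN mulrC exprfctE.
  apply: is_derive_eq.
  rewrite /GRing.scale/= sub0r mulrN1 mulrNN.
  by rewrite mulrA mulVf ?mul1r ?pnatr_eq0.
by rewrite (FTC_power T0 ck dF) subrr subr0 expr0n/= mul0r oppr0 sub0r opprK.
Qed.

End PowerIntegrals.

Section Moments.
Variable R : realType.
Local Notation mu2 := (@lebesgue_pair R).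

Lemma cons_integral n (f : n.+1.-tuple (Rpair R) -> \bar R) :
  measurable_fun setT f -> (forall x, 0 <= f x)%E ->
  (\int[lebesgue_Cn R n.+1]_x f x =
   \int[mu2]_z \int[lebesgue_Cn R n]_t f (cons_pair (z, t)))%E.
Proof.
move=> mf f0.
have := @ge0_integral_pushforward _ _ _ _ _ (@cons_pair R n) (@measurable_cons_pair R n)
  (prod_measure mu2 (lebesgue_Cn R n)) setT f measurableT mf (fun x _ => f0 x).
rewrite preimage_setT => H.
have mfc : measurable_fun setT (f \o @cons_pair R n).
  exact: (measurableT_comp mf (@measurable_cons_pair R n)).
transitivity (\int[prod_measure mu2 (lebesgue_Cn R n)]_z (f \o @cons_pair R n) z)%E.
  exact: H.
exact: (tonelli_prod mu2 (lebesgue_Cn R n) mfc (fun x => f0 _)).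
Qed.

Definition sqn n (x : n.-tuple (Rpair R)) : R := \sum_(i < n) psq (tnth x i).

Lemma sqn_ge0 n (x : n.-tuple (Rpair R)) : 0 <= sqn x.
Proof. by apply: sumr_ge0 => i _; exact: psq_ge0. Qed.

Lemma sqn_cons n z (t : n.-tuple (Rpair R)) : sqn (cons_pair (z, t)) = psq z + sqn t.
Proof.
rewrite /sqn big_ord_recl tnth0; congr (_ + _).
by apply: eq_bigr => i _; rewrite tnthS.
Qed.

Lemma measurable_psq_tnth n (i : 'I_n) : measurable_fun setT (fun x => @psq R (tnth x i)).
Proof. exact: (measurableT_comp (@measurable_psq R) (measurable_tnth i)). Qed.

Lemma measurable_sqn n : measurable_fun setT (@sqn n).
Proof. by apply: measurable_sum => i; exact: measurable_psq_tnth. Qed.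

Definition ball_moment n k T (x : n.+1.-tuple (Rpair R)) : \bar R :=
  (if sqn x < T then psq (tnth x ord_max) ^+ k else 0)%:E.

Lemma measurable_ball_moment n k T : measurable_fun setT (@ball_moment n k T).
Proof.
apply/measurable_EFinP; apply: measurable_fun_ifT => //.
  by apply: measurable_fun_ltr; [exact: measurable_sqn|exact: measurable_cst].
exact: (measurable_funX _ (measurable_psq_tnth _)).
Qed.

Lemma ball_moment_ge0 n k T x : (0 <= @ball_moment n k T x)%E.
Proof. by rewrite lee_fin; case: ifP => // _; rewrite exprn_ge0// psq_ge0. Qed.

(** By induction on the dimension: integrating out the first coordinate in polar
    coordinates leaves the integral of (T - s)^(k+n+1) over [0, T]. *)
Lemma integral_ball_moment n k T : 0 <= T ->
  (\int[lebesgue_Cn R n.+1]_x ball_moment k T x =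
   (pi ^+ n.+1 * k`!%:R / (k + n.+1)`!%:R * T ^+ (k + n.+1))%:E)%E.
Proof.
elim: n T => [|n IH] T T0.
  rewrite cons_integral//; [|exact: measurable_ball_moment|exact: ball_moment_ge0].
  pose F (t : R) : \bar R := (if (t < T)%R then `|t| ^+ k else 0)%:E.
  have mF : measurable_fun setT F.
    apply/measurable_EFinP; apply: measurable_fun_ifT => //.
      by apply: measurable_fun_ltr; [exact: measurable_id|exact: measurable_cst].
    by apply: measurable_funX; exact: normr_measurable.
  transitivity (\int[mu2]_z F (psq z))%E.
    apply: eq_integral => z _; rewrite integral_dirac//=; last first.
      apply: (measurableT_comp (measurable_ball_moment k T)).
      exact: (measurableT_comp (@measurable_cons_pair R 0) (measurable_pair1 z)).
    rewrite diracT mul1e /ball_moment /F sqn_cons {1}/sqn big_ord0 addr0.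
    rewrite (_ : ord_max = ord0); last exact: val_inj.
    by rewrite tnth0 ger0_norm// psq_ge0.
  rewrite polar_integral//; last first.
    by move=> t; rewrite lee_fin; case: ifP => // _; exact: exprn_ge0.
  transitivity (pi%:E * \int[@lebesgue_measure R]_(t in `[0%R, +oo[)
      (if (t < T)%R then t ^+ k else 0)%:E)%E.
    congr (_ * _)%E; apply: eq_integral => t.
    by rewrite inE/= in_itv/= andbT => t0; rewrite /F ger0_norm.
  rewrite integral_power// -EFinM; congr EFin.
  have f0 : k`!%:R != 0 :> R by rewrite pnatr_eq0 -lt0n fact_gt0.
  have s0 : k.+1%:R != 0 :> R by rewrite pnatr_eq0.
  rewrite addn1 factS natrM expr1; move: (T ^+ _) f0 s0 => x.
  by move: (k`!%:R) (k.+1%:R) => a b a0 b0; field; rewrite a0 b0.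
rewrite cons_integral//; [|exact: measurable_ball_moment|exact: ball_moment_ge0].
pose C : R := pi ^+ n.+1 * k`!%:R / (k + n.+1)`!%:R.
have C0 : 0 <= C.
  by rewrite divr_ge0// mulr_ge0// exprn_ge0// pi_ge0.
pose F (s : R) : \bar R := (C * (if (s < T)%R then (T - s) ^+ (k + n.+1) else 0))%:E.
have mF : measurable_fun setT F.
  apply/measurable_EFinP; apply: measurable_funM => //.
  apply: measurable_fun_ifT => //.
    by apply: measurable_fun_ltr; [exact: measurable_id|exact: measurable_cst].
  by apply: measurable_funX; apply: measurable_funB => //; exact: measurable_id.
have F0 s : (0 <= F s)%E.
  rewrite lee_fin mulr_ge0//; case: ifP => // sT.
  by rewrite exprn_ge0// subr_ge0 ltW.
transitivity (\int[mu2]_z F (psq z))%E.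
  apply: eq_integral => z _; rewrite /F; case: ifP => [zT|/negbT]; last first.
    rewrite -leNgt mulr0 => Tz; apply: integral0_eq => t _.
    rewrite /ball_moment sqn_cons ifF//; apply/negP.
    by have := sqn_ge0 t; lra.
  rewrite -IH; last by rewrite subr_ge0 ltW.
  apply: eq_integral => t _; rewrite /ball_moment sqn_cons ltrBrDl.
  rewrite (_ : ord_max = lift ord0 ord_max); last exact: val_inj.
  by rewrite tnthS.
rewrite polar_integral//.
transitivity (pi%:E * \int[@lebesgue_measure R]_(s in `[0%R, +oo[)
    (C%:E * (if (s < T)%R then (T - s) ^+ (k + n.+1) else 0)%:E))%E.
  by congr (_ * _)%E; apply: eq_integral => s _; rewrite -EFinM.
rewrite ge0_integralZl//=; last 2 first.
- apply/measurable_EFinP; apply: measurable_funTS; apply: measurable_fun_ifT => //.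
    by apply: measurable_fun_ltr; [exact: measurable_id|exact: measurable_cst].
  by apply: measurable_funX; apply: measurable_funB => //; exact: measurable_id.
- by move=> s _; rewrite lee_fin; case: ifP => // sT; rewrite exprn_ge0// subr_ge0 ltW.
rewrite integral_copower// -!EFinM; congr EFin.
have f0 : (k + n.+1)`!%:R != 0 :> R by rewrite pnatr_eq0 -lt0n fact_gt0.
have s0 : (k + n.+1).+1%:R != 0 :> R by rewrite pnatr_eq0.
rewrite /C (addnS k n.+1) (factS (k + n.+1)) natrM [in RHS](exprS _ n.+1).
move: (T ^+ _) (pi ^+ n.+1) (k`!%:R) f0 s0 => x y z.
by move: ((k + n.+1)`!%:R) ((k + n.+1).+1%:R) => a b a0 b0; field; rewrite a0 b0.
Qed.

End Moments.

(** * Unitary maps *)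

Section UnitaryMatrices.
Variable R : realType.
Local Notation C := R[i].

Lemma dotmx_sum m (Z W : 'rV[C]_m) : dotmx Z W = \sum_(i < m) Z 0 i * ((W 0 i)^*)%C.
Proof.
rewrite dotmxE !mxE; apply: eq_bigr => i _; rewrite !mxE.
by [].
Qed.

Lemma dotmx_self m (Z : 'rV[C]_m) : dotmx Z Z = (\sum_(i < m) normc (Z 0 i) ^+ 2)%:C.
Proof.
rewrite dotmx_sum (raddf_sum (real_complex R)).
by apply: eq_bigr => i _; rewrite mulcJ.
Qed.

Lemma sqnorm_sum m (Z : 'rV[C]_m) : sqnorm Z = \sum_(i < m) normc (Z 0 i) ^+ 2.
Proof. by rewrite /sqnorm dotmx_self. Qed.

Lemma dotmx_sqnorm m (Z : 'rV[C]_m) : dotmx Z Z = (sqnorm Z)%:C.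
Proof. by rewrite sqnorm_sum dotmx_self. Qed.

Lemma sqnorm_ge0 m (Z : 'rV[C]_m) : 0 <= sqnorm Z.
Proof. by rewrite sqnorm_sum sumr_ge0// => i _; rewrite exprn_ge0 ?normc_ge0. Qed.

Lemma sqnormZ m (a : C) (Z : 'rV[C]_m) : sqnorm (a *: Z) = normc a ^+ 2 * sqnorm Z.
Proof.
rewrite !sqnorm_sum mulr_sumr; apply: eq_bigr => i _.
by rewrite mxE normcM exprMn.
Qed.

Lemma dotmx_unitary m (M : 'M[C]_m) (Z W : 'rV[C]_m) : M \is unitarymx ->
  dotmx (Z *m M) (W *m M) = dotmx Z W.
Proof.
move=> /unitarymxP MM; rewrite !dotmxE.
by rewrite trmx_mul map_mxM -mulmxA [M *m _]mulmxA MM mul1mx.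
Qed.

Lemma sqnorm_unitary m (M : 'M[C]_m) (Z : 'rV[C]_m) : M \is unitarymx ->
  sqnorm (Z *m M) = sqnorm Z.
Proof. by move=> uM; rewrite /sqnorm dotmx_unitary. Qed.

Lemma unitary_diag m (d : 'rV[C]_m) : (forall i, normc (d 0 i) = 1) ->
  diag_mx d \is unitarymx.
Proof.
move=> d1; apply/unitarymxP; rewrite tr_diag_mx map_diag_mx mul_diag_mx.
apply/matrixP => i j; rewrite !mxE; case: eqVneq => [->|ij]; last by rewrite mulr0n mulr0.
rewrite !mulr1n; transitivity (d 0 j * ((d 0 j)^*)%C); first by [].
by rewrite mulcJ d1 expr1n.
Qed.

(** Gram-Schmidt completes a multiple of Z to a unitary matrix. *)
Lemma unitary_direction m (Z : 'rV[C]_m.+1) : exists (M : 'M[C]_m.+1) (a : C),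
  M \is unitarymx /\ Z = a *: row ord_max M.
Proof.
pose A : 'M[C]_m.+1 := \matrix_(i, j) Z 0 j.
pose S := schmidt A; have uS : S \is unitarymx by exact: schmidt_unitarymx.
pose M : 'M[C]_m.+1 := row_perm (tperm ord0 ord_max) S.
have uM : M \is unitarymx.
  apply/row_unitarymxP => i j.
  have rowM k : row k M = row (tperm ord0 ord_max k) S by apply/rowP => l; rewrite !mxE.
  by rewrite !rowM (row_unitarymxP uS) (inj_eq perm_inj).
have := row_schmidt_sub A ord0; rewrite (big_pred1 ord0) => [|k]; last first.
  by rewrite /= leqn0.
have -> : row ord0 A = Z by apply/rowP => l; rewrite !mxE.
rewrite genmxE => /sub_rVP[a aE]; exists M, a; split => //.
rewrite aE; congr (_ *: _); apply/rowP => l; rewrite !mxE.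
by rewrite tpermR.
Qed.

End UnitaryMatrices.

Section UnitaryAction.
Variable R : realType.
Local Notation C := R[i].

(** Rows of complex numbers and tuples of pairs of reals are in bijection through
    std_coord_map; unitary matrices act on tuples by transport. *)
Definition of_row m (Z : 'rV[C]_m) : m.-tuple (Rpair R) :=
  [tuple (complex.Re (Z 0 i), complex.Im (Z 0 i)) | i < m].

Lemma of_rowK m (Z : 'rV[C]_m) : std_coord_map (of_row Z) = Z.
Proof.
apply/rowP => i; rewrite mxE tnth_mktuple /to_complex /=.
by case: (Z 0 i).
Qed.

Lemma std_coord_mapK m (x : m.-tuple (Rpair R)) : of_row (std_coord_map x) = x.
Proof.
apply: eq_from_tnth => i; rewrite tnth_mktuple mxE /to_complex /=.
by case: (tnth x i).
Qed.

Lemma std_coord_map_inj m : injective (@std_coord_map R m).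
Proof. exact: can_inj (@std_coord_mapK m). Qed.

Lemma std_coord_map_tadd m (x y : m.-tuple (Rpair R)) :
  std_coord_map (tadd x y) = std_coord_map x + std_coord_map y.
Proof. by apply/rowP => i; rewrite !mxE tnth_mktuple. Qed.

Lemma sqn_sqnorm m (x : m.-tuple (Rpair R)) : sqn x = sqnorm (std_coord_map x).
Proof. by rewrite sqnorm_sum; apply: eq_bigr => i _; rewrite mxE psq_normc. Qed.

Definition unitary_act m (M : 'M[C]_m) (x : m.-tuple (Rpair R)) : m.-tuple (Rpair R) :=
  of_row (std_coord_map x *m M).

Lemma std_unitary_act m (M : 'M[C]_m) x :
  std_coord_map (unitary_act M x) = std_coord_map x *m M.
Proof. exact: of_rowK. Qed.

Lemma cvgc_sum {T : Type} (F : set_system T) {FF : Filter F} n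
    (f : 'I_n -> T -> C) (a : 'I_n -> C) :
  (forall i, cvgc F (f i) (a i)) -> cvgc F (fun x => \sum_(i < n) f i x) (\sum_(i < n) a i).
Proof.
elim: n f a => [|n IH] f a H.
  have -> : (fun x => \sum_(i < 0) f i x) = (fun=> 0).
    by apply/funext => x; rewrite big_ord0.
  by rewrite big_ord0; exact: cvgc_cst.
have -> : (fun x => \sum_(i < n.+1) f i x) =
    (fun x => f ord0 x + \sum_(i < n) f (lift ord0 i) x).
  by apply/funext => x; rewrite big_ord_recl.
rewrite big_ord_recl; apply: cvgcD; first exact: H.
by apply: (IH (fun i => f (lift ord0 i)) (fun i => a (lift ord0 i))) => i; exact: H.
Qed.

Lemma row_mulE m (x : m.-tuple (Rpair R)) (M : 'M[C]_m) j :
  (std_coord_map x *m M) 0 j = \sum_i to_complex (tnth x i) * M i j.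
Proof. by rewrite mxE; apply: eq_bigr => i _; rewrite mxE. Qed.

Lemma cvgc_row_mul {T : Type} (F : set_system T) {FF : Filter F} m
    (f : T -> m.-tuple (Rpair R)) (M : T -> 'M[C]_m) x (N : 'M[C]_m) j :
  (forall i, cvgc F (fun t => to_complex (tnth (f t) i)) (to_complex (tnth x i))) ->
  (forall i, cvgc F (fun t => M t i j) (N i j)) ->
  cvgc F (fun t => (std_coord_map (f t) *m M t) 0 j) ((std_coord_map x *m N) 0 j).
Proof.
move=> cf cM; rewrite row_mulE.
rewrite (_ : (fun t => _) = (fun t => \sum_i to_complex (tnth (f t) i) * M t i j)); last first.
  by apply/funext => t; rewrite row_mulE.
apply: (cvgc_sum (f := fun i t => to_complex (tnth (f t) i) * M t i j)
  (a := fun i => to_complex (tnth x i) * N i j)) => i.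
exact: cvgcM.
Qed.

Lemma measurable_unitary_act m (M : 'M[C]_m) : measurable_fun setT (unitary_act M).
Proof.
apply: measurable_tuple => i.
have H (x : m.-tuple (Rpair R)) : cvgc (coord_nbhs (@tuple_coord R m) x)
    (fun y => (std_coord_map y *m M) 0 i) ((std_coord_map x *m M) 0 i).
  have FF : Filter (coord_nbhs (@tuple_coord R m) x) by exact: coord_nbhs_filter.
  apply: (@cvgc_row_mul _ _ FF m id (fun=> M)) => j; last exact: cvgc_cst.
  exact: cvgc_tuple_coord.
apply: measurable_fun_pair; apply: (measurable_fun_coord (@measurable_tuple_coord R m)).
- exact: coord_openT.
- by move=> x _; have /cvgc_ReIm[] := H x.
- exact: coord_openT.
- by move=> x _; have /cvgc_ReIm[] := H x.
Qed.

Lemma unitary_act_inv m (M : 'M[C]_m) x : M \is unitarymx ->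
  unitary_act M (unitary_act (invmx M) x) = x.
Proof.
move=> uM; apply: std_coord_map_inj; rewrite !std_unitary_act.
by rewrite mulmxKV// unitarymx_unit.
Qed.

Lemma unitary_act_tadd m (M : 'M[C]_m) x y :
  unitary_act M (tadd x y) = tadd (unitary_act M x) (unitary_act M y).
Proof.
apply: std_coord_map_inj.
by rewrite std_coord_map_tadd !std_unitary_act std_coord_map_tadd mulmxDl.
Qed.

(** The indicator function of the unit ball is an invariant test function. *)
Lemma mpres_unitary_lebesgue m (M : 'M[C]_m.+1) : M \is unitarymx ->
  mpres (lebesgue_Cn R m.+1) (unitary_act M).
Proof.
move=> uM.
apply: (@lebesgue_Cn_invariant R m.+1 (unitary_act M) (unitary_act (invmx M)) (ball_moment 0 1)).
- exact: measurable_unitary_act.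
- by move=> x; exact: unitary_act_inv.
- exact: unitary_act_tadd.
- exact: measurable_ball_moment.
- by move=> x; exact: ball_moment_ge0.
- move=> x; rewrite /ball_moment !expr0; congr (if _ < _ then _ else _)%:E.
  apply: eq_bigr => i _; rewrite tnth_mktuple /psq /popp/=.
  by rewrite !sqrrN.
- by move=> x; rewrite /ball_moment !expr0 !sqn_sqnorm std_unitary_act sqnorm_unitary.
- rewrite integral_ball_moment// lte_fin ltry andbT expr1n mulr1.
  by rewrite divr_gt0// ?ltr0n ?fact_gt0// mulr_gt0 ?ltr0n ?fact_gt0// exprn_gt0// pi_gt0.
Qed.

Lemma mpres_unitary m (M : 'M[C]_m.+1) : M \is unitarymx ->
  mpres (@volume_Cn R m.+1) (unitary_act M).
Proof.
move=> /mpres_unitary_lebesgue[mM H]; split => // A mA.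
exact: (f_equal (fun x => ((volume_const R m.+1)%:num%:E * x)%E) (H A mA)).
Qed.

Lemma volume_ball_moment m k (T : R) : 0 <= T ->
  (\int[@volume_Cn R m.+1]_x ball_moment k T x =
   (T ^+ (k + m.+1) / 'C(k + m.+1, m.+1)%:R)%:E)%E.
Proof.
move=> T0; etransitivity.
  apply: (ge0_integral_mscale (lebesgue_Cn R m.+1) measurableT (volume_const R m.+1)
    (measurable_ball_moment k T)) => x _.
  exact: ball_moment_ge0.
rewrite integral_ball_moment// -EFinM; congr EFin.
have := bin_fact (leq_addl k m.+1); rewrite addnK => /(congr1 (fun n => n%:R : R)).
rewrite (natrM _ 'C(_, _)) (natrM _ m.+1`!) => <-.
have -> : (volume_const R m.+1)%:num = (m.+1)`!%:R / pi ^+ m.+1 by [].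
have c0 : 'C(k + m.+1, m.+1)%:R != 0 :> R.
  by rewrite pnatr_eq0 -lt0n bin_gt0 leq_addl.
have f0 j : j`!%:R != 0 :> R by rewrite pnatr_eq0 -lt0n fact_gt0.
have p0 : (pi : R) ^+ m.+1 != 0 by rewrite expf_neq0// gt_eqF// pi_gt0.
move: c0 (f0 m.+1) (f0 k) p0; move: ('C(_, _)%:R) (m.+1`!%:R) (k`!%:R) (pi ^+ m.+1) (T ^+ _).
by move=> c a b q x c0 a0 b0 q0; field; rewrite c0 a0 b0 q0.
Qed.

End UnitaryAction.

(** * Averages over one-parameter families *)

Section Average.
Context d (X : measurableType d) (R : realType).
Variable mu : {sigma_finite_measure set X -> \bar R}.

Lemma mpres_integrable (T : X -> X) (f : X -> R) : mpres mu T ->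
  mu.-integrable setT (EFin \o f) ->
  (\int[mu]_x (f (T x))%:E = \int[mu]_x (f x)%:E)%E.
Proof.
move=> pT /measurable_int mf; rewrite integralE [RHS]integralE.
have H1 : (\int[mu]_x (EFin \o f)^\+ (T x) = \int[mu]_x (EFin \o f)^\+ x)%E := mpres_integral pT (measurable_funepos mf) (funepos_ge0 _).
have H2 : (\int[mu]_x (EFin \o f)^\- (T x) = \int[mu]_x (EFin \o f)^\- x)%E := mpres_integral pT (measurable_funeneg mf) (funeneg_ge0 _).
f_equal; last f_equal.
  by rewrite -[RHS]H1; apply: eq_integral => x _; rewrite !funeposE.
by rewrite -[RHS]H2; apply: eq_integral => x _; rewrite !funenegE.
Qed.

Lemma segment_integral (c : \bar R) :
  (\int[@lebesgue_R R]_t (if (0 <= t <= 2 * pi)%R then c else 0) = c * (2 * pi)%:E)%E.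
Proof.
transitivity (\int[@lebesgue_measure R]_(t in `[0%R, (2 * pi)%R]) c)%E.
  rewrite [RHS]integral_mkcond; apply: eq_integral => t _; rewrite patchE.
  by rewrite mem_setE /= in_itv.
rewrite integral_cst//= lebesgue_measure_itv/= lte_fin twopi_gt0.
by rewrite -EFinB subr0.
Qed.

Variable T : R -> X -> X.
Hypothesis mT : measurable_fun setT (fun u : X * measurableTypeR R => T u.2 u.1).
Hypothesis pT : forall t, mpres mu (T t).

(** Fubini on [0, 2 pi] x X, each T t preserving the integral. *)
Lemma integral_average (f : X -> R) : mu.-integrable setT (EFin \o f) ->
  (forall x, (@lebesgue_measure R).-integrable `[0%R, (2 * pi)%R] (fun t => (f (T t x))%:E)) ->
  mu.-integrable setT (fun x => (seg_int 0 (2 * pi) (fun t => f (T t x)))%:E) /\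
  (\int[mu]_x (seg_int 0 (2 * pi) (fun t => f (T t x)))%:E =
   (2 * pi)%:E * \int[mu]_x (f x)%:E)%E.
Proof.
move=> fi fT; have mf := measurable_int _ fi.
pose Phi (u : X * measurableTypeR R) : \bar R :=
  if (0 <= (u.2 : R) <= 2 * pi)%R then (f (T u.2 u.1))%:E else 0%E.
have mPhi : measurable_fun setT Phi.
  apply: measurable_fun_ifT; [|exact: (measurableT_comp mf mT)|exact: measurable_cst].
  apply: measurable_and.
    by apply: measurable_fun_ler; [exact: measurable_cst|exact: measurable_snd].
  by apply: measurable_fun_ler; [exact: measurable_snd|exact: measurable_cst].
have Phi_int : (mu \x @lebesgue_R R)%E.-integrable setT Phi.
  have [_] := integrable21ltyP mu (@lebesgue_R R) mPhi; apply.
  rewrite (_ : \int[_]_x _ = (\int[mu]_x `|(f x)%:E|) * (2 * pi)%:E)%E; last first.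
    rewrite -segment_integral; apply: eq_integral => t _; rewrite /Phi/=.
    case: ifP => _; last by rewrite abse0 integral0.
    apply: (mpres_integral (pT t) (f := fun x => `|(f x)%:E|%E)) => //.
    exact: (measurableT_comp _ mf).
  have /integrableP[_ fi'] := fi.
  apply: lte_mul_pinfty; rewrite ?ltry ?integral_ge0//.
  by rewrite ge0_fin_numE// integral_ge0.
have PhiG x : fubini_F (@lebesgue_R R) Phi x = (seg_int 0 (2 * pi) (fun t => f (T t x)))%:E.
  transitivity (\int[@lebesgue_measure R]_(t in `[0%R, (2 * pi)%R]) (f (T t x))%:E)%E.
    rewrite [RHS]integral_mkcond; apply: eq_integral => t _; rewrite patchE.
    by rewrite mem_setE /= in_itv.
  by rewrite /seg_int /Rintegral fineK//; exact: integrable_fin_num.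
rewrite -(_ : fubini_F (@lebesgue_R R) Phi = fun x => _); last by apply/funext => x; exact: PhiG.
split; first exact: integrable_fubini_F.
rewrite (integral12_prod_meas1 Phi_int) -(integral21_prod_meas1 Phi_int).
rewrite muleC -segment_integral; apply: eq_integral => t _; rewrite /Phi/fubini_G/=.
case: ifP => _; last by rewrite integral0.
exact: mpres_integrable.
Qed.

End Average.

Section ComplexAverage.
Context d (X : measurableType d) (R : realType).
Variable mu : {sigma_finite_measure set X -> \bar R}.
Local Notation C := R[i].

Definition cintegrable (F : X -> C) :=
  mu.-integrable setT (fun x => (complex.Re (F x))%:E) /\
  mu.-integrable setT (fun x => (complex.Im (F x))%:E).

Lemma cintegrable_dom (F : X -> C) (g : X -> R) :
  measurable_fun setT (fun x => complex.Re (F x)) ->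
  measurable_fun setT (fun x => complex.Im (F x)) ->
  (forall x, normc (F x) <= g x) -> mu.-integrable setT (EFin \o g) -> cintegrable F.
Proof.
move=> mR mI Fg gi; split; apply: (le_integrable measurableT _ _ gi).
- exact/measurable_EFinP.
- move=> x _; rewrite /= lee_fin; apply: le_trans (ler_norm _).
  by apply: le_trans (Fg x); exact: Re_le_normc.
- exact/measurable_EFinP.
- move=> x _; rewrite /= lee_fin; apply: le_trans (ler_norm _).
  by apply: le_trans (Fg x); exact: Im_le_normc.
Qed.

Variable T : R -> X -> X.
Hypothesis mT : measurable_fun setT (fun u : X * measurableTypeR R => T u.2 u.1).
Hypothesis pT : forall t, mpres mu (T t).

Lemma cintegral_average (F : X -> C) : cintegrable F ->
  (forall x, cseg_cont 0 (2 * pi) (fun t => F (T t x))) ->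
  cintegrable (fun x => circle_mean (fun t => F (T t x))) /\
  complex_integral mu setT (fun x => circle_mean (fun t => F (T t x))) =
  complex_integral mu setT F.
Proof.
move=> [FR FI] cF.
have cFR x : (@lebesgue_measure R).-integrable `[0%R, (2 * pi)%R]
    (fun t => (complex.Re (F (T t x)))%:E).
  by have /cseg_contP[/seg_cont_integrable] := cF x.
have cFI x : (@lebesgue_measure R).-integrable `[0%R, (2 * pi)%R]
    (fun t => (complex.Im (F (T t x)))%:E).
  by have /cseg_contP[_ /seg_cont_integrable] := cF x.
have [iR eR] := integral_average mT pT FR cFR.
have [iI eI] := integral_average mT pT FI cFI.
have p0 : (2 * pi : R) != 0 by rewrite gt_eqF// twopi_gt0.
have mR x : complex.Re (circle_mean (fun t => F (T t x))) =
    (2 * pi)^-1 * seg_int 0 (2 * pi) (fun t => complex.Re (F (T t x))).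
  by rewrite /circle_mean /cseg_int/= mul0r subr0.
have mI x : complex.Im (circle_mean (fun t => F (T t x))) =
    (2 * pi)^-1 * seg_int 0 (2 * pi) (fun t => complex.Im (F (T t x))).
  by rewrite /circle_mean /cseg_int/= mul0r addr0.
split.
  split.
    apply: eq_integrable (integrableZl measurableT (2 * pi)^-1 iR) => // x _.
    exact: (esym (f_equal EFin (mR x))).
  apply: eq_integrable (integrableZl measurableT (2 * pi)^-1 iI) => // x _.
  exact: (esym (f_equal EFin (mI x))).
have E (f : X -> R) (g : X -> R) : mu.-integrable setT (fun x => (f x)%:E) ->
    mu.-integrable setT (fun x => (g x)%:E) ->
    (\int[mu]_x (f x)%:E = (2 * pi)%:E * \int[mu]_x (g x)%:E)%E ->
    \int[mu]_x ((2 * pi)^-1 * f x) = \int[mu]_x g x.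
  move=> fi gi H; rewrite RintegralZl//; apply: (mulfI p0).
  rewrite mulrA mulfV// mul1r /Rintegral H fineM//.
  exact: integrable_fin_num.
rewrite /complex_integral; f_equal.
  rewrite -(E _ _ iR FR eR); f_equal; apply/funext => x; exact: mR.
rewrite -(E _ _ iI FI eI); f_equal; apply/funext => x; exact: mI.
Qed.

End ComplexAverage.

(** * Affine restrictions of holomorphic functions, uniqueness of Taylor coefficients *)

Section HDiffComposition.
Variable R : realType.
Local Notation C := R[i].

Lemma hdiff_affine (E F : normedModType C) (L : E -> F) (c : F) (f : F -> C) x :
  bounded_lin L -> hdiff f (c + L x) -> hdiff (fun y => f (c + L y)) x.
Proof.
move=> [LD LZ [B B0 LB]] [M [MD MZ [D D0 MD']] Mf].
exists (fun h => M (L h)); first split.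
- by move=> u v; rewrite LD MD.
- by move=> a u; rewrite LZ MZ.
- exists (D * B) => [|u]; first by rewrite mulr_gt0.
  apply: (le_trans (MD' _)); rewrite -mulrA; apply: ler_wpM2l; last exact: LB.
  exact: ltW.
move=> e e0; have eB : 0 < e / B by rewrite divr_gt0.
have [d d0 H] := Mf _ eB; exists (d / B) => [|h]; first by rewrite divr_gt0.
rewrite ltr_pdivlMr// mulrC => hd.
have Lhd : nrm (L h) < d by apply: le_lt_trans hd; exact: LB.
have := H _ Lhd; rewrite LD addrA => /le_trans; apply.
rewrite -mulrA ler_pM2l// ler_pdivrMl//; exact: LB.
Qed.

Lemma hdiff_lin (E : normedModType C) (L : E -> C^o) x : bounded_lin L -> hdiff L x.
Proof.
move=> bL; exists L => // e e0; exists 1 => // h _; have [LD _ _] := bL.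
by rewrite LD addrAC addrK subrr normc0 mulr_ge0 ?nrm_ge0// ltW.
Qed.

Lemma hdiffM (E : normedModType C) (f g : E -> C) x :
  hdiff f x -> hdiff g x -> hdiff (fun y => f y * g y) x.
Proof.
move=> /hdiff_differentiable df /hdiff_differentiable dg.
by apply: differentiable_hdiff; exact: (@differentiableM C E f g x df dg).
Qed.

Lemma hdiffX (E : normedModType C) (f : E -> C) x k :
  hdiff f x -> hdiff (fun y => f y ^+ k) x.
Proof.
move=> df; elim: k => [|k IH]; first exact: hdiff_cst.
have -> : (fun y => f y ^+ k.+1) = (fun y => f y * f y ^+ k).
  by apply/funext => y; rewrite exprS.
exact: hdiffM.
Qed.

Lemma nrm_fst (E F : normedModType C) (x : E * F) : nrm x.1 <= nrm x.
Proof.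
by rewrite leNgt; apply/negP => /(nrm_pair x _).1[]; rewrite ltxx.
Qed.

Lemma nrm_snd (E F : normedModType C) (x : E * F) : nrm x.2 <= nrm x.
Proof.
by rewrite leNgt; apply/negP => /(nrm_pair x _).1[_]; rewrite ltxx.
Qed.

Lemma bounded_lin_fst (E F : normedModType C) : bounded_lin (fun x : E * F => x.1).
Proof. by split => //; exists 1 => // x; rewrite mul1r nrm_fst. Qed.

Lemma bounded_lin_snd (E F : normedModType C) : bounded_lin (fun x : E * F => x.2).
Proof. by split => //; exists 1 => // x; rewrite mul1r nrm_snd. Qed.

Lemma bounded_lin_inl (E F : normedModType C) : bounded_lin (fun x : E => (x, 0 : F)).
Proof.
split=> [x y|a x|].
- by rewrite -[RHS]/(x + y, 0 + 0) addr0.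
- by rewrite -[RHS]/(a *: x, a *: 0) scaler0.
exists 1 => // x; rewrite mul1r leNgt; apply/negP => xx.
have : nrm (x, 0 : F) < nrm (x, 0 : F); last by rewrite ltxx.
by apply/nrm_pair; split => //=; rewrite nrm0; apply: le_lt_trans xx; exact: nrm_ge0.
Qed.

Lemma bounded_lin_inr (E F : normedModType C) : bounded_lin (fun x : F => (0 : E, x)).
Proof.
split=> [x y|a x|].
- by rewrite -[RHS]/(0 + 0, x + y) addr0.
- by rewrite -[RHS]/(a *: 0, a *: x) scaler0.
exists 1 => // x; rewrite mul1r leNgt; apply/negP => xx.
have : nrm (0 : E, x) < nrm (0 : E, x); last by rewrite ltxx.
by apply/nrm_pair; split => //=; rewrite nrm0; apply: le_lt_trans xx; exact: nrm_ge0.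
Qed.

Lemma normc_coord_le m (Z : 'rV[C]_m.+1) i : normc (Z 0 i) <= nrm (Z : 'rV[C]_m.+1).
Proof.
rewrite -lecR -norm_normcE -nrmE [leRHS]/Num.norm/= mx_normE.
exact: (@le_bigmax _ {nonneg C} _ 0%:nng (fun i : 'I_1 * 'I_m.+1 => `|Z i.1 i.2|%:nng) (0, i)).
Qed.

Lemma bounded_lin_mulmx m n (M : 'M[C]_(m.+1, n.+1)) :
  bounded_lin (fun Z : 'rV[C]_m.+1 => (Z *m M : 'rV[C]_n.+1)).
Proof.
split=> [x y|a x|]; first exact: mulmxDl.
  by rewrite scalemxAl.
exists (1 + \sum_i nrm (row i M)) => [|Z].
  by rewrite ltr_wpDr// sumr_ge0// => i _; exact: nrm_ge0.
rewrite mulmx_sum_row mulrDl mul1r ler_wpDl ?nrm_ge0// mulr_suml.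
apply: (@big_ind2 _ _ (fun (x : 'rV[C]_n.+1) (y : R) => nrm x <= y)).
- by rewrite nrm0.
- by move=> x1 x2 y1 y2 h1 h2; apply: (le_trans (nrmD _ _)); exact: lerD.
- move=> i _; rewrite nrmZ mulrC; apply: ler_wpM2l; first exact: nrm_ge0.
  exact: normc_coord_le.
Qed.

Lemma bounded_lin_dotmx m (u : 'rV[C]_m.+1) :
  bounded_lin (fun Z : 'rV[C]_m.+1 => (dotmx Z u : C^o)).
Proof.
split=> [x y|a x|]; first by rewrite linearDl.
  by rewrite linearZl_LR.
exists (1 + \sum_i normc (u 0 i)) => [|Z].
  by rewrite ltr_wpDr// sumr_ge0// => i _; exact: normc_ge0.
rewrite mulrDl mul1r ler_wpDl ?nrm_ge0// mulr_suml dotmx_sum nrm_normc.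
apply: (@big_ind2 _ _ (fun (x : C) (y : R) => normc x <= y)).
- by rewrite normc0.
- by move=> x1 x2 y1 y2 h1 h2; apply: (le_trans (normcD _ _)); exact: lerD.
- move=> i _; rewrite normcM normc_conj mulrC; apply: ler_wpM2l; first exact: normc_ge0.
  exact: normc_coord_le.
Qed.

End HDiffComposition.

Section MoreLimits.
Variable R : realType.
Local Notation C := R[i].
Context {T : Type} (F : set_system T) {FF : Filter F}.

Lemma cvgc_conj (f : T -> C) a : cvgc F f a -> cvgc F (fun x => (f x)^*) (a^*).
Proof.
move=> /cvgc_ReIm[fR fI]; apply/cvgc_ReIm.
have RN z : complex.Re (z^* : C) = complex.Re z by case: z.
have IN z : complex.Im (z^* : C) = - complex.Im z by case: z.
split; rewrite ?RN ?IN.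
  by rewrite (_ : (fun x => _) = (fun x => complex.Re (f x)))//; apply/funext => x.
rewrite (_ : (fun x => _) = (fun x => - complex.Im (f x))); last by apply/funext => x.
exact: cvgN.
Qed.

Lemma cvgcX (f : T -> C) a k : cvgc F f a -> cvgc F (fun x => f x ^+ k) (a ^+ k).
Proof.
move=> fa; elim: k => [|k IH]; first exact: cvgc_cst.
have -> : (fun x => f x ^+ k.+1) = (fun x => f x * f x ^+ k).
  by apply/funext => x; rewrite exprS.
by rewrite exprS; exact: cvgcM.
Qed.

Lemma cvge_row m (f : T -> 'rV[C]_m.+1) (a : 'rV[C]_m.+1) :
  (forall i, cvgc F (fun x => f x 0 i) (a 0 i)) -> cvge F f a.
Proof.
move=> H; rewrite (row_sum_delta a).
have -> : f = (fun x => \sum_i f x 0 i *: delta_mx 0 i).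
  by apply/funext => x; exact: row_sum_delta.
by apply: cvge_sum => i; exact: cvgeZ.
Qed.

End MoreLimits.

Section TaylorUniqueness.
Variable R : realType.
Local Notation C := R[i].

Lemma taylor_remainder_le f (r : R) N : 0 < r -> (forall w, normc w <= r -> cdiff f w) ->
  exists B, forall z, normc z <= r / 2 ->
    normc (f z - \sum_(k < N) taylor_coef f r k * z ^+ k) <= B * normc z ^+ N.
Proof.
move=> r0 df; have [M M0 fM] := circle_bounded df r0.
exists (4 * M / r ^+ N) => z zr.
have zr' : normc z < r by lra.
apply: (le_trans (taylor_remainder N r0 zr' df fM)).
have rz : r / (r - normc z) <= 2 by rewrite ler_pdivrMr; lra.
rewrite expr_div_n.
have -> : 4 * M / r ^+ N * normc z ^+ N = 2 * (M * (normc z ^+ N / r ^+ N * 2)) by ring.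
rewrite ler_pM2l// ler_wpM2l// ler_wpM2l// divr_ge0// exprn_ge0// ?normc_ge0//.
exact: ltW.
Qed.

(** If the first nonzero difference of coefficients had index k, the remainders of
    order k + 1 would bound it by a multiple of |z|, for all small z. *)
Lemma taylor_coef_unique f (r s : R) (b : nat -> C) : 0 < r -> 0 < s ->
  (forall w, normc w <= r -> cdiff f w) ->
  (forall N, exists B, forall z, normc z <= s ->
    normc (f z - \sum_(k < N) b k * z ^+ k) <= B * normc z ^+ N) ->
  forall k, b k = taylor_coef f r k.
Proof.
move=> r0 s0 df fb k; apply/eqP; rewrite -subr_eq0; apply/eqP.
pose c j := b j - taylor_coef f r j; rewrite -/(c k).
elim/ltn_ind: k => k IH.
have [B1 H1] := fb k.+1; have [B2 H2] := taylor_remainder_le k.+1 r0 df.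
pose q := Num.min s (r / 2); have q0 : 0 < q by rewrite lt_min s0 divr_gt0.
have [qs qr] : q <= s /\ q <= r / 2 by split; rewrite ge_min lexx ?orbT.
apply: (@harmonic_eq0 _ _ ((B1 + B2) * q)) => n.
pose z : C := (q * n.+1%:R^-1)%:C.
have n0 : 0 < n.+1%:R^-1 :> R by rewrite invr_gt0 ltr0n.
have n1 : n.+1%:R^-1 <= 1 :> R by rewrite invf_le1 ?ler1n// ltr0n.
have zE : normc z = q * n.+1%:R^-1 by rewrite normc_real gtr0_norm// mulr_gt0.
have zq : normc z <= q by rewrite zE -[leRHS]mulr1 ler_wpM2l// ltW.
have z0 : 0 < normc z by rewrite zE mulr_gt0.
have sumE : \sum_(j < k.+1) c j * z ^+ j = c k * z ^+ k.
  rewrite big_ord_recr/= big1 ?add0r// => j _.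
  by rewrite IH ?mul0r.
have E : c k * z ^+ k = (f z - \sum_(j < k.+1) taylor_coef f r j * z ^+ j) -
    (f z - \sum_(j < k.+1) b j * z ^+ j).
  rewrite -sumE /c.
  have -> : \sum_(j < k.+1) (b j - taylor_coef f r j) * z ^+ j =
     \sum_(j < k.+1) b j * z ^+ j - \sum_(j < k.+1) taylor_coef f r j * z ^+ j.
    by rewrite -sumrB; apply: eq_bigr => j _; rewrite mulrBl.
  by ring.
have : normc (c k * z ^+ k) <= (B1 + B2) * normc z ^+ k.+1.
  rewrite E; apply: (le_trans (normcB _ _)); rewrite addrC mulrDl.
  by apply: lerD; [apply: H1|apply: H2]; apply: le_trans zq _.
rewrite normcM normcX exprS mulrA ler_pM2r ?exprn_gt0// => /le_trans; apply.
by rewrite zE le_eqVlt; apply/orP; left; apply/eqP; ring.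
Qed.

(** The Taylor expansion of f at a l is an expansion in powers of l. *)
Lemma taylor_coef_scale f (r : R) (a : C) k : 0 < r ->
  (forall w, normc w <= r -> cdiff f w) ->
  forall t, 0 < t -> (forall w, normc w <= t -> cdiff (fun l => f (a * l)) w) ->
  taylor_coef (fun l => f (a * l)) t k = taylor_coef f r k * a ^+ k.
Proof.
move=> r0 df t t0 dfa; apply/esym.
have a1 : 0 < 1 + normc a by rewrite ltr_wpDr// normc_ge0.
have s0 : 0 < r / 2 / (1 + normc a) by rewrite divr_gt0// divr_gt0.
apply: (@taylor_coef_unique _ _ _ (fun k => taylor_coef f r k * a ^+ k) t0 s0 dfa) => N.
have [B H] := taylor_remainder_le N r0 df.
exists (B * normc a ^+ N) => z; rewrite ler_pdivlMr// => zs.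
rewrite -mulrA -exprMn -normcM.
have -> : \sum_(j < N) taylor_coef f r j * a ^+ j * z ^+ j =
    \sum_(j < N) taylor_coef f r j * (a * z) ^+ j.
  by apply: eq_bigr => j _; rewrite exprMn mulrA.
apply: H; apply: le_trans zs; rewrite normcM mulrC ler_wpM2l ?normc_ge0//.
by rewrite lerDr.
Qed.

End TaylorUniqueness.

(** * Integrals against powers of a linear form on a ball *)

Section DiagonalRotations.
Variables (R : realType) (m : nat).
Local Notation C := R[i].
Variable D : R -> 'rV[C]_m.+1.
Hypothesis D1 : forall t i, normc (D t 0 i) = 1.
Hypothesis cD : forall t i, cvgc (nbhs t) (fun s => D s 0 i) (D t 0 i).

Definition rotate (t : R) (x : m.+1.-tuple (Rpair R)) := unitary_act (diag_mx (D t)) x.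

Lemma std_rotate t x i : std_coord_map (rotate t x) 0 i = std_coord_map x 0 i * D t 0 i.
Proof. by rewrite std_unitary_act mul_mx_diag mxE. Qed.

Lemma sqn_rotate t x : sqn (rotate t x) = sqn x.
Proof.
by rewrite !sqn_sqnorm std_unitary_act sqnorm_unitary//; exact: unitary_diag.
Qed.

Lemma mpres_rotate t : mpres (@volume_Cn R m.+1) (rotate t).
Proof. by apply: mpres_unitary; exact: unitary_diag. Qed.

Lemma measurable_rotate : measurable_fun setT
  (fun u : m.+1.-tuple (Rpair R) * measurableTypeR R => rotate u.2 u.1).
Proof.
have mC (f : C -> R) : (f = @complex.Re R) \/ (f = @complex.Im R) -> forall i : 'I_m.+1,
    measurable_fun setT (fun t : measurableTypeR R => f (D t 0 i)).
  move=> Hf i; apply: (@continuous_measurable_fun R (fun t : R => f (D t 0 i))) => t.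
  by have /cvgc_ReIm[hR hI] := cD t i; case: Hf => ->.
have mx (i : 'I_m.+1) :
    measurable_fun setT (fun u : m.+1.-tuple (Rpair R) * measurableTypeR R => tnth u.1 i).
  exact: (measurableT_comp (measurable_tnth i) measurable_fst).
apply: measurable_tuple => i.
pose a (u : m.+1.-tuple (Rpair R) * measurableTypeR R) : R := (tnth u.1 i).1.
pose b (u : m.+1.-tuple (Rpair R) * measurableTypeR R) : R := (tnth u.1 i).2.
pose c (u : m.+1.-tuple (Rpair R) * measurableTypeR R) : R := complex.Re (D u.2 0 i).
pose d (u : m.+1.-tuple (Rpair R) * measurableTypeR R) : R := complex.Im (D u.2 0 i).
have ma : measurable_fun setT a by exact: (measurableT_comp measurable_fst (mx i)).
have mb : measurable_fun setT b by exact: (measurableT_comp measurable_snd (mx i)).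
have mc : measurable_fun setT c.
  by apply: (measurableT_comp (mC _ (or_introl erefl) i) measurable_snd).
have md : measurable_fun setT d.
  by apply: (measurableT_comp (mC _ (or_intror erefl) i) measurable_snd).
have E u : (std_coord_map u.1 *m diag_mx (D u.2)) 0 i =
    Complex (a u * c u - b u * d u) (a u * d u + b u * c u).
  rewrite mul_mx_diag !mxE /to_complex /a /b /c /d; case: (D u.2 0 i) => e f /=.
  by [].
apply: measurable_fun_pair.
  rewrite (_ : (fun u => _) = (fun u => a u * c u - b u * d u)); last first.
    by apply/funext => u; rewrite E.
  by apply: measurable_funB; apply: measurable_funM.
rewrite (_ : (fun u => _) = (fun u => a u * d u + b u * c u)); last first.
  by apply/funext => u; rewrite E.
by apply: measurable_funD; apply: measurable_funM.
Qed.

End DiagonalRotations.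

Section BallIntegral.
Variables (R : realType) (m : nat).
Local Notation C := R[i].
Local Notation vol := (@volume_Cn R m.+1).

(** The extension by 0 allows integration over the whole space, on which the
    rotations act. *)
Definition ball_pairing (T : R) (g : 'rV[C]_m.+1 -> C) (u : 'rV[C]_m.+1) k
    (x : m.+1.-tuple (Rpair R)) : C :=
  if sqn x < T then g (std_coord_map x) * ((dotmx (std_coord_map x) u ^+ k)^*)%C else 0.

Local Notation e_last := (delta_mx 0 ord_max : 'rV[C]_m.+1).

Lemma dotmx_e_last (Z : 'rV[C]_m.+1) : dotmx Z e_last = Z 0 ord_max.
Proof.
rewrite dotmx_sum (bigD1 ord_max)//= big1 ?addr0 => [|i /negbTE im].
  by rewrite mxE !eqxx conjc1 mulr1.
by rewrite mxE im andbF conjc0 mulr0.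
Qed.

Lemma sqnorm_e_last (a : C) : sqnorm (a *: e_last) = normc a ^+ 2.
Proof.
rewrite sqnormZ sqnorm_sum (bigD1 ord_max)//= big1 ?addr0 => [|i /negbTE im].
  by rewrite mxE !eqxx normc1 expr1n mulr1.
by rewrite mxE im andbF normc0 expr0n.
Qed.

Lemma cseg_cont_rotate (D : R -> 'rV[C]_m.+1) (T : R) (g : 'rV[C]_m.+1 -> C) k x :
  (forall t i, normc (D t 0 i) = 1) ->
  (forall t i, cvgc (nbhs t) (fun s => D s 0 i) (D t 0 i)) ->
  (forall Z, sqnorm Z < T -> hdiff g Z) ->
  cseg_cont 0 (2 * pi) (fun t => ball_pairing T g e_last k (rotate D t x)).
Proof.
move=> D1 cD dg t _.
have [xT|xT] := boolP (sqn x < T); last first.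
  have E s : ball_pairing T g e_last k (rotate D s x) = 0.
    by rewrite /ball_pairing sqn_rotate// (negbTE xT).
  rewrite E (_ : (fun s => _) = fun=> 0); first exact: cvgc_cst.
  by apply/funext.
have E s : ball_pairing T g e_last k (rotate D s x) =
    g (std_coord_map (rotate D s x)) * ((dotmx (std_coord_map (rotate D s x)) e_last ^+ k)^*)%C.
  by rewrite /ball_pairing sqn_rotate// xT.
rewrite E (_ : (fun s => _) = (fun s =>
  g (std_coord_map (rotate D s x)) * ((dotmx (std_coord_map (rotate D s x)) e_last ^+ k)^*)%C));
  last by apply/funext.
have cr i : cvgc (nbhs t) (fun s => std_coord_map (rotate D s x) 0 i)
    (std_coord_map (rotate D t x) 0 i).
  rewrite std_rotate (_ : (fun s => _) = (fun s => std_coord_map x 0 i * D s 0 i)).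
    by apply: cvgcM; [exact: cvgc_cst|exact: cD].
  by apply/funext => s; rewrite std_rotate.
apply: cvgcM.
  apply: (@cvge_hdiff _ _ _ _ _ (fun s => std_coord_map (rotate D s x)) _ g).
    exact: cvge_row.
  by apply: dg; rewrite -sqn_sqnorm sqn_rotate.
apply: cvgc_conj; apply: cvgcX; rewrite dotmx_e_last.
rewrite (_ : (fun s => _) = (fun s => std_coord_map (rotate D s x) 0 ord_max)); first exact: cr.
by apply/funext => s; rewrite dotmx_e_last.
Qed.

Definition rotate_others t : 'rV[C]_m.+1 := \row_i (if i == ord_max then 1 else cis t).
Definition rotate_last t : 'rV[C]_m.+1 := \row_i (if i == ord_max then cis t else 1).

Lemma rotate_others_norm t i : normc (rotate_others t 0 i) = 1.
Proof. by rewrite mxE; case: ifP; rewrite ?normc1 ?normc_cis. Qed.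

Lemma rotate_last_norm t i : normc (rotate_last t 0 i) = 1.
Proof. by rewrite mxE; case: ifP; rewrite ?normc1 ?normc_cis. Qed.

Lemma rotate_others_cvg t i : cvgc (nbhs t) (fun s => rotate_others s 0 i) (rotate_others t 0 i).
Proof.
rewrite (_ : (fun s => _) = (fun s => if i == ord_max then 1 else cis s)); last first.
  by apply/funext => s; rewrite mxE.
rewrite mxE; have [_|_] := eqVneq i ord_max; first exact: cvgc_cst.
exact: continuous_cis.
Qed.

Lemma rotate_last_cvg t i : cvgc (nbhs t) (fun s => rotate_last s 0 i) (rotate_last t 0 i).
Proof.
rewrite (_ : (fun s => _) = (fun s => if i == ord_max then cis s else 1)); last first.
  by apply/funext => s; rewrite mxE.
rewrite mxE; have [_|_] := eqVneq i ord_max; last exact: cvgc_cst.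
exact: continuous_cis.
Qed.

Lemma conj_cisX (t : R) k : ((cis t ^+ k)^*)%C = (cis t ^+ k)^-1.
Proof.
have c0 : cis t ^+ k != 0 by rewrite expf_neq0// cis_neq0.
by apply: (mulfI c0); rewrite mulcJ normcX normc_cis !expr1n mulfV.
Qed.

Lemma circle1 t : circle (1 : R) t = cis t.
Proof. by rewrite /circle mul1r. Qed.

Section Averages.
Variables (T : R) (g : 'rV[C]_m.+1 -> C) (k : nat).
Hypothesis dg : forall Z, sqnorm Z < T -> hdiff g Z.

Lemma normc_last_le (Z : 'rV[C]_m.+1) : normc (Z 0 ord_max) ^+ 2 <= sqnorm Z.
Proof.
rewrite sqnorm_sum (bigD1 ord_max)//= lerDl sumr_ge0// => i _.
by rewrite exprn_ge0// normc_ge0.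
Qed.

Lemma last_coord_split (Z : 'rV[C]_m.+1) l i :
  (Z 0 ord_max *: e_last + l *: (Z - Z 0 ord_max *: e_last)) 0 i =
  if i == ord_max then Z 0 ord_max else l * Z 0 i.
Proof.
rewrite !mxE eqxx/=; have [->|_] := eqVneq i ord_max.
  by rewrite mulr1 subrr mulr0 addr0.
by rewrite mulr0 subr0 add0r.
Qed.

Definition last_only (Z : 'rV[C]_m.+1) : C := g (Z 0 ord_max *: e_last).

Lemma hdiff_last_only Z : sqnorm Z < T -> hdiff last_only Z.
Proof.
move=> ZT; pose P : 'M[C]_m.+1 := delta_mx ord_max ord_max.
have E Y : Y *m P = Y 0 ord_max *: e_last.
  apply/rowP => j; rewrite mxE (bigD1 ord_max)//= big1 ?addr0 => [|i /negbTE im].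
    by rewrite !mxE eqxx.
  by rewrite mxE im mulr0.
have -> : last_only = (fun Y => g (0 + Y *m P)).
  by apply/funext => Y; rewrite add0r E.
apply: hdiff_affine; first exact: bounded_lin_mulmx.
rewrite add0r E; apply: dg; rewrite sqnorm_e_last.
by apply: le_lt_trans ZT; exact: normc_last_le.
Qed.

(** Mean value property of the holomorphic function of one variable which
    multiplies the coordinates other than the last one by l. *)
Lemma mean_rotate_others x :
  circle_mean (fun t => ball_pairing T g e_last k (rotate rotate_others t x)) =
  ball_pairing T last_only e_last k x.
Proof.
pose Z := std_coord_map x; pose a := Z 0 ord_max.
have [xT|xT] := boolP (sqn x < T); last first.
  rewrite (@eq_circle_mean _ _ (fun=> 0)) ?circle_mean_cst.
    by rewrite /ball_pairing (negbTE xT).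
  by move=> t; rewrite /ball_pairing sqn_rotate ?(negbTE xT)//; exact: rotate_others_norm.
pose Z' := Z - a *: e_last.
have ZE l i : (a *: e_last + l *: Z') 0 i = if i == ord_max then a else l * Z 0 i.
  exact: last_coord_split.
pose phi l := g (a *: e_last + l *: Z').
have dphi w : normc w <= 1 -> cdiff phi w.
  move=> w1; apply: hdiff_line; apply: dg.
  apply: le_lt_trans xT; rewrite sqn_sqnorm !sqnorm_sum.
  apply: ler_sum => i _; rewrite ZE; have [->//|_] := eqVneq i ord_max.
  rewrite normcM exprMn -[leRHS]mul1r ler_wpM2r ?exprn_ge0 ?normc_ge0//.
  by rewrite exprn_ile1// normc_ge0.
have rE t : std_coord_map (rotate rotate_others t x) = a *: e_last + cis t *: Z'.
  apply/rowP => i; rewrite std_rotate ZE [rotate_others _ _ _]mxE -/Z mulrC.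
  by have [->|_] := eqVneq i ord_max; rewrite ?mul1r.
have E t : ball_pairing T g e_last k (rotate rotate_others t x) =
    ((a ^+ k)^*)%C * (phi (circle 1 t) / circle 1 t ^+ 0).
  rewrite /ball_pairing sqn_rotate; last exact: rotate_others_norm.
  rewrite xT circle1 rE dotmx_e_last ZE eqxx mulrC expr0 divr1.
  by [].
rewrite (eq_circle_mean E) circle_meanZ; last first.
  apply: (@cseg_contM R 0 (2 * pi) (fun t => phi (circle 1 t)) (fun t => (circle 1 t ^+ 0)^-1)).
    apply: cdiff_cseg_cont => [t _|]; last exact: cseg_cont_circle.
    by apply: dphi; rewrite normc_circle.
  rewrite (_ : (fun t => _) = fun=> 1^-1); first exact: cseg_cont_cst.
  by apply/funext => t; rewrite expr0.
have := taylor_coef0 ltr01 dphi; rewrite /taylor_coef => ->.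
by rewrite /ball_pairing xT /phi scale0r addr0 dotmx_e_last -/Z -/a mulrC.
Qed.

(** Rotating the last coordinate a of x, conj(a^k) is multiplied by (cis t)^-k, so
    that the mean is the Cauchy integral for the k-th coefficient of
    l |-> g(l a e_last). *)
Lemma mean_rotate_last r x : 0 < r -> r ^+ 2 < T ->
  circle_mean (fun t => ball_pairing T last_only e_last k (rotate rotate_last t x)) =
  taylor_coef (fun l => g (l *: e_last)) r k *
    (if sqn x < T then psq (tnth x ord_max) ^+ k else 0)%:C.
Proof.
move=> r0 rT; pose Z := std_coord_map x; pose a := Z 0 ord_max.
have [xT|xT] := boolP (sqn x < T); last first.
  rewrite (@eq_circle_mean _ _ (fun=> 0)) ?circle_mean_cst ?mulr0//.
  by move=> t; rewrite /ball_pairing sqn_rotate ?(negbTE xT)//; exact: rotate_last_norm.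
pose f l := g (l *: e_last).
have df w : normc w ^+ 2 < T -> cdiff f w.
  move=> wT; have -> : f = (fun l => g (0 + l *: e_last)).
    by apply/funext => l; rewrite add0r.
  by apply: hdiff_line; apply: dg; rewrite add0r sqnorm_e_last.
have dfr w : normc w <= r -> cdiff f w.
  move=> wr; apply: df; apply: le_lt_trans rT.
  by apply: ler_pM; rewrite ?normc_ge0.
have aT : normc a ^+ 2 < T.
  by apply: (le_lt_trans (normc_last_le Z)); rewrite -sqn_sqnorm.
have dfa w : normc w <= 1 -> cdiff (fun l => f (a * l)) w.
  move=> w1; have -> : (fun l => f (a * l)) = (fun l => g (0 + l *: (a *: e_last))).
    by apply/funext => l; rewrite add0r scalerA mulrC.
  apply: hdiff_line; apply: dg; rewrite add0r scalerA sqnorm_e_last.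
  apply: le_lt_trans aT; rewrite normcM exprMn -[leRHS]mul1r.
  by rewrite ler_wpM2r ?exprn_ge0 ?normc_ge0// exprn_ile1// normc_ge0.
have rE t : std_coord_map (rotate rotate_last t x) 0 ord_max = a * cis t.
  by rewrite std_rotate [rotate_last _ _ _]mxE eqxx.
have E t : ball_pairing T last_only e_last k (rotate rotate_last t x) =
    ((a ^+ k)^*)%C * (f (a * circle 1 t) / circle 1 t ^+ k).
  rewrite /ball_pairing sqn_rotate; last exact: rotate_last_norm.
  rewrite xT circle1 /last_only dotmx_e_last rE exprMn rmorphM/= conj_cisX -/(f (a * cis t)).
  by rewrite mulrCA.
rewrite (eq_circle_mean E) circle_meanZ; last first.
  apply: (@cseg_contM R 0 (2 * pi) (fun t => f (a * circle 1 t)) (fun t => (circle 1 t ^+ k)^-1)).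
    apply: (@cdiff_cseg_cont _ (fun l => f (a * l))) => [t _|]; last exact: cseg_cont_circle.
    by apply: dfa; rewrite normc_circle.
  apply: cseg_contV; first by apply: cseg_contX; exact: cseg_cont_circle.
  by move=> t _; rewrite expf_neq0// circle_neq0.
have := taylor_coef_scale k r0 dfr ltr01 dfa; rewrite {1}/taylor_coef => ->.
have P : ((psq (tnth x ord_max) ^+ k)%:C : C) = a ^+ k * ((a ^+ k)^*)%C.
  by rewrite mulcJ normcX exprAC psq_normc /a mxE.
by rewrite P mulrC mulrA.
Qed.

End Averages.

End BallIntegral.

Section BallIntegralValue.
Variables (R : realType) (m : nat).
Local Notation C := R[i].
Local Notation vol := (@volume_Cn R m.+1).
Local Notation e_last := (delta_mx 0 ord_max : 'rV[C]_m.+1).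

Lemma ball_moment_integrable k (T : R) : 0 <= T -> vol.-integrable setT (ball_moment k T).
Proof.
move=> T0; apply/integrableP; split; first exact: measurable_ball_moment.
rewrite (eq_integral (ball_moment k T)) ?volume_ball_moment ?ltry// => x _.
by rewrite gee0_abs// ball_moment_ge0.
Qed.

Lemma integral_scaled_moment k (T : R) (c : C) : 0 <= T ->
  complex_integral vol setT
    (fun x => c * (if sqn x < T then psq (tnth x ord_max) ^+ k else 0)%:C) =
  c * (T ^+ (k + m.+1) / 'C(k + m.+1, m.+1)%:R)%:C.
Proof.
move=> T0; have fi := ball_moment_integrable k T0.
pose f (x : m.+1.-tuple (Rpair R)) : R := if sqn x < T then psq (tnth x ord_max) ^+ k else 0.
have If : Rintegral vol setT f = T ^+ (k + m.+1) / 'C(k + m.+1, m.+1)%:R.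
  by rewrite /Rintegral (volume_ball_moment m k T0).
have HR (a : R) : Rintegral vol setT (fun x => a * f x) = a * Rintegral vol setT f.
  exact: RintegralZl.
rewrite -If; case: c => a b.
rewrite /complex_integral.
rewrite (_ : (fun x => complex.Re _) = (fun x => a * f x)); last first.
  by apply/funext => x; rewrite /= mulr0 subr0.
rewrite (_ : (fun x => complex.Im _) = (fun x => b * f x)); last first.
  by apply/funext => x; rewrite /= mulr0 add0r.
by rewrite !HR; simpc.
Qed.

(** Average first over the rotations of the other coordinates, then over those of
    the last one; what remains is a multiple of the moment of order k. *)
Lemma ball_integral_last (T : R) g k r : 0 < r -> r ^+ 2 < T ->
  (forall Z, sqnorm Z < T -> hdiff g Z) ->
  cintegrable vol (ball_pairing T g e_last k) ->
  complex_integral vol setT (ball_pairing T g e_last k) =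
  taylor_coef (fun l => g (l *: e_last)) r k * (T ^+ (k + m.+1) / 'C(k + m.+1, m.+1)%:R)%:C.
Proof.
move=> r0 rT dg gi.
have [i1 <-] := cintegral_average (measurable_rotate (@rotate_others_cvg R m))
  (mpres_rotate (@rotate_others_norm R m)) gi
  (fun x => cseg_cont_rotate k x (@rotate_others_norm R m) (@rotate_others_cvg R m) dg).
have E1 : (fun x => circle_mean (fun t => ball_pairing T g e_last k (rotate (@rotate_others R m) t x))) =
    ball_pairing T (last_only g) e_last k.
  by apply/funext => x; exact: mean_rotate_others.
rewrite E1 in i1 *.
have [_ <-] := cintegral_average (measurable_rotate (@rotate_last_cvg R m))
  (mpres_rotate (@rotate_last_norm R m)) i1
  (fun x => cseg_cont_rotate k x (@rotate_last_norm R m) (@rotate_last_cvg R m) (hdiff_last_only dg)).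
rewrite -integral_scaled_moment; last by apply: le_trans (ltW rT); exact: sqr_ge0.
by f_equal; apply/funext => x; exact: mean_rotate_last.
Qed.

End BallIntegralValue.

Section UnitaryInvariance.
Variables (R : realType) (m : nat).
Local Notation C := R[i].
Local Notation vol := (@volume_Cn R m.+1).

Lemma cintegrable_mpres d (X : measurableType d) (mu : {sigma_finite_measure set X -> \bar R})
    (T : X -> X) (F : X -> C) : mpres mu T -> cintegrable mu F ->
  cintegrable mu (F \o T) /\ complex_integral mu setT (F \o T) = complex_integral mu setT F.
Proof.
move=> pT [FR FI].
have H (f : X -> R) : mu.-integrable setT (EFin \o f) -> mu.-integrable setT (EFin \o (f \o T)).
  move=> fi; have mf := measurable_int _ fi; have [mT _] := pT.
  apply/integrableP; split; first exact: (measurableT_comp mf mT).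
  have /integrableP[_] := fi; apply: le_lt_trans.
  rewrite le_eqVlt; apply/orP; left; apply/eqP.
  apply: (mpres_integral pT (f := fun x => `|(f x)%:E|%E)) => //.
  exact: (measurableT_comp _ mf).
split; first by split; [exact: (H _ FR)|exact: (H _ FI)].
have HR := mpres_integrable pT FR; have HI := mpres_integrable pT FI.
by rewrite /complex_integral /Rintegral -HR -HI.
Qed.

(** A unitary change of coordinates takes u to the last coordinate vector. *)
Lemma ball_integral (M : 'M[C]_m.+1) (T : R) (g : 'rV[C]_m.+1 -> C) k r :
  M \is unitarymx -> 0 < r -> r ^+ 2 < T ->
  (forall Z, sqnorm Z < T -> hdiff g Z) ->
  cintegrable vol (ball_pairing T g (row ord_max M) k) ->
  complex_integral vol setT (ball_pairing T g (row ord_max M) k) =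
  taylor_coef (fun l => g (l *: row ord_max M)) r k *
    (T ^+ (k + m.+1) / 'C(k + m.+1, m.+1)%:R)%:C.
Proof.
move=> uM r0 rT dg gi; pose h Z := g (0 + Z *m M).
have dh Z : sqnorm Z < T -> hdiff h Z.
  move=> ZT; apply: hdiff_affine; first exact: bounded_lin_mulmx.
  by apply: dg; rewrite add0r sqnorm_unitary.
have rE : row ord_max M = delta_mx 0 ord_max *m M by rewrite rowE.
have E : ball_pairing T g (row ord_max M) k \o unitary_act M =
    ball_pairing T h (delta_mx 0 ord_max) k.
  apply/funext => x.
  have Es : sqn (unitary_act M x) = sqn x.
    by rewrite !sqn_sqnorm std_unitary_act sqnorm_unitary.
  rewrite /ball_pairing -[LHS]/(if sqn (unitary_act M x) < T then _ else _) Es.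
  by rewrite (std_unitary_act M x) [in LHS]rE (dotmx_unitary _ _ uM) /h add0r.
have [hi <-] := cintegrable_mpres (mpres_unitary uM) gi.
rewrite E in hi *; rewrite (ball_integral_last r0 rT dh hi).
have H l : h (l *: (delta_mx 0 ord_max : 'rV[C]_m.+1)) = g (l *: row ord_max M).
  by rewrite /h add0r -scalemxAl -rE.
exact: (f_equal (fun F => taylor_coef F r k * _) (funext H)).
Qed.

Lemma integral_direction_moment (M : 'M[C]_m.+1) k (T : R) : M \is unitarymx -> 0 <= T ->
  (\int[vol]_x (if sqn x < T then
     normc (dotmx (std_coord_map x) (row ord_max M)) ^+ 2 ^+ k else 0)%:E =
   (T ^+ (k + m.+1) / 'C(k + m.+1, m.+1)%:R)%:E)%E.
Proof.
move=> uM T0; rewrite -volume_ball_moment//.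
have [M' uM' MM'] : exists2 M' : 'M[C]_m.+1, M' \is unitarymx & M *m M' = 1%:M.
  by exists (map_mx Num.conj M^T); [rewrite trmxC_unitary|exact/unitarymxP].
rewrite -[RHS](mpres_integral (mpres_unitary uM')); last 2 first.
- exact: measurable_ball_moment.
- by move=> x; exact: ball_moment_ge0.
apply: eq_integral => x _; rewrite /ball_moment !sqn_sqnorm std_unitary_act sqnorm_unitary//.
case: ifP => // _; f_equal; f_equal.
have -> : psq (tnth (unitary_act M' x) ord_max) =
    normc (std_coord_map (unitary_act M' x) 0 ord_max) ^+ 2 by rewrite psq_normc mxE.
rewrite std_unitary_act -dotmx_e_last -(dotmx_unitary (std_coord_map x) _ uM').
by rewrite rowE -mulmxA MM' mulmx1.
Qed.

End UnitaryInvariance.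

Section BesselOnBall.
Variables (R : realType) (m : nat).
Local Notation C := R[i].
Local Notation vol := (@volume_Cn R m.+1).
Local Notation cnbhs := (coord_nbhs (@tuple_coord R m.+1)).
Local Notation mtuple := (m.+1.-tuple (Rpair R)).

Lemma cvge_std_coord_map (x : mtuple) :
  cvge (cnbhs x) (@std_coord_map R m.+1) (std_coord_map x).
Proof.
have FF : Filter (cnbhs x) by exact: coord_nbhs_filter.
apply: cvge_row => i; rewrite mxE.
rewrite (_ : (fun y => _) = (fun y => to_complex (tnth y i))); last first.
  by apply/funext => y; rewrite mxE.
exact: cvgc_tuple_coord.
Qed.

Lemma cvg_sqn (x : mtuple) : sqn y @[y --> cnbhs x] --> sqn x.
Proof.
have FF : Filter (cnbhs x) by exact: coord_nbhs_filter.
pose c i (y : mtuple) : C := to_complex (tnth y i) * ((to_complex (tnth y i))^*)%C.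
have E y : sqn y = complex.Re (\sum_(i < m.+1) c i y).
  rewrite /sqn raddf_sum; apply: eq_bigr => i _.
  by rewrite /c mulcJ psq_normc.
rewrite E (_ : (fun y => _) = (fun y => complex.Re (\sum_(i < m.+1) c i y))).
  have H : cvgc (cnbhs x) (fun y => \sum_(i < m.+1) c i y) (\sum_(i < m.+1) c i x).
    apply: (cvgc_sum (f := c) (a := fun i => c i x)) => i.
    by apply: cvgcM; [|apply: cvgc_conj]; exact: cvgc_tuple_coord.
  by have /cvgc_ReIm[] := H.
by apply/funext.
Qed.

Lemma coord_open_ball (T : R) : coord_open (@tuple_coord R m.+1) [set x | sqn x < T].
Proof.
move=> x xT; apply: (@cvg_sqn x [set s | s < T]).
exact: lt_nbhsl.
Qed.

Lemma measurable_ball_fun (T : R) (f : mtuple -> R) :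
  (forall x, sqn x < T -> f y @[y --> cnbhs x] --> f x) ->
  measurable_fun setT (fun x => if sqn x < T then f x else 0).
Proof.
move=> cf; have mB := measurable_coord_open (@measurable_tuple_coord R m.+1) (@coord_open_ball T).
have := measurable_fun_coord (@measurable_tuple_coord R m.+1) (@coord_open_ball T) cf.
move=> /(measurable_restrictT _ mB).
rewrite (_ : _ \_ _ = (fun x => if sqn x < T then f x else 0))//.
apply/funext => x; rewrite patchE; case: ifP => xT; first by rewrite ifT//; move: xT; rewrite inE.
by rewrite ifF//; apply/negP => h; move/negP: xT; apply; rewrite inE.
Qed.

Variables (M : 'M[C]_m.+1) (T r : R) (g : 'rV[C]_m.+1 -> C) (k : nat).
Hypotheses (uM : M \is unitarymx) (r0 : 0 < r) (rT : r ^+ 2 < T).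
Hypothesis dg : forall Z, sqnorm Z < T -> hdiff g Z.
Local Notation u := (row ord_max M).

Let cvg_g (x : mtuple) : sqn x < T ->
  cvgc (cnbhs x) (fun y => g (std_coord_map y)) (g (std_coord_map x)).
Proof.
move=> xT; have FF : Filter (cnbhs x) by exact: coord_nbhs_filter.
apply: (@cvge_hdiff _ _ _ _ _ (@std_coord_map R m.+1) _ g); first exact: cvge_std_coord_map.
by apply: dg; rewrite -sqn_sqnorm.
Qed.

Let cvg_dot (x : mtuple) :
  cvgc (cnbhs x) (fun y => dotmx (std_coord_map y) u) (dotmx (std_coord_map x) u).
Proof.
have FF : Filter (cnbhs x) by exact: coord_nbhs_filter.
apply: (@cvge_hdiff _ _ _ _ _ (@std_coord_map R m.+1) _ (fun Z => dotmx Z u)).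
  exact: cvge_std_coord_map.
by apply: hdiff_lin; exact: bounded_lin_dotmx.
Qed.

Let cvg_pair (x : mtuple) : sqn x < T ->
  cvgc (cnbhs x) (fun y => g (std_coord_map y) * ((dotmx (std_coord_map y) u ^+ k)^*)%C)
    (g (std_coord_map x) * ((dotmx (std_coord_map x) u ^+ k)^*)%C).
Proof.
move=> xT; have FF : Filter (cnbhs x) by exact: coord_nbhs_filter.
apply: cvgcM; first exact: cvg_g.
by apply: cvgc_conj; apply: cvgcX; exact: cvg_dot.
Qed.

Lemma measurable_ball_pairing :
  measurable_fun setT (fun x => complex.Re (ball_pairing T g u k x)) /\
  measurable_fun setT (fun x => complex.Im (ball_pairing T g u k x)).
Proof.
pose F x := g (std_coord_map x) * ((dotmx (std_coord_map x) u ^+ k)^*)%C.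
split.
  rewrite (_ : (fun x => _) = (fun x => if sqn x < T then complex.Re (F x) else 0)).
    by apply: measurable_ball_fun => x xT; have /cvgc_ReIm[] := cvg_pair xT.
  by apply/funext => x; rewrite /ball_pairing; case: ifP.
rewrite (_ : (fun x => _) = (fun x => if sqn x < T then complex.Im (F x) else 0)).
  by apply: measurable_ball_fun => x xT; have /cvgc_ReIm[] := cvg_pair xT.
by apply/funext => x; rewrite /ball_pairing; case: ifP.
Qed.

Let gsq (x : mtuple) : R := if sqn x < T then normc (g (std_coord_map x)) ^+ 2 else 0.
Let dsq (x : mtuple) : R := if sqn x < T then normc (dotmx (std_coord_map x) u) ^+ 2 ^+ k else 0.

Let gsq_ge0 x : 0 <= gsq x.
Proof. by rewrite /gsq; case: ifP => // _; rewrite exprn_ge0 ?normc_ge0. Qed.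

Let dsq_ge0 x : 0 <= dsq x.
Proof. by rewrite /dsq; case: ifP => // _; rewrite !exprn_ge0 ?normc_ge0. Qed.

Let measurable_gsq : measurable_fun setT gsq.
Proof.
apply: measurable_ball_fun => x xT; have FF : Filter (cnbhs x) by exact: coord_nbhs_filter.
have H := cvgc_normc (cvgcX 2 (cvg_g xT)).
rewrite -normcX (_ : (fun y => _) = (fun y => normc (g (std_coord_map y) ^+ 2))); first exact: H.
by apply/funext => y; rewrite -normcX.
Qed.

Lemma measurable_direction_moment : measurable_fun setT dsq.
Proof.
apply: measurable_ball_fun => x xT; have FF : Filter (cnbhs x) by exact: coord_nbhs_filter.
have H := cvgc_normc (cvgcX (2 * k) (cvg_dot x)).
have E (z : C) : normc z ^+ 2 ^+ k = normc (z ^+ (2 * k)) by rewrite normcX exprM.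
pose f (y : mtuple) := normc (dotmx (std_coord_map y) u ^+ (2 * k)).
have ff : f = (fun y => normc (dotmx (std_coord_map y) u) ^+ 2 ^+ k).
  by apply/funext => y; rewrite E.
have H' : f y @[y --> cnbhs x] --> f x by exact: H.
by rewrite ff in H'.
Qed.

Let Mo : R := T ^+ (k + m.+1) / 'C(k + m.+1, m.+1)%:R.
Let j : C := taylor_coef (fun l => g (l *: u)) r k.

Let T_ge0 : 0 <= T.
Proof. by apply: le_trans (ltW rT); exact: sqr_ge0. Qed.

(** Cauchy-Schwarz inequality between g and <., u>^k.  It is obtained by
    integrating 2 Re(conj(j) g conj(<., u>^k)) <= |g|^2 + |j|^2 |<., u>|^(2k): by
    ball_integral the left-hand side has integral 2 |j|^2 Mo. *)
Lemma ball_bessel : ((normc j ^+ 2 * Mo)%:E <= \int[vol]_x (gsq x)%:E)%E.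
Proof.
have [Ioo|] := eqVneq (\int[vol]_x (gsq x)%:E)%E +oo%E; first by rewrite Ioo leey.
move=> Ioo.
have absE (f : mtuple -> R) : (forall x, 0 <= f x) ->
    (\int[vol]_x `|(f x)%:E| = \int[vol]_x (f x)%:E)%E.
  by move=> f0; apply: eq_integral => x _; rewrite gee0_abs// lee_fin.
have gi : vol.-integrable setT (EFin \o gsq).
  apply/integrableP; split; first exact/measurable_EFinP.
  by rewrite absE// ltey.
have di : vol.-integrable setT (EFin \o dsq).
  apply/integrableP; split; first by apply/measurable_EFinP; exact: measurable_direction_moment.
  by rewrite absE// (integral_direction_moment k uM T_ge0) ltry.
have jdi : vol.-integrable setT (EFin \o (fun x => normc j ^+ 2 * dsq x)).
  by apply: eq_integrable (integrableZl measurableT (normc j ^+ 2) di) => // x _; rewrite /= EFinM.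
have bp_le x (t : R) : 2 * t * normc (ball_pairing T g u k x) <= gsq x + t ^+ 2 * dsq x.
  rewrite /ball_pairing /gsq /dsq; case: ifP => _; last by rewrite normc0; lra.
  rewrite normcM normc_conj normcX exprAC -subr_ge0.
  set a := normc (g _); set b := normc _ ^+ k.
  have -> : a ^+ 2 + t ^+ 2 * b ^+ 2 - 2 * t * (a * b) = (a - t * b) ^+ 2 by ring.
  exact: sqr_ge0.
have [mR mI] := measurable_ball_pairing.
have bi : cintegrable vol (ball_pairing T g u k).
  apply: (cintegrable_dom mR mI (g := fun x => gsq x + dsq x)).
    move=> x; have := bp_le x 1; have := normc_ge0 (ball_pairing T g u k x); lra.
  exact: (integrableD measurableT gi di).
have bE := ball_integral uM r0 rT dg bi.
have [bR bI] := bi.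
pose w x := complex.Re j * complex.Re (ball_pairing T g u k x) +
  complex.Im j * complex.Im (ball_pairing T g u k x).
have bRZ := integrableZl measurableT (complex.Re j) bR.
have bIZ := integrableZl measurableT (complex.Im j) bI.
have wi : vol.-integrable setT (EFin \o w) by exact: (integrableD measurableT bRZ bIZ).
have wE : Rintegral vol setT w = normc j ^+ 2 * Mo.
  rewrite /w RintegralD//.
  rewrite !RintegralZl//.
  have -> : Rintegral vol setT (fun x => complex.Re (ball_pairing T g u k x)) = complex.Re (j * Mo%:C).
    by rewrite -bE.
  have -> : Rintegral vol setT (fun x => complex.Im (ball_pairing T g u k x)) = complex.Im (j * Mo%:C).
    by rewrite -bE.
  rewrite normc_sqr; case: (j) => a b /=.
  by ring.
have w_le x : 2 * w x <= gsq x + normc j ^+ 2 * dsq x.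
  apply: le_trans (bp_le x (normc j)); rewrite -mulrA ler_pM2l// -normc_conj -normcM.
  apply: le_trans (Re_le_normc _); rewrite /w.
  case: (ball_pairing _ _ _ _ _) => c d; case: (j) => a b /=; apply: le_trans (ler_norm _).
  by rewrite mulNr opprK.
have wi2 : vol.-integrable setT (EFin \o (fun x => 2 * w x)).
  by apply: eq_integrable (integrableZl measurableT 2 wi) => // x _; rewrite /= EFinM.
have := le_Rintegral measurableT wi2 (integrableD measurableT gi jdi) (fun x _ => w_le x).
have -> : Rintegral vol setT (fun x => 2 * w x) = 2 * (normc j ^+ 2 * Mo).
  by rewrite -wE; exact: RintegralZl.
have -> : Rintegral vol setT (fun x => gsq x + normc j ^+ 2 * dsq x) =
    Rintegral vol setT gsq + normc j ^+ 2 * Mo.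
  have -> : Mo = Rintegral vol setT dsq.
    by rewrite /Rintegral (integral_direction_moment k uM T_ge0).
  have <- : Rintegral vol setT (fun x => normc j ^+ 2 * dsq x) = normc j ^+ 2 * Rintegral vol setT dsq.
    exact: RintegralZl.
  exact: RintegralD.
rewrite -[X in (_ <= X)%E]fineK; last exact: (integrable_fin_num measurableT gi).
rewrite lee_fin -/(Rintegral vol setT gsq); lra.
Qed.

End BesselOnBall.

(** * Fubini's theorem on fibered domains *)

Section FiberedDomain.
Context d1 d2 (X : measurableType d1) (Y : measurableType d2) (R : realType).
Variable mu : {sigma_finite_measure set X -> \bar R}.
Variable nu : {sigma_finite_measure set Y -> \bar R}.
Variables (A : set X) (s : X -> Y -> bool).
Local Notation C := R[i].
Local Notation D := [set u : X * Y | A u.1 /\ s u.1 u.2].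
Hypotheses (mA : measurable A) (mD : measurable D).

Definition fiber {T} (t0 : T) (f : X * Y -> T) (x : X) (y : Y) : T :=
  if s x y then f (x, y) else t0.

Let patch_fiber (f : X * Y -> R) x y :
  ((f \_ D) (x, y) = if x \in A then fiber 0 f x y else 0).
Proof.
rewrite patchE /fiber; have [xA|xA] := boolP (x \in A); last first.
  rewrite ifF//; apply/negP; rewrite inE => -[/= xA' _].
  by move/negP: xA; apply; rewrite inE.
have -> : ((x, y) \in D) = s x y; last by [].
apply/idP/idP; first by rewrite inE => -[].
by move=> sxy; rewrite inE; split => //; move: xA; rewrite inE.
Qed.

Let integral_patch (f : X * Y -> R) x :
  (\int[nu]_y ((f \_ D) (x, y))%:E =
   ((fun x => \int[nu]_y (fiber 0 f x y)%:E) \_ A) x)%E.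
Proof.
rewrite patchE; case: ifPn => xA.
  by apply: eq_integral => y _; rewrite patch_fiber xA.
by apply: integral0_eq => y _; rewrite patch_fiber (negbTE xA).
Qed.

Lemma tonelli_fibered (f : X * Y -> R) : measurable_fun D f -> (forall u, 0 <= f u) ->
  measurable_fun A (fun x => \int[nu]_y (fiber 0 f x y)%:E)%E /\
  (\int[prod_measure mu nu]_(u in D) (f u)%:E =
   \int[mu]_(x in A) \int[nu]_y (fiber 0 f x y)%:E)%E.
Proof.
move=> mf f0; have /measurable_EFinP mfD := (measurable_restrictT _ mD).1 mf.
have fD0 u : (0 <= ((f \_ D) u)%:E)%E by rewrite lee_fin patchE; case: ifP.
split.
  apply/(measurable_restrictT _ mA).
  have := measurable_fun_fubini_tonelli_F (m2 := nu) _ mfD fD0.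
  rewrite /fubini_F (_ : (fun x => _) = (fun x => \int[nu]_y (fiber 0 f x y)%:E)%E \_ A)//.
  by apply/funext => x; exact: integral_patch.
rewrite integral_mkcond [RHS]integral_mkcond.
rewrite (restrict_EFin f) (tonelli_prod mu nu mfD fD0).
by apply: eq_integral => x _; exact: integral_patch.
Qed.

(** For almost all x the fiber of F is integrable, so that the hypothesis on
    complex_integral applies. *)
Lemma fubini_fibered (F : X * Y -> C) (g : X -> C) :
  (prod_measure mu nu).-integrable D (fun u => (complex.Re (F u))%:E) ->
  (prod_measure mu nu).-integrable D (fun u => (complex.Im (F u))%:E) ->
  measurable_fun A (fun x => complex.Re (g x)) ->
  measurable_fun A (fun x => complex.Im (g x)) ->
  (forall x, A x -> cintegrable nu (fiber 0 F x) ->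
     complex_integral nu setT (fiber 0 F x) = g x) ->
  complex_integral (prod_measure mu nu) D F = complex_integral mu A g.
Proof.
move=> iR iI mR mI H.
have [iR' iI'] : (mu \x nu)%E.-integrable setT (EFin \o ((complex.Re (R := R) \o F) \_ D)) /\
    (mu \x nu)%E.-integrable setT (EFin \o ((complex.Im (R := R) \o F) \_ D)).
  by split; rewrite -restrict_EFin; apply/(integrable_mkcond _ mD).
have aeR := ae_integrable1 iR'; have aeI := ae_integrable1 iI'.
have ReF x y : fiber 0 (complex.Re (R := R) \o F) x y = complex.Re (fiber 0 F x y).
  by rewrite /fiber; case: ifP.
have ImF x y : fiber 0 (complex.Im (R := R) \o F) x y = complex.Im (fiber 0 F x y).
  by rewrite /fiber; case: ifP.
have key x : nu.-integrable setT (fun y => (((complex.Re (R := R) \o F) \_ D) (x, y))%:E) ->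
    nu.-integrable setT (fun y => (((complex.Im (R := R) \o F) \_ D) (x, y))%:E) ->
    (\int[nu]_y (((complex.Re (R := R) \o F) \_ D) (x, y))%:E =
       (((complex.Re (R := R) \o g) \_ A) x)%:E)%E /\
    (\int[nu]_y (((complex.Im (R := R) \o F) \_ D) (x, y))%:E =
       (((complex.Im (R := R) \o g) \_ A) x)%:E)%E.
  move=> h1 h2; rewrite !integral_patch !patchE; case: ifPn => xA; last by [].
  have ER : (fun y => (((complex.Re (R := R) \o F) \_ D) (x, y))%:E) =
      (fun y => (complex.Re (fiber 0 F x y))%:E).
    by apply/funext => y; rewrite patch_fiber xA ReF.
  have EI : (fun y => (((complex.Im (R := R) \o F) \_ D) (x, y))%:E) =
      (fun y => (complex.Im (fiber 0 F x y))%:E).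
    by apply/funext => y; rewrite patch_fiber xA ImF.
  rewrite ER in h1; rewrite EI in h2.
  have Ax : A x by move: xA; rewrite inE.
  have [gR gI] : complex.Re (complex_integral nu setT (fiber 0 F x)) = complex.Re (g x) /\
      complex.Im (complex_integral nu setT (fiber 0 F x)) = complex.Im (g x).
    by rewrite (H x Ax (conj h1 h2)).
  split.
    rewrite /= -gR /= /Rintegral fineK; last exact: (integrable_fin_num measurableT h1).
    by apply: eq_integral => y _; rewrite ReF.
  rewrite /= -gI /= /Rintegral fineK; last exact: (integrable_fin_num measurableT h2).
  by apply: eq_integral => y _; rewrite ImF.
have mgR : measurable_fun setT (EFin \o ((complex.Re (R := R) \o g) \_ A)).
  by apply/measurable_EFinP/(measurable_restrictT _ mA).
have mgI : measurable_fun setT (EFin \o ((complex.Im (R := R) \o g) \_ A)).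
  by apply/measurable_EFinP/(measurable_restrictT _ mA).
rewrite /complex_integral; f_equal; rewrite [LHS]Rintegral_mkcond [RHS]Rintegral_mkcond /Rintegral; f_equal.
  transitivity (\int[mu]_x fubini_F nu (EFin \o ((complex.Re (R := R) \o F) \_ D)) x)%E.
    by rewrite (integral12_prod_meas1 iR').
  apply: ae_eq_integral => //; first exact: (measurable_fubini_F iR').
  by apply: filterS2 aeR aeI => x h1 h2 _; have [] := key x h1 h2.
transitivity (\int[mu]_x fubini_F nu (EFin \o ((complex.Im (R := R) \o F) \_ D)) x)%E.
  by rewrite (integral12_prod_meas1 iI').
apply: ae_eq_integral => //; first exact: (measurable_fubini_F iI').
by apply: filterS2 aeR aeI => x h1 h2 _; have [] := key x h1 h2.
Qed.

End FiberedDomain.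

(** * The Hartogs domain and Taylor coefficients in a direction *)

Section HartogsCoordinates.
Variables (R : realType) (n m : nat) (V : normedModType R[i]) (e : 'I_n -> V).
Variables (Omega : set V) (p : V -> R).
Hypotheses (oOmega : open Omega) (cp : {within Omega, continuous p}).
Local Notation C := R[i].
Local Notation bnbhs := (coord_nbhs (@tuple_coord R n)).
Local Notation hcoord := (coord_sum (@tuple_coord R n) (@tuple_coord R m.+1)).
Local Notation hnbhs := (coord_nbhs hcoord).
Local Notation base := (coord_map e @^-1` Omega).
Local Notation hartogs := (prod_coord_map e (m:=m.+1) @^-1` hartogs_domain Omega p (m := m.+1)).

Lemma continuous_weight z : Omega z -> {for z, continuous p}.
Proof.
by move=> Oz; move: cp; rewrite continuous_open_subspace// => /(_ z); apply; rewrite inE.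
Qed.

Lemma cvge_coord_map x : cvge (bnbhs x) (coord_map e) (coord_map e x).
Proof.
have FF : Filter (bnbhs x) by exact: coord_nbhs_filter.
apply: (cvge_sum (f := fun i y => to_complex (tnth y i) *: e i)
  (a := fun i => to_complex (tnth x i) *: e i)) => i.
by apply: cvgeZ; exact: cvgc_tuple_coord.
Qed.

Lemma cvge_prod_coord_map u :
  cvge (hnbhs u) (@prod_coord_map R V n e m.+1) (prod_coord_map e u).
Proof.
have FF : Filter (hnbhs u) by exact: coord_nbhs_filter.
apply: cvge_pair => d d0.
  exact: (@coord_nbhs_fst _ _ _ _ _ _ _ _ _ _ _ (cvge_coord_map u.1 d0)).
exact: (@coord_nbhs_snd _ _ _ _ _ _ _ _ _ _ _ (cvge_std_coord_map u.2 d0)).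
Qed.

Lemma coord_open_base : coord_open (@tuple_coord R n) base.
Proof.
move=> x Ox; have FF : Filter (bnbhs x) by exact: coord_nbhs_filter.
by apply: (cvge_nbhs (cvge_coord_map x)); exact: open_nbhs_nbhs.
Qed.

Lemma measurable_base : measurable base.
Proof. exact: (measurable_coord_open (@measurable_tuple_coord R n) coord_open_base). Qed.

Lemma cvg_weight x : base x -> p (coord_map e y) @[y --> bnbhs x] --> p (coord_map e x).
Proof.
move=> Ox; have FF : Filter (bnbhs x) by exact: coord_nbhs_filter.
exact: (cvge_continuous (cvge_coord_map x) (continuous_weight Ox)).
Qed.

Lemma hartogsE : hartogs = [set u | base u.1 /\ sqn u.2 < p (coord_map e u.1)].
Proof.
apply/funext => u; rewrite /= /hartogs_domain /preimage /=.
by rewrite sqn_sqnorm.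
Qed.

(** Near a point of the domain, |Z|^2 and p(z) are separated by the mean c of
    their values there. *)
Lemma coord_open_hartogs : coord_open hcoord hartogs.
Proof.
rewrite hartogsE => u [Ou pu]; have FF : Filter (hnbhs u) by exact: coord_nbhs_filter.
pose c := (sqn u.2 + p (coord_map e u.1)) / 2.
have h1 : bnbhs u.1 [set y | c < p (coord_map e y)].
  apply: (@cvg_weight u.1 Ou [set s | c < s]).
  by apply: lt_nbhsr; rewrite /c; lra.
have h2 : coord_nbhs (@tuple_coord R m.+1) u.2 [set y | sqn y < c].
  by apply: (@cvg_sqn R m u.2 [set s | s < c]); apply: lt_nbhsl; rewrite /c; lra.
have h3 := coord_open_base Ou.
have H1 := @coord_nbhs_fst _ _ _ _ _ _ _ _ (@tuple_coord R m.+1) u _ h1.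
have H3 := @coord_nbhs_fst _ _ _ _ _ _ _ _ (@tuple_coord R m.+1) u _ h3.
have H2 := @coord_nbhs_snd _ _ _ _ _ _ _ (@tuple_coord R n) _ u _ h2.
have H := filterI (F := hnbhs u) (filterI (F := hnbhs u) H1 H3) H2.
have [r r0 Hr] := H; exists r => // v /Hr[[/= a d] b]; split => //; exact: lt_trans b a.
Qed.

Let measurable_hcoord j : measurable_fun setT (hcoord j).
Proof. by apply: measurable_coord_sum => i; exact: measurable_tuple_coord. Qed.

Lemma measurable_hartogs : measurable hartogs.
Proof. exact: (measurable_coord_open measurable_hcoord coord_open_hartogs). Qed.

Lemma measurable_base_fun (F : n.-tuple (Rpair R) -> C) :
  (forall x, base x -> cvgc (bnbhs x) F (F x)) ->
  measurable_fun base (fun x => complex.Re (F x)) /\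
  measurable_fun base (fun x => complex.Im (F x)).
Proof.
move=> cF; split; apply: (measurable_fun_coord (@measurable_tuple_coord R n) coord_open_base) => x Ox;
  by have /cvgc_ReIm[] := cF x Ox.
Qed.

Lemma measurable_hartogs_fun (F : n.-tuple (Rpair R) * m.+1.-tuple (Rpair R) -> C) :
  (forall u, hartogs u -> cvgc (hnbhs u) F (F u)) ->
  measurable_fun hartogs (fun u => complex.Re (F u)) /\
  measurable_fun hartogs (fun u => complex.Im (F u)).
Proof.
move=> cF; split; apply: (measurable_fun_coord measurable_hcoord coord_open_hartogs) => u Hu;
  by have /cvgc_ReIm[] := cF u Hu.
Qed.

Lemma cvgc_base (f : V -> C) x : hdiff f (coord_map e x) ->
  cvgc (bnbhs x) (fun y => f (coord_map e y)) (f (coord_map e x)).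
Proof.
have FF : Filter (bnbhs x) by exact: coord_nbhs_filter.
exact: (cvge_hdiff (cvge_coord_map x)).
Qed.

Lemma cvgc_hartogs (f : V * 'rV[C]_m.+1 -> C) u : hdiff f (prod_coord_map e u) ->
  cvgc (hnbhs u) (fun v => f (prod_coord_map e v)) (f (prod_coord_map e u)).
Proof.
have FF : Filter (hnbhs u) by exact: coord_nbhs_filter.
exact: (cvge_hdiff (cvge_prod_coord_map u)).
Qed.

End HartogsCoordinates.

Section DirectionCoefficients.
Variables (R : realType) (m : nat) (V : normedModType R[i]).
Variables (Omega : set V) (p : V -> R).
Hypotheses (oOmega : open Omega) (cp : {within Omega, continuous p}).
Hypothesis p_gt0 : forall z, Omega z -> 0 < p z.
Local Notation C := R[i].
Local Notation D := (hartogs_domain Omega p (m := m.+1)).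
Variables (f : V * 'rV[C]_m.+1 -> C) (u : 'rV[C]_m.+1).
Hypotheses (df : forall x, D x -> hdiff f x) (u1 : sqnorm u = 1).

Definition half_radius (z : V) : R := Num.sqrt (p z) / 2.

(** By taylor_coef_radius the radius does not matter; the half radius keeps the circle
    inside the fiber over z. *)
Definition direction_coef k z : C := taylor_coef (fun l => f (z, l *: u)) (half_radius z) k.

Lemma half_radius_gt0 z : Omega z -> 0 < half_radius z.
Proof. by move=> Oz; rewrite divr_gt0// sqrtr_gt0 p_gt0. Qed.

Lemma half_radius_lt z : Omega z -> half_radius z ^+ 2 < p z.
Proof.
move=> Oz; have := p_gt0 Oz; rewrite /half_radius expr_div_n sqr_sqrtr; last exact/ltW/p_gt0.
by lra.
Qed.

Lemma direction_in z (l : C) : Omega z -> normc l ^+ 2 < p z -> D (z, l *: u).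
Proof. by move=> Oz lp; split => //=; rewrite sqnormZ u1 mulr1. Qed.

Lemma cdiff_direction z (l : C) : Omega z -> normc l ^+ 2 < p z ->
  cdiff (fun l => f (z, l *: u)) l.
Proof.
move=> Oz lp; have E (b : C) : (z, b *: u) = (z, 0) + b *: (0, u) :> V * 'rV[C]_m.+1.
  by rewrite -[RHS]/(z + b *: 0, 0 + b *: u) scaler0 addr0 add0r.
have -> : (fun l => f (z, l *: u)) = (fun b => f ((z, 0) + b *: (0, u))).
  by apply/funext => b; rewrite E.
by apply: hdiff_line; rewrite -E; apply: df; exact: direction_in.
Qed.

Lemma hdiff_slice z (b : 'rV[C]_m.+1) : D (z, b) -> hdiff (fun y => f (y, b)) z.
Proof.
move=> Dz; have E (y : V) : (y, b) = (0, b) + (y, 0) :> V * 'rV[C]_m.+1.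
  by rewrite -[RHS]/(0 + y, b + 0) add0r addr0.
have -> : (fun y => f (y, b)) = (fun y => f ((0, b) + (y, 0))).
  by apply/funext => y; rewrite E.
apply: (hdiff_affine (L := fun y : V => (y, 0 : 'rV[C]_m.+1))); first exact: bounded_lin_inl.
by rewrite -E; exact: df.
Qed.

(** Near z0 the coefficient can be computed on a fixed circle, so small that f is
    bounded near it by continuity at (z0, 0). *)
Lemma hdiff_direction_coef k z0 : Omega z0 -> hdiff (direction_coef k) z0.
Proof.
move=> Oz0; have D0 : D (z0, 0 : 'rV[C]_m.+1).
  by have := @direction_in z0 0 Oz0; rewrite scale0r; apply; rewrite normc0 expr0n p_gt0.
have [d1 d10 H1] := hdiff_continuous (df D0) ltr01.
have p0 := p_gt0 Oz0.
have [d2 d20 H2] : exists2 d, 0 < d & forall z, nrm (z - z0) < d -> Omega z /\ p z0 / 2 < p z.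
  apply/nbhs_nrmP; apply: filterI; first exact: open_nbhs_nbhs.
  have cz : p z @[z --> z0] --> p z0 by exact: (continuous_weight oOmega cp Oz0).
  by apply: (cz [set s | p z0 / 2 < s]); apply: lt_nbhsr; lra.
pose d := Num.min d1 d2; have d0 : 0 < d by rewrite lt_min d10.
(* |l| <= s keeps (z, l u) within d1 of (z0, 0), and inside the domain since
   s^2 < p z0 / 2 < p z; moreover s is at most half_radius z. *)
pose s := Num.min (d1 / (2 * (1 + nrm u))) (Num.sqrt (p z0 / 8)).
have nu : 0 < 1 + nrm u by rewrite ltr_wpDr// nrm_ge0.
have s0 : 0 < s by rewrite lt_min divr_gt0 ?mulr_gt0//= sqrtr_gt0; lra.
have s1 : s * (1 + nrm u) < d1.
  have : s <= d1 / (2 * (1 + nrm u)) by rewrite ge_min lexx.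
  rewrite ler_pdivlMr ?mulr_gt0//; lra.
have s2 : s ^+ 2 <= p z0 / 8.
  rewrite -[leRHS]sqr_sqrtr; last by lra.
  have ss : s <= Num.sqrt (p z0 / 8) by rewrite ge_min lexx orbT.
  by apply: ler_pM => //; exact: ltW.
have near z : nrm (z - z0) < d -> Omega z /\ p z0 / 2 < p z.
  by rewrite lt_min => /andP[_ /H2].
have lp z (l : C) : nrm (z - z0) < d -> normc l <= s -> normc l ^+ 2 < p z.
  move=> /near[_ pz] ls; apply: (@le_lt_trans _ _ (s ^+ 2)); last by lra.
  by apply: ler_pM; rewrite ?normc_ge0.
have bound z (l : C) : nrm (z - z0) < d -> normc l <= s -> normc (f (z, l *: u)) <= normc (f (z0, 0)) + 1.
  move=> zd ls; have : nrm ((z, l *: u) - (z0, 0)) < d1.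
    rewrite -[X in nrm X]/(z - z0, l *: u - 0); apply/nrm_pair; split => /=.
      by move: zd; rewrite lt_min => /andP[].
    rewrite subr0 nrmZ; apply: le_lt_trans s1.
    by apply: ler_pM; rewrite ?normc_ge0 ?nrm_ge0// lerDr.
  move=> /H1 h; have := normcD (f (z, l *: u) - f (z0, 0)) (f (z0, 0)).
  by rewrite subrK; lra.
apply: (@hdiff_near _ _ (fun z => taylor_coef (fun l => f (z, l *: u)) s k) _ _ d d0) => [z zd|].
  have [Oz pz] := near z zd.
  apply: taylor_coef_radius => //.
    rewrite /half_radius ler_pdivlMr// -(@ler_pXn2r _ 2)// ?nnegrE ?sqrtr_ge0 ?mulr_ge0 ?ltW//.
    by rewrite exprMn sqr_sqrtr; lra.
  move=> w wr; apply: cdiff_direction => //; apply: le_lt_trans (half_radius_lt Oz).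
  by apply: ler_pM; rewrite ?normc_ge0.
apply: (@hdiff_taylor_coef _ _ (fun z l => f (z, l *: u)) z0 d s
  (normc (f (z0, 0)) + 1) k d0 s0).
- by move=> y b yd bs; apply: cdiff_direction; [have [] := near y yd|exact: lp].
- by move=> y b yd bs; exact: bound.
- move=> y b yd bs; apply: hdiff_slice; apply: direction_in; first by have [] := near y yd.
  by apply: lp => //; exact: ltW.
- by rewrite subrr nrm0.
Qed.

End DirectionCoefficients.

(** * The coefficients as elements of weighted Bergman spaces *)

Section SquareIntegrable.
Context d (X : measurableType d) (R : realType) (mu : {measure set X -> \bar R}).
Variables (A : set X) (q : X -> R).
Hypotheses (mA : measurable A) (q0 : forall x, A x -> 0 <= q x).
Local Notation C := R[i].

Lemma square_integrable_cross (F G : X -> C) :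
  measurable_fun A (fun x => normc (F x) ^+ 2 * q x) ->
  measurable_fun A (fun x => normc (G x) ^+ 2 * q x) ->
  measurable_fun A (fun x => complex.Re (F x * (G x)^* * (q x)%:C)) ->
  measurable_fun A (fun x => complex.Im (F x * (G x)^* * (q x)%:C)) ->
  (\int[mu]_(x in A) (normc (F x) ^+ 2 * q x)%:E < +oo)%E ->
  (\int[mu]_(x in A) (normc (G x) ^+ 2 * q x)%:E < +oo)%E ->
  mu.-integrable A (fun x => (complex.Re (F x * (G x)^* * (q x)%:C))%:E) /\
  mu.-integrable A (fun x => (complex.Im (F x * (G x)^* * (q x)%:C))%:E).
Proof.
move=> mF mG mR mI Foo Goo.
have sq_int (H : X -> C) : measurable_fun A (fun x => normc (H x) ^+ 2 * q x) ->
    (\int[mu]_(x in A) (normc (H x) ^+ 2 * q x)%:E < +oo)%E ->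
    mu.-integrable A (EFin \o (fun x => normc (H x) ^+ 2 * q x)).
  move=> mH Hoo; apply/integrableP; split; first exact/measurable_EFinP.
  rewrite (eq_integral (fun x => (normc (H x) ^+ 2 * q x)%:E)) => [//|x].
  rewrite inE => Ax; rewrite /= ger0_norm// mulr_ge0 ?q0// exprn_ge0// normc_ge0.
  by [].
have FGi := integrableD mA (sq_int F mF Foo) (sq_int G mG Goo).
have le_FG x : A x -> normc (F x * (G x)^* * (q x)%:C) <=
    normc (F x) ^+ 2 * q x + normc (G x) ^+ 2 * q x.
  move=> Ax; rewrite !normcM normc_conj normc_real ger0_norm ?q0// -mulrDl.
  apply: ler_wpM2r; first exact: q0.
  have := normc_ge0 (F x); have := normc_ge0 (G x); have := sqr_ge0 (normc (F x) - normc (G x)).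
  by move: (normc (F x)) (normc (G x)) => a b h1 h2 h3; nra.
split; apply: le_integrable FGi => //; do ?exact/measurable_EFinP; move=> x Ax;
  rewrite /= lee_fin; apply: le_trans (ler_norm _); apply: le_trans (le_FG x Ax).
  exact: Re_le_normc.
exact: Im_le_normc.
Qed.

Lemma complex_integralZ (c : R) (F : X -> C) :
  mu.-integrable A (fun x => (complex.Re (F x))%:E) ->
  mu.-integrable A (fun x => (complex.Im (F x))%:E) ->
  complex_integral mu A (fun x => c%:C * F x) = c%:C * complex_integral mu A F.
Proof.
move=> iR iI; rewrite /complex_integral.
have RE x : complex.Re (c%:C * F x) = c * complex.Re (F x).
  by case: (F x) => a b /=; rewrite mul0r subr0.
have IE x : complex.Im (c%:C * F x) = c * complex.Im (F x).
  by case: (F x) => a b /=; rewrite mul0r addr0.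
rewrite (_ : (fun x => complex.Re _) = (fun x => c * complex.Re (F x))); last exact/funext.
rewrite (_ : (fun x => complex.Im _) = (fun x => c * complex.Im (F x))); last exact/funext.
by rewrite !RintegralZl//; simpc.
Qed.

End SquareIntegrable.

Section TaylorScale.
Variable R : realType.
Local Notation C := R[i].

Lemma taylor_coefZ (f : C -> C) (c : C) r k : 0 < r ->
  (forall w, normc w <= r -> cdiff f w) ->
  taylor_coef (fun l => c * f l) r k = c * taylor_coef f r k.
Proof.
move=> r0 df; rewrite /taylor_coef -circle_meanZ.
  by apply: eq_circle_mean => t; rewrite mulrA.
apply: (@cseg_contM R 0 (2 * pi) (fun t => f (circle r t)) (fun t => (circle r t ^+ k)^-1)).
  apply: cdiff_cseg_cont => [t _|]; last exact: cseg_cont_circle.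
  by apply: df; rewrite normc_circle.
apply: cseg_contV; first by apply: cseg_contX; exact: cseg_cont_circle.
by move=> t _; rewrite expf_neq0// circle_neq0.
Qed.

End TaylorScale.

Section Projection.
Variables (R : realType) (n m : nat) (V : normedModType R[i]) (e : 'I_n -> V).
Variables (Omega : set V) (p : V -> R).
Hypotheses (oOmega : open Omega) (cp : {within Omega, continuous p}).
Hypothesis p_gt0 : forall z, Omega z -> 0 < p z.
Local Notation C := R[i].
Local Notation D := (hartogs_domain Omega p (m := m.+1)).
Local Notation base := (coord_map e @^-1` Omega).
Local Notation phi := (prod_coord_map e (m:=m.+1)).
Local Notation hartogs := (phi @^-1` D).
Local Notation muV := (@volume_Cn R n).
Local Notation muZ := (@volume_Cn R m.+1).
Local Notation mu := (prod_measure muV muZ).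
Variable k : nat.
Local Notation W := (fun z => p z ^+ (k + m.+1)).
Local Notation bin := ('C(k + m.+1, m.+1)%:R : R).
Local Notation base_space := (bergman_space muV (coord_map e) Omega W).
Local Notation hartogs_space := (bergman_space mu phi D (fun=> 1)).
Variable M : 'M[C]_m.+1.
Hypothesis uM : M \is unitarymx.
Local Notation u := (row ord_max M).
Local Notation j f := (direction_coef p f u k).

Lemma sqnorm_row_unitary : sqnorm u = 1.
Proof.
rewrite rowE sqnorm_unitary// -[delta_mx _ _]scale1r sqnorm_e_last normc1.
exact: expr1n.
Qed.

Let s (x : n.-tuple (Rpair R)) (y : m.+1.-tuple (Rpair R)) := sqn y < p (coord_map e x).

Let measurable_fibered : measurable [set v | base v.1 /\ s v.1 v.2].
Proof. by have := measurable_hartogs (m := m) e oOmega cp; rewrite hartogsE. Qed.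

Let mbase : measurable base := measurable_base e oOmega.

Let bin_gt0 : 0 < bin.
Proof. by rewrite ltr0n bin_gt0 leq_addl. Qed.

Let hartogs_hdiff f : hartogs_space f -> forall x, D x -> hdiff f x.
Proof. by move=> [hf _] x Dx; apply: differentiable_hdiff; exact: hf. Qed.

Let base_hdiff h : base_space h -> forall x, Omega x -> hdiff h x.
Proof. by move=> [hf _] x Dx; apply: differentiable_hdiff; exact: hf. Qed.

Let cvgc_W x : base x ->
  cvgc (coord_nbhs (@tuple_coord R n) x) (fun y => (W (coord_map e y))%:C) (W (coord_map e x))%:C.
Proof.
move=> Ox; have FF : Filter (coord_nbhs (@tuple_coord R n) x) by exact: coord_nbhs_filter.
have H := cvgcX (k + m.+1) (cvgc_real (cvg_weight oOmega cp Ox)).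
have E (y : n.-tuple (Rpair R)) : (W (coord_map e y))%:C = (p (coord_map e y))%:C ^+ (k + m.+1) :> C.
  by rewrite (rmorphXn (real_complex R)).
rewrite (E x) (_ : (fun y => (W (coord_map e y))%:C) = (fun y => (p (coord_map e y))%:C ^+ (k + m.+1))).
  exact: H.
exact/funext.
Qed.

Let measurable_cross (f h : V -> C) :
  (forall x, Omega x -> hdiff f x) -> (forall x, Omega x -> hdiff h x) ->
  measurable_fun base (fun x => complex.Re
    (f (coord_map e x) * (h (coord_map e x))^* * (W (coord_map e x))%:C)) /\
  measurable_fun base (fun x => complex.Im
    (f (coord_map e x) * (h (coord_map e x))^* * (W (coord_map e x))%:C)).
Proof.
move=> df dh.
apply: (measurable_base_fun oOmega (F := fun x =>
  f (coord_map e x) * (h (coord_map e x))^* * (W (coord_map e x))%:C)) => x Ox.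
have FF : Filter (coord_nbhs (@tuple_coord R n) x) by exact: coord_nbhs_filter.
apply: cvgcM; last exact: cvgc_W.
by apply: cvgcM; [|apply: cvgc_conj]; apply: cvgc_base; [exact: df|exact: dh].
Qed.

Let Re_square (z : C) (a : R) : complex.Re (z * z^* * a%:C) = normc z ^+ 2 * a.
Proof. by rewrite mulcJ /= mul0r subr0. Qed.

Let measurable_square (f : V -> C) : (forall x, Omega x -> hdiff f x) ->
  measurable_fun base (fun x => normc (f (coord_map e x)) ^+ 2 * W (coord_map e x)).
Proof.
move=> df; have [H _] := measurable_cross df df.
by rewrite (_ : (fun x => _) = (fun x => complex.Re
    (f (coord_map e x) * (f (coord_map e x))^* * (W (coord_map e x))%:C)));
  [exact: H|apply/funext => x; rewrite Re_square].
Qed.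

Let measurable_hartogs_cross (f h : V * 'rV[C]_m.+1 -> C) :
  (forall x, D x -> hdiff f x) -> (forall x, D x -> hdiff h x) ->
  measurable_fun hartogs (fun x => complex.Re (f (phi x) * (h (phi x))^* * 1%:C)) /\
  measurable_fun hartogs (fun x => complex.Im (f (phi x) * (h (phi x))^* * 1%:C)).
Proof.
move=> df dh; apply: (measurable_hartogs_fun oOmega cp (F := fun x =>
  f (phi x) * (h (phi x))^* * 1%:C)) => x Dx.
have FF : Filter (coord_nbhs (coord_sum (@tuple_coord R n) (@tuple_coord R m.+1)) x).
  exact: coord_nbhs_filter.
apply: cvgcM; last exact: cvgc_cst.
by apply: cvgcM; [|apply: cvgc_conj]; apply: cvgc_hartogs; [exact: df|exact: dh].
Qed.

Let measurable_hartogs_square (f : V * 'rV[C]_m.+1 -> C) : (forall x, D x -> hdiff f x) ->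
  measurable_fun hartogs (fun x => normc (f (phi x)) ^+ 2 * 1).
Proof.
move=> df; have [H _] := measurable_hartogs_cross df df.
by rewrite (_ : (fun x => _) = (fun x => complex.Re (f (phi x) * (f (phi x))^* * 1%:C)));
  [exact: H|apply/funext => x; rewrite Re_square].
Qed.

Let fiber_hdiff f z : (forall x, D x -> hdiff f x) -> Omega z ->
  forall Z, sqnorm Z < p z -> hdiff (fun Z => f (z, Z)) Z.
Proof.
move=> df Oz Z ZT; have E (Y : 'rV[C]_m.+1) : (z, Y) = (z, 0) + (0, Y).
  by rewrite -[RHS]/(z + 0, 0 + Y) addr0 add0r.
have -> : (fun Z => f (z, Z)) = (fun Z => f ((z, 0) + (0, Z))).
  by apply/funext => Y; rewrite E.
apply: (hdiff_affine (L := fun Y : 'rV[C]_m.+1 => (0 : V, Y))); first exact: bounded_lin_inr.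
by rewrite -E; apply: df.
Qed.

(** Bessel's inequality on each fiber, integrated over the base. *)
Lemma direction_coef_bergman f : hartogs_space f -> base_space (j f).
Proof.
move=> Hf; have df := hartogs_hdiff Hf.
have dj z : Omega z -> hdiff (j f) z.
  by move=> Oz; exact: (hdiff_direction_coef oOmega cp p_gt0 df sqnorm_row_unitary k Oz).
split; first by move=> z Oz; apply: hdiff_differentiable; exact: dj.
pose fsq v := normc (f (phi v)) ^+ 2 * 1.
have fsq0 v : 0 <= fsq v by rewrite /fsq mulr1 exprn_ge0// normc_ge0.
have mfsq : measurable_fun [set v | base v.1 /\ s v.1 v.2] fsq.
  by have := measurable_hartogs_square df; rewrite hartogsE.
have [mI IE] := tonelli_fibered muV muZ mbase measurable_fibered mfsq fsq0.
have [_] := Hf; rewrite hartogsE => fin.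
have {fin} : (\int[muV]_(x in base) \int[muZ]_y (fiber s 0 fsq x y)%:E < +oo)%E.
  by rewrite -IE.
move=> fin; apply: (@le_lt_trans _ _
  (\int[muV]_(x in base) (bin%:E * \int[muZ]_y (fiber s 0 fsq x y)%:E))%E).
  apply: ge0_le_integral => //.
  - move=> x Ox; rewrite lee_fin mulr_ge0 ?exprn_ge0 ?normc_ge0//.
    exact/ltW/p_gt0.
  - by apply/measurable_EFinP; exact: (measurable_square dj).
  - exact: measurable_funeM.
  - move=> x Ox; pose z := coord_map e x.
    have B := ball_bessel k uM (half_radius_gt0 p_gt0 Ox) (half_radius_lt p_gt0 Ox)
      (fiber_hdiff df Ox).
    have -> : (\int[muZ]_y (fiber s 0 fsq x y)%:E =
        \int[muZ]_y (if sqn y < p z then normc (f (z, std_coord_map y)) ^+ 2 else 0)%:E)%E.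
      apply: eq_integral => y _; rewrite /fiber /s /fsq.
      by case: ifP => _ //; rewrite mulr1.
    have bin0 : (0 <= bin%:E)%E by rewrite lee_fin ltW.
    apply: (le_trans _ (lee_wpmul2l bin0 B)).
    rewrite -EFinM lee_fin le_eqVlt; apply/orP; left; apply/eqP.
    have b0 : bin != 0 by rewrite gt_eqF.
    rewrite -/z /direction_coef; move: b0; move: ('C(_, _)%:R) (p z ^+ _) => a b a0.
    by field.
rewrite ge0_integralZl//; last by move=> x _; apply: integral_ge0 => y _; rewrite lee_fin /fiber; case: ifP.
  by apply: lte_mul_pinfty => //; rewrite lee_fin ltW.
Qed.

Definition direction_product (h : V -> C) (zZ : V * 'rV[C]_m.+1) : C :=
  h zZ.1 * dotmx zZ.2 u ^+ k.

Lemma hdiff_direction_product h : base_space h ->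
  forall x, D x -> hdiff (direction_product h) x.
Proof.
move=> Hh [z Z] [/= Oz _]; have dh := base_hdiff Hh Oz.
apply: hdiffM.
  have -> : (fun y : V * 'rV[C]_m.+1 => h y.1) = (fun y => h (0 + y.1)).
    by apply/funext => y; rewrite add0r.
  by apply: hdiff_affine; [exact: bounded_lin_fst|rewrite add0r].
apply: hdiffX.
have -> : (fun y : V * 'rV[C]_m.+1 => dotmx y.2 u) = (fun y => dotmx (0 + y.2) u).
  by apply/funext => y; rewrite add0r.
apply: (hdiff_affine (f := fun Y => dotmx Y u)); first exact: bounded_lin_snd.
by apply: hdiff_lin; exact: bounded_lin_dotmx.
Qed.

(** The fiber integral of |<Z, u>|^(2k) is a multiple of p^(k+m+1). *)
Lemma direction_product_bergman h : base_space h -> hartogs_space (direction_product h).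
Proof.
move=> Hh; have dF := hdiff_direction_product Hh.
split; first by move=> x Dx; apply: hdiff_differentiable; exact: dF.
pose Fsq v := normc (direction_product h (phi v)) ^+ 2 * 1.
have Fsq0 v : 0 <= Fsq v by rewrite /Fsq mulr1 exprn_ge0// normc_ge0.
have mFsq : measurable_fun [set v | base v.1 /\ s v.1 v.2] Fsq.
  by have := measurable_hartogs_square dF; rewrite hartogsE.
have [_] := tonelli_fibered muV muZ mbase measurable_fibered mFsq Fsq0.
rewrite hartogsE => ->; have [_ hfin] := Hh.
have mh : measurable_fun base (fun x => (normc (h (coord_map e x)) ^+ 2 * W (coord_map e x))%:E).
  by apply/measurable_EFinP; exact: (measurable_square (base_hdiff Hh)).
have fiberE x : base x -> (\int[muZ]_y (fiber s 0 Fsq x y)%:E =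
    (bin^-1)%:E * (normc (h (coord_map e x)) ^+ 2 * W (coord_map e x))%:E)%E.
  move=> Ox; pose T := p (coord_map e x); have T0 : 0 <= T by exact/ltW/p_gt0.
  pose dsq (y : m.+1.-tuple (Rpair R)) : R :=
    if sqn y < T then normc (dotmx (std_coord_map y) u) ^+ 2 ^+ k else 0.
  have mdsq : measurable_fun setT dsq by exact: measurable_direction_moment.
  have dsq0 y : 0 <= dsq y by rewrite /dsq; case: ifP => // _; rewrite !exprn_ge0 ?normc_ge0.
  transitivity (\int[muZ]_y ((normc (h (coord_map e x)) ^+ 2)%:E * (dsq y)%:E))%E.
    apply: eq_integral => y _; rewrite -EFinM /fiber /s /Fsq /dsq -/T; f_equal.
    case: ifP => _; last by rewrite mulr0.
    by rewrite /direction_product /= mulr1 normcM normcX exprMn exprAC.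
  rewrite ge0_integralZl//; last 3 first.
  - exact/measurable_EFinP.
  - by move=> y _; rewrite lee_fin.
  - by rewrite lee_fin exprn_ge0// normc_ge0.
  rewrite (integral_direction_moment k uM T0) -!EFinM; f_equal.
  by rewrite mulrA mulrC.
rewrite (eq_integral (fun x => (bin^-1)%:E *
    (normc (h (coord_map e x)) ^+ 2 * W (coord_map e x))%:E)%E) => [|x]; last first.
  by rewrite inE => Ox; exact: fiberE.
rewrite ge0_integralZl//.
- by apply: lte_mul_pinfty => //; rewrite lee_fin invr_ge0 ltW.
- move=> x Ox; rewrite lee_fin mulr_ge0 ?exprn_ge0 ?normc_ge0//.
  exact/ltW/p_gt0.
Qed.

(** By Fubini, and ball_integral on the fiber over z applied to the holomorphic
    function conj(h(z)) f(z, .), this being a constant multiple of f on the fiber. *)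
Lemma direction_pairing f h : hartogs_space f -> base_space h ->
  bergman_dot mu phi D (fun=> 1) f (direction_product h) =
  (bin^-1)%:C * bergman_dot muV (coord_map e) Omega W (j f) h.
Proof.
move=> Hf Hh; have df := hartogs_hdiff Hf; have dh := base_hdiff Hh.
have Hj := direction_coef_bergman Hf; have dj := base_hdiff Hj.
have HF := direction_product_bergman Hh; have dF := hdiff_direction_product Hh.
have W0 x : base x -> 0 <= W (coord_map e x) by move=> Ox; rewrite exprn_ge0// ltW// p_gt0.
have [jhR jhI] := measurable_cross dj dh.
have [iR iI] := square_integrable_cross mbase W0 (measurable_square dj) (measurable_square dh)
  jhR jhI Hj.2 Hh.2.
have [fFR fFI] := measurable_hartogs_cross df dF.
have [iR' iI'] := square_integrable_cross (measurable_hartogs (m := m) e oOmega cp)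
  (fun _ _ => ler01) (measurable_hartogs_square df) (measurable_hartogs_square dF)
  fFR fFI Hf.2 HF.2.
rewrite /bergman_dot -(complex_integralZ mbase _ iR iI).
rewrite hartogsE in iR' iI' *.
apply: (fubini_fibered mbase measurable_fibered iR' iI').
- rewrite (_ : (fun x => _) = (fun x => bin^-1 * complex.Re
    (j f (coord_map e x) * (h (coord_map e x))^* * (W (coord_map e x))%:C))).
    exact: measurable_funM.
  by apply/funext => x; case: (_ * (W _)%:C) => a b /=; rewrite mul0r subr0.
- rewrite (_ : (fun x => _) = (fun x => bin^-1 * complex.Im
    (j f (coord_map e x) * (h (coord_map e x))^* * (W (coord_map e x))%:C))).
    exact: measurable_funM.
  by apply/funext => x; case: (_ * (W _)%:C) => a b /=; rewrite mul0r addr0.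
move=> x Ox; pose z := coord_map e x; pose T := p z.
pose g Z := (h z)^* * f (z, Z).
have E : fiber s 0 (fun v => f (phi v) * (direction_product h (phi v))^* * 1%:C) x =
    ball_pairing T g u k.
  apply/funext => y; rewrite /fiber /ball_pairing /s -/z -/T.
  have [_|_] := boolP (sqn y < T); last by [].
  have EF : direction_product h (phi (x, y)) = h z * dotmx (std_coord_map y) u ^+ k by [].
  have cM (a b : C) : conjc (a * b) = conjc a * conjc b by exact: rmorphM.
  rewrite mulr1 EF /g; transitivity (f (phi (x, y)) *
      (conjc (h z) * conjc (dotmx (std_coord_map y) u ^+ k))).
    exact: (f_equal (fun a => f (phi (x, y)) * a) (cM _ _)).
  by rewrite mulrA [f _ * _]mulrC.
rewrite E => iB.
have dg Z : sqnorm Z < T -> hdiff g Z.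
  by move=> ZT; apply: hdiffZ; exact: fiber_hdiff.
rewrite (ball_integral uM (half_radius_gt0 p_gt0 Ox) (half_radius_lt p_gt0 Ox) dg iB).
rewrite (@taylor_coefZ R (fun l => f (z, l *: u)) (h z)^* (half_radius p z) k); last first.
- move=> w wr; apply: (cdiff_direction df sqnorm_row_unitary) => //.
  apply: le_lt_trans (half_radius_lt p_gt0 Ox).
  by apply: ler_pM; rewrite ?normc_ge0.
- exact: (half_radius_gt0 p_gt0 Ox).
have -> : (T ^+ (k + m.+1) / bin)%:C = bin^-1%:C * (T ^+ (k + m.+1))%:C :> C.
  by rewrite mulrC (rmorphM (real_complex R)).
rewrite -[taylor_coef _ _ _]/(j f z) -/z -/T.
by move: (j f z) ((T ^+ _)%:C) (bin^-1%:C) => a b c; ring.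
Qed.

End Projection.

(** * The virtual Bergman kernel *)

Section KernelSymmetry.
Context d (X : measurableType d) (R : realType) (mu : {measure set X -> \bar R}).
Variables (E : normedModType R[i]) (phi : X -> E) (D : set E) (q : E -> R).

(** When the integral of the positive or of the negative part is infinite, both sides
    are 0. *)
Lemma RintegralN_all (A : set X) (g : X -> R) :
  Rintegral mu A (fun x => - g x) = - Rintegral mu A g.
Proof.
rewrite /Rintegral -fineN [in LHS]integralE [in RHS]integralE.
have -> : (fun x => (- g x)%:E)^\+%E = (fun x => (g x)%:E)^\-%E by rewrite -funeposN.
have -> : (fun x => (- g x)%:E)^\-%E = (fun x => (g x)%:E)^\+%E by rewrite -funenegN.
have := integral_ge0 mu (fun x (_ : A x) => funepos_ge0 (EFin \o g) x).
have := integral_ge0 mu (fun x (_ : A x) => funeneg_ge0 (EFin \o g) x).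
rewrite /comp; move: (\int[mu]_(x in A) ((fun x => (g x)%:E)^\- x))%E.
move: (\int[mu]_(x in A) ((fun x => (g x)%:E)^\+ x))%E.
by move=> [a| |] [b| |] //= _ _; rewrite ?opprB ?oppr0.
Qed.

Lemma bergman_dot_conj f g :
  bergman_dot mu phi D q g f = conjc (bergman_dot mu phi D q f g).
Proof.
rewrite /bergman_dot /complex_integral /= -RintegralN_all.
f_equal; f_equal; apply/funext => x; case: (f _) (g _) => a b [c e] /=; ring.
Qed.

Lemma kernel_conj (K : E -> E -> R[i]) : is_reproducing_kernel mu phi D q K ->
  forall z w, D z -> D w -> conjc (K w z) = K z w.
Proof.
move=> HK z w Dz Dw; have [Kz Rz] := HK z Dz; have [Kw Rw] := HK w Dw.
by rewrite (Rz _ Kw) (Rw _ Kz) -bergman_dot_conj.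
Qed.

End KernelSymmetry.

Section NormalizedDerivative.
Variable R : realType.
Local Notation C := R[i].

Lemma iter_termwise_derivative m (a : nat -> C) k :
  k`!%:R * iter m (@termwise_derivative R) a k = (k + m)`!%:R * a (k + m)%N.
Proof.
elim: m k => [|m IH] k; first by rewrite addn0.
rewrite iterS {1}/termwise_derivative mulrA -natrM mulnC -factS IH.
by rewrite addSnnS.
Qed.

Lemma normalized_derivativeE m (a : nat -> C) k :
  normalized_derivative m a k = 'C(k + m, m)%:R * a (k + m)%N.
Proof.
have f0 i : i`!%:R != 0 :> C by rewrite pnatr_eq0 -lt0n fact_gt0.
apply: (mulfI (f0 k)); apply: (mulfI (f0 m)); rewrite /normalized_derivative.
transitivity (k`!%:R * iter m (@termwise_derivative R) a k).
  by move: (f0 m) (iter _ _ _ _) => h x; move: (m`!%:R) h => y h; field.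
rewrite iter_termwise_derivative !mulrA; f_equal.
rewrite -(bin_fact (leq_addl k m)) addnK (natrM _ 'C(_, _)) (natrM _ m`!).
by move: ('C(_, _)%:R) (m`!%:R) (k`!%:R) => x y z; ring.
Qed.

End NormalizedDerivative.

Section TaylorSeries.
Variable R : realType.
Local Notation C := R[i].

Lemma taylor_series_cvg (f : C -> C) (r : R) (z : C) : 0 < r -> normc z < r ->
  (forall w, normc w <= r -> cdiff f w) ->
  cvgc \oo (fun N => \sum_(k < N) taylor_coef f r k * z ^+ k) (f z).
Proof.
move=> r0 zr df; have [M M0 fM] := circle_bounded df r0.
pose B := 2 * (M * (r / (r - normc z))).
have H : B * (normc z / r) ^+ N @[N --> \oo] --> (0 : R).
  rewrite -[X in _ --> X](mulr0 B); apply: cvgMr; apply: cvg_expr.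
  by rewrite ger0_norm ?divr_ge0 ?normc_ge0 ?ltW// ltr_pdivrMr ?mul1r.
move=> e e0; have : \forall N \near \oo, B * (normc z / r) ^+ N < e.
  by apply: (H [set s | s < e]); exact: lt_nbhsl.
apply: filterS => N /= hN; apply: le_lt_trans hN.
apply: (le_trans (taylor_remainder N r0 zr df fM)).
by rewrite le_eqVlt; apply/orP; left; apply/eqP; rewrite /B; ring.
Qed.

End TaylorSeries.

Section VirtualKernel.
Variables (R : realType) (n m : nat) (V : normedModType R[i]) (e : 'I_n -> V).
Variables (Omega : set V) (p : V -> R).
Hypotheses (oOmega : open Omega) (cp : {within Omega, continuous p}).
Hypothesis p_gt0 : forall z, Omega z -> 0 < p z.
Local Notation C := R[i].
Local Notation D := (hartogs_domain Omega p (m := m.+1)).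
Local Notation muV := (@volume_Cn R n).
Local Notation mu := (prod_measure muV (@volume_Cn R m.+1)).
Local Notation phi := (prod_coord_map e (m:=m.+1)).
Variables (K : nat -> V -> V -> C) (Khat : V * 'rV[C]_m.+1 -> V * 'rV[C]_m.+1 -> C).
Hypothesis HK : forall k, is_reproducing_kernel muV (coord_map e) Omega (fun z => p z ^+ k) (K k).
Hypothesis HKhat : is_reproducing_kernel mu phi D (fun=> 1) Khat.

Let conjcM (a b : C) : conjc (a * b) = conjc a * conjc b.
Proof. exact: rmorphM. Qed.

Let conjcX (a : C) i : conjc (a ^+ i) = conjc a ^+ i.
Proof. exact: rmorphXn. Qed.

Lemma dotmx_conj l (Z W : 'rV[C]_l) : conjc (dotmx Z W) = dotmx W Z.
Proof.
rewrite !dotmx_sum (raddf_sum (@conjc R)); apply: eq_bigr => i _.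
etransitivity; first exact: conjcM.
by rewrite mulrC; f_equal; exact: conjcK.
Qed.

(** The scalar product of direction_product k M (K (k + m.+1) ^~ z) and of the kernel
    of the Hartogs domain is computed twice: by the reproducing property of Khat, and
    by direction_pairing followed by the reproducing property of K (k + m.+1). *)
Lemma direction_coef_kernel (M : 'M[C]_m.+1) z w W k : M \is unitarymx ->
  Omega z -> D (w, W) ->
  direction_coef p (Khat^~ (w, W)) (row ord_max M) k z =
  'C(k + m.+1, m.+1)%:R * K (k + m.+1) z w * dotmx (row ord_max M) W ^+ k.
Proof.
move=> uM Oz Dw; have [HG Grep] := HKhat Dw; have [Ow _] := Dw.
have [Hh hrep] := HK (k + m.+1) Oz.
have Hj := direction_coef_bergman oOmega cp p_gt0 k uM HG.
have pairE := direction_pairing oOmega cp p_gt0 uM HG Hh.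
have HF := direction_product_bergman oOmega cp p_gt0 uM Hh.
rewrite (hrep _ Hj).
have b0 : ('C(k + m.+1, m.+1)%:R : R) != 0 by rewrite pnatr_eq0 -lt0n bin_gt0 leq_addl.
have bE : ('C(k + m.+1, m.+1)%:R : C) = ('C(k + m.+1, m.+1)%:R : R)%:C.
  by rewrite (rmorph_nat (real_complex R)).
have := Grep _ HF; rewrite bergman_dot_conj pairE => FE.
have : conjc (direction_product k M ((K (k + m.+1))^~ z) (w, W)) =
    ('C(k + m.+1, m.+1)%:R : R)^-1%:C * bergman_dot muV (coord_map e) Omega
      (fun z => p z ^+ (k + m.+1)) (direction_coef p (Khat^~ (w, W)) (row ord_max M) k)
      ((K (k + m.+1))^~ z).
  by rewrite FE conjcK.
rewrite /direction_product conjcM conjcX.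
rewrite (kernel_conj (HK (k + m.+1)) Oz Ow) dotmx_conj bE => E.
rewrite -mulrA E mulrA -(rmorphM (real_complex R)) mulfV// mul1r.
by [].
Qed.

(** Taylor's formula along the complex line through Z = a u, on a circle of radius
    r with |a| < r and r^2 < p z. *)
Lemma virtual_kernel_cvg z Z w W : D (z, Z) -> D (w, W) ->
  cvgc \oo (power_series (Lm_coef K m.+1 z w) (dotmx Z W)) (Khat (z, Z) (w, W)).
Proof.
move=> [/= Oz Zp] Dw; have [M [a [uM ZE]]] := unitary_direction Z.
pose u := row ord_max M; have u1 : sqnorm u = 1 := sqnorm_row_unitary uM.
have aZ : normc a ^+ 2 = sqnorm Z by rewrite ZE sqnormZ u1 mulr1.
pose r := Num.sqrt ((sqnorm Z + p z) / 2); have p0 := p_gt0 Oz.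
have Z0 := sqnorm_ge0 Z.
have r2 : r ^+ 2 = (sqnorm Z + p z) / 2 by rewrite sqr_sqrtr//; lra.
have r0 : 0 < r by rewrite sqrtr_gt0; lra.
have lt_sq (x y : R) : 0 <= x -> 0 <= y -> x ^+ 2 < y ^+ 2 -> x < y.
  by move=> x0 y0; rewrite ltr_pXn2r.
have ar : normc a < r by apply: lt_sq; rewrite ?normc_ge0 ?ltW// r2 aZ; lra.
have hr : half_radius p z <= r.
  apply/ltW/lt_sq; [exact/ltW/(half_radius_gt0 p_gt0 Oz)|exact: ltW|].
  rewrite r2 /half_radius expr_div_n sqr_sqrtr; last exact: ltW.
  lra.
have [[Gd _] _] := HKhat Dw.
have dG x : D x -> hdiff (Khat^~ (w, W)) x.
  by move=> Dx; apply: differentiable_hdiff; exact: Gd.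
pose f l := Khat (z, l *: u) (w, W).
have df (l : C) : normc l <= r -> cdiff f l.
  move=> lr; apply: (cdiff_direction dG u1 Oz).
  apply: (@le_lt_trans _ _ (r ^+ 2)); last by rewrite r2; lra.
  by apply: ler_pM; rewrite ?normc_ge0.
have := taylor_series_cvg r0 ar df; rewrite {2}/f -ZE.
rewrite (_ : (fun N => _) = power_series (Lm_coef K m.+1 z w) (dotmx Z W))//.
apply/funext => N; rewrite /power_series /series /= big_mkord; apply: eq_bigr => k _.
rewrite -(taylor_coef_radius k (half_radius_gt0 p_gt0 Oz) hr df).
rewrite -[taylor_coef _ _ _]/(direction_coef p (Khat^~ (w, W)) (row ord_max M) k z).
rewrite direction_coef_kernel// /Lm_coef normalized_derivativeE /L0_coef.
rewrite -[LHS]mulrA; f_equal; rewrite -exprMn; f_equal.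
by rewrite [in RHS]ZE linearZl_LR/= mulrC.
Qed.

End VirtualKernel.

Lemma cvgc_limn (R : realType) (a : nat -> R[i]^o) (l : R[i]) :
  cvgc \oo a l -> cvgn a /\ l = limn a.
Proof.
move=> /cvg_normcP H; split; first exact: cvgP H.
by apply/esym; apply: cvg_lim H; exact: norm_hausdorff.
Qed.

Theorem theorem1p2 (R : realType) (n : nat) (V : normedModType R[i])
    (dot : {dot V for Num.conj}) (e : 'I_n -> V)
    (Omega : set V) (p : V -> R) (m : nat)
    (K : nat -> V -> V -> R[i])
    (Khat : (V * 'rV[R[i]]_m) -> (V * 'rV[R[i]]_m) -> R[i]) :
  (forall v : V, `|v| ^+ 2 = dot v v) ->
  orthonormal_basis dot e ->
  is_domain Omega ->
  {within Omega, continuous p} ->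
  (forall z, Omega z -> 0 < p z) ->
  (1 <= m)%N ->
  (forall k : nat,
    is_reproducing_kernel (volume_Cn n) (coord_map e) Omega
      (fun z => p z ^+ k) (K k)) ->
  is_reproducing_kernel (prod_measure (volume_Cn n) (volume_Cn m))
    (prod_coord_map e (m:=m)) (hartogs_domain Omega p (m:=m)) (fun=> 1) Khat ->
  (forall (z : V) (Z : 'rV[R[i]]_m) (w : V) (W : 'rV[R[i]]_m),
    hartogs_domain Omega p (z, Z) -> hartogs_domain Omega p (w, W) ->
    cvgn (power_series (Lm_coef K m z w) (dotmx Z W)) /\
    Khat (z, Z) (w, W) = Lm K m z w (dotmx Z W)) /\
  (forall (z : V) (Z : 'rV[R[i]]_m),
    hartogs_domain Omega p (z, Z) ->
    cvgn (power_series (diagLm_coef K m z) (sqnorm Z)%:C) /\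
    Khat (z, Z) (z, Z) = diagLm K m z (sqnorm Z)).
Proof.
case: m Khat => [//|m' Khat'] _ _ [oOmega _ _] cp p_gt0 _ HK HKhat.
have main z Z w W : hartogs_domain Omega p (z, Z) -> hartogs_domain Omega p (w, W) ->
    cvgn (power_series (Lm_coef K m'.+1 z w) (dotmx Z W)) /\
    Khat' (z, Z) (w, W) = Lm K m'.+1 z w (dotmx Z W).
  by move=> Dz Dw; apply: cvgc_limn; exact: (virtual_kernel_cvg oOmega cp p_gt0 HK HKhat).
split=> // z Z Dz; have := main z Z z Z Dz Dz.
by rewrite dotmx_sqnorm.
Qed.
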